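(* Assume $\mathbb{E}[L^\alpha+R^\alpha]=1$ and $\mathcal{S}(\gamma)<0$, for some $\gamma$ with $1\le\alpha<\gamma\le2$ or $\alpha<\gamma\le1$. Assume further that $$\lim_{x\to+\infty}x^\alpha(1-F_0(x))=c^+<+\infty,\qquad \lim_{x\to-\infty}|x|^\alpha F_0(x)=c^-<+\infty$$ if $\alpha\neq1$, or that $\mathbb{E}[|X_0|^\gamma]<+\infty$ if $\alpha=1$, respectively. Then $$\mathcal{W}_\gamma(V_t,V_\infty)\le A\,\mathcal{W}_\gamma(X_0,V_\infty)\,e^{-Bt|\mathcal{S}(\gamma)|},$$ with $A=B=1$ if $\gamma\le1$, or $A=2^{1/\gamma}$ and $B=1/\gamma$ otherwise.
   Context: $(L,R)$ is a fixed random vector with $L,R\ge 0$, and $\alpha\in(0,2]$. For $s\ge0$, $\mathcal{S}(s)=\mathbb{E}[L^s+R^s]-1\in[-1,\infty]$ (with $0^0=0$). The initial condition $X_0$ is a real random variable with distribution function $F_0$ and characteristic function $\phi_0$. On a sufficiently large probability space $(\Omega,\mathcal{F},P)$ let the following stochastically independent families be given: i.i.d. random variables $(X_n)_{n\ge1}$ with distribution function $F_0$; i.i.d. random vectors $(L_n,R_n)_{n\ge1}$ distributed as $(L,R)$; independent random variables $(I_n)_{n\ge1}$ with $I_n$ uniform on $\{1,\dots,n\}$; a process $(\nu_t)_{t\ge0}$ with values in the positive integers and $P\{\nu_t=n\}=e^{-t}(1-e^{-t})^{n-1}$. Define $\beta_{1,1}=1$, $(\beta_{1,2},\beta_{2,2})=(L_1,R_1)$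 and, for $n\ge2$, $$(\beta_{1,n+1},\dots,\beta_{n+1,n+1})=(\beta_{1,n},\dots,\beta_{I_n-1,n},L_n\beta_{I_n,n},R_n\beta_{I_n,n},\beta_{I_n+1,n},\dots,\beta_{n,n}).$$ For $t\ge0$ put $V_t=\sum_{j=1}^{\nu_t}\beta_{j,\nu_t}X_j$. The characteristic function $\phi(t;\cdot)$ of $V_t$ is the unique solution of $\partial_t\phi(t;\xi)+\phi(t;\xi)=\mathbb{E}[\phi(t;L\xi)\phi(t;R\xi)]$, $\phi(0;\cdot)=\phi_0$. $V_\infty$ is the limit in distribution of $V_t$ as $t\to\infty$. The Wasserstein distance of order $\gamma>0$ between real random variables $X,Y$ is $\mathcal{W}_\gamma(X,Y)=\inf_{(X',Y')}(\mathbb{E}|X'-Y'|^\gamma)^{1/\max(\gamma,1)}$, the infimum being over all pairs $(X',Y')$ of real random variables whose marginal distribution functions are the same as those of $X$ and $Y$, respectively; it may be infinite. *)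

(* Defs.v *)
From HB Require Import structures.
From mathcomp Require Import all_boot all_order all_algebra.
From mathcomp Require Import all_classical all_reals all_analysis.

Set Implicit Arguments.
Unset Strict Implicit.
Unset Printing Implicit Defensive.

Import Order.TTheory GRing.Theory Num.Theory.
Import numFieldNormedType.Exports.

Local Open Scope classical_set_scope.
Local Open Scope ring_scope.

Section independence.
Context d (T : measurableType d) (R : realType) (P : probability T R).

(* Stochastic independence of the set systems C k, k in D: the product rule
   over every finite subfamily. *)
Definition independent (K : eqType) (D : set K) (C : K -> set (set T)) : Prop :=
  forall (s : seq K) (A : K -> set T), uniq s ->
    (forall k, k \in s -> D k /\ C k (A k)) ->
    P (\bigcap_(k in [set` s]) A k) = (\prod_(k <- s) P (A k))%E.

Definition sigma_rv d' (T' : measurableType d') (X : T -> T') : set (set T) :=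
  preimage_set_system setT X measurable.

Definition sigma_family (K : Type) (D : set K) d' (T' : measurableType d')
    (X : K -> T -> T') : set (set T) :=
  <<s \bigcup_(k in D) sigma_rv (X k) >>.

End independence.

Section real_random_variables.
Context (R : realType).

(* The limit may live on another probability space. *)
Definition cvg_in_distribution d (T : measurableType d) (P : probability T R)
    (V : R -> {RV P >-> R}) d' (T' : measurableType d') (Q : probability T' R)
    (Z : {RV Q >-> R}) : Prop :=
  forall x : R, {for x, continuous (cdf Z)} ->
    cdf (V t) x @[t --> +oo] --> cdf Z x.

Definition wasserstein (gamma : R)
    d1 (T1 : measurableType d1) (P1 : probability T1 R) (X : {RV P1 >-> R})
    d2 (T2 : measurableType d2) (P2 : probability T2 R) (Y : {RV P2 >-> R})
    : \bar R :=
  ereal_inf [set e : \bar R |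
    exists (d : measure_display) (T : measurableType d) (Q : probability T R)
           (X' Y' : {RV Q >-> R}),
      [/\ cdf X' =1 cdf X, cdf Y' =1 cdf Y &
          e = ('E_Q[fun w => (`|X' w - Y' w| `^ gamma)%R]
                 `^ ((Num.max gamma 1)^-1)%R)%E]].

(* The convention is 0^0 = 0, whereas 0 `^ 0 = 1. *)
Definition pow00 (x s : R) : R := if x == 0 then 0 else x `^ s.

Definition moment d (T : measurableType d) (P : probability T R)
    (LR : {RV P >-> (R * R)%type}) (s : R) : \bar R :=
  ('E_P[fun w => (pow00 (LR w).1 s + pow00 (LR w).2 s)%R])%E.

Definition calS d (T : measurableType d) (P : probability T R)
    (LR : {RV P >-> (R * R)%type}) (s : R) : \bar R :=
  (moment LR s - 1)%E.

End real_random_variables.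

Section probabilistic_representation.
Context d (T : measurableType d) (R : realType) (P : probability T R).
Variables (LR : nat -> {RV P >-> (R * R)%type}) (I : nat -> {RV P >-> nat}).
Variables (X : nat -> {RV P >-> R}) (nu : R -> {RV P >-> nat}).

(* All indices start from 1, as in the mathematics: [beta n j] is the weight
   beta_{j,n} for 1 <= j <= n (other values of j and n are junk, as are the
   values on the null set where I m is not in {1, ..., m}). *)
Fixpoint beta (n j : nat) (w : T) : R :=
  if n isn't m.+1 then 0
  else if m == 0%N then (if j == 1%N then 1 else 0)
  else if m == 1%N then
    (if j == 1%N then (LR 1 w).1 else if j == 2%N then (LR 1 w).2 else 0)
  else if (j < I m w)%N then beta m j w
  else if j == I m w then (LR m w).1 * beta m (I m w) w
  else if j == (I m w).+1 then (LR m w).2 * beta m (I m w) w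
  else beta m j.-1 w.

Definition V_fun (t : R) (w : T) : R :=
  \sum_(1 <= j < (nu t w).+1) beta (nu t w) j w * X j w.

Lemma measurable_fun_nat_index (N : {RV P >-> nat}) (f : nat -> T -> R) :
  (forall n, measurable_fun setT (f n)) ->
  measurable_fun setT (fun w => f (N w) w).
Proof.
move=> mf _ B mB; rewrite setTI.
rewrite (_ : _ @^-1` _ = \bigcup_n (N @^-1` [set n] `&` f n @^-1` B)).
  apply: bigcup_measurable => n _; apply: measurableI.
    by rewrite -[X in measurable X]setTI; exact: measurable_funPT.
  by rewrite -[X in measurable X]setTI; exact: mf.
apply/seteqP; split=> [w Bw|w [n _ [/= <-]]] //.
by exists (N w).
Qed.

Lemma measurable_beta n j : measurable_fun setT (beta n j).
Proof.
have mL m : measurable_fun setT (fun w => (LR m w).1).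
  by apply: measurableT_comp => //; exact: measurable_funPT.
have mR m : measurable_fun setT (fun w => (LR m w).2).
  by apply: measurableT_comp => //; exact: measurable_funPT.
elim: n j => [|m IH] j /=; first exact: measurable_cst.
case: (m == 0%N); first by case: (j == 1%N); exact: measurable_cst.
case: (m == 1%N).
  case: (j == 1%N) => //; case: (j == 2%N) => //; exact: measurable_cst.
apply: (@measurable_fun_nat_index (I m) (fun i w =>
  if (j < i)%N then beta m j w
  else if j == i then (LR m w).1 * beta m i w
  else if j == i.+1 then (LR m w).2 * beta m i w
  else beta m j.-1 w)) => i.
case: (j < i)%N => //.
case: (j == i); first exact: measurable_realfun.measurable_funM.
by case: (j == i.+1) => //; exact: measurable_realfun.measurable_funM.
Qed.

Lemma measurable_V t : measurable_fun setT (V_fun t).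
Proof.
apply: (@measurable_fun_nat_index (nu t) (fun n w =>
  \sum_(1 <= j < n.+1) beta n j w * X j w)) => n.
apply: measurable_sum => j; apply: measurable_realfun.measurable_funM => //.
exact: measurable_beta.
Qed.

HB.instance Definition _ t :=
  isMeasurableFun.Build _ _ _ _ (V_fun t) (measurable_V t).

Definition V (t : R) : {RV P >-> R} := V_fun t.

End probabilistic_representation.

(* Main.v *)
Require Import Defs.
From HB Require Import structures.
From mathcomp Require Import all_boot all_order all_algebra.
From mathcomp Require Import all_classical all_reals all_analysis.
From mathcomp Require Import measurable_realfun.
From mathcomp Require Import ring lra zify.

Set Implicit Arguments.
Unset Strict Implicit.
Unset Printing Implicit Defensive.

Import Order.TTheory GRing.Theory Num.Theory.
Import numFieldNormedType.Exports.

Local Open Scope classical_set_scope.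
Local Open Scope ring_scope.

(** Reading the recursion for the weights backwards, the last split turns two neighbouring summands
    x, y of V into one summand L x + R y.  On the event that nu_t = n + 1, the variable V_t is thus
    obtained from a row of n + 1 independent copies of X_0 by n merges of uniformly chosen adjacent
    pairs.  The merges draw a random binary tree u with n inner nodes, whose probability given n is
    [hook u], the product, over the inner nodes of u, of 1 / k where k is the number of inner nodes
    of the subtree rooted there.  Hence the law of V_t is the mixture, with weights [tree_weight t],
    of the laws [real_law u] obtained by performing along u independent smoothings
    x, y |-> L x + R y of copies of X_0 ([V_law]).

    The law of Vinfty is fixed by the smoothing along any tree.  Comparing the weights of a tree at
    the times t and t + s gives the growth inequality [law_growth].  When t tends to infinity, lower
    semicontinuity on open sets turns it into an inequality for the limit law.  Divided by the order
    of s and used for the two half-lines bounded by a point, it becomes an equality as s tends to 0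
    ([limit_law_fixed]).

    Start now from any coupling (X', Y') of X_0 and Vinfty, and smooth independent copies of the pair
    along the same random tree with the same weights.  The result is a coupling of V_t and Vinfty, in
    which Z = X' - Y' undergoes the same smoothing.  For gamma at most 1, subadditivity of
    |z| ^ gamma bounds the moment of Z along u by M times [cost u], where M = E|Z| ^ gamma.  For
    gamma in ]1, 2] and Z centered, the inequality
    |a + z| ^ gamma <= |a| ^ gamma + k z + 2 |z| ^ gamma, whose linear term integrates to zero,
    gives the same bound with 2 M ([tree_abs_moment]).  The mean of [cost] over the random tree with
    n + 1 leaves solves a two-term recursion, and its generating function gives the rate
    exp (- t |S(gamma)|) ([tree_cost_series]).

    It remains to see that Z is centered when gamma > 1 ([coupling_centered]).  If Z had mean
    delta <> 0, then smoothing Z - delta would give a quantity that tends to 0, so that the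
    difference of the two coupled variables would be asymptotically delta times the total weight of
    the leaves.  That weight is nonnegative and stays away from 0 with positive probability, because
    E[L + R] >= 1 and E[L ^ gamma + R ^ gamma] < 1 ([tree_mass_away]).  But two variables that are
    asymptotically ordered and converge to the same law have a difference tending to 0
    ([asymptotically_null_gap]). *)

(** * Random binary trees *)

Inductive tree : Type := Leaf | Node of tree & tree.

Fixpoint gtree_of_tree (u : tree) : GenTree.tree unit :=
  if u is Node l r then GenTree.Node 1 [:: gtree_of_tree l; gtree_of_tree r]
  else GenTree.Node 0 [::].

Fixpoint tree_of_gtree (g : GenTree.tree unit) : option tree :=
  match g with
  | GenTree.Node 0 [::] => Some Leaf
  | GenTree.Node _ [:: gl; gr] =>
    if (tree_of_gtree gl, tree_of_gtree gr) is (Some l, Some r)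
    then Some (Node l r) else None
  | _ => None
  end.

Lemma gtree_of_treeK : pcancel gtree_of_tree tree_of_gtree.
Proof. by elim=> //= l -> r ->. Qed.

HB.instance Definition _ := Countable.copy tree (pcan_type gtree_of_treeK).

Section random_binary_tree.
Context {R : realType}.
Implicit Types (u l r : tree) (s : seq tree) (f g : tree -> R).

(** One step of the backward recursion: the [i]-th and the next tree of the row become the two
    children of a new node. *)
Definition fuse i s : seq tree :=
  take i s ++ Node (nth Leaf s i) (nth Leaf s i.+1) :: drop i.+2 s.

(** Expectation of [f] at the tree that is left when the row [s] undergoes [n] merges, each at a
    uniformly chosen place. *)
Fixpoint forest_mean n s f : R :=
  if n is m.+1 then m.+1%:R^-1 * \sum_(i < m.+1) forest_mean m (fuse i s) f
  else f (head Leaf s).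

Fixpoint inner u : nat := if u is Node l r then (inner l + inner r).+1 else 0%N.

(** The hook weight, [inner u]! times which is the number of orders in which the inner nodes of [u]
    can be created, each child before its parent. *)
Fixpoint hook u : R :=
  if u is Node l r then (inner u)%:R^-1 * (hook l * hook r) else 1.

Definition tree_mean n f := forest_mean n (nseq n.+1 Leaf) f.

Lemma fuse_cat s1 u v s2 :
  fuse (size s1) (s1 ++ u :: v :: s2) = s1 ++ Node u v :: s2.
Proof.
rewrite /fuse take_size_cat// !nth_cat ltnn subnn/= ltnNge leqnSn/= subSnn/=.
by rewrite -[_.+2]add2n -drop_drop drop_size_cat//= drop0.
Qed.

Lemma split_pair i s : (i.+1 < size s)%N ->
  exists s1 u v s2, s = s1 ++ u :: v :: s2 /\ size s1 = i.
Proof.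
move=> i_s; exists (take i s), (nth Leaf s i), (nth Leaf s i.+1), (drop i.+2 s).
split; last by rewrite size_takel// ltnW// ltnW.
by rewrite -drop_nth// -drop_nth ?cat_take_drop// ltnW.
Qed.

Lemma size_fuse n i s : size s = n.+2 -> (i <= n)%N -> size (fuse i s) = n.+1.
Proof.
move=> ss i_n; have [|s1 [u [v [s2 [sE <-]]]]] := @split_pair i s.
  by rewrite ss.
by rewrite sE fuse_cat; move: ss; rewrite sE !size_cat/=; lia.
Qed.

Lemma forest_mean_sum n s (J : Type) (e : seq J) (F : J -> tree -> R) :
  forest_mean n s (fun u => \sum_(j <- e) F j u) =
  \sum_(j <- e) forest_mean n s (F j).
Proof.
elim: n s => //= n IH s; rewrite -mulr_sumr exchange_big/=; congr (_ * _).
by apply: eq_bigr => i _; exact: IH.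
Qed.

Lemma forest_meanZ n s c f :
  forest_mean n s (fun u => c * f u) = c * forest_mean n s f.
Proof.
elim: n s => //= n IH s; rewrite mulrCA; congr (_ * _); rewrite mulr_sumr.
by apply: eq_bigr => i _; exact: IH.
Qed.

Lemma eq_forest_mean n s f g : f =1 g -> forest_mean n s f = forest_mean n s g.
Proof. by move=> /funext ->. Qed.

Lemma fuse_left k i s : (i <= k)%N -> (k.+1 < size s)%N ->
  take k.+1 (fuse i s) = fuse i (take k.+2 s) /\
  drop k.+1 (fuse i s) = drop k.+2 s.
Proof.
move=> ik ks; have [|s1 [u [v [s2 [-> si]]]]] := @split_pair i s; first lia.
have [d ->] : exists d, k = (size s1 + d)%N by exists (k - i)%N; rewrite si subnKC.
have takeC n w : take (size s1 + n) (s1 ++ w) = s1 ++ take n w.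
  by rewrite takeD take_size_cat// drop_size_cat.
have dropC n w : drop (size s1 + n) (s1 ++ w) = drop n w.
  by rewrite addnC -drop_drop drop_size_cat.
by rewrite -si fuse_cat -!addnS !takeC !dropC/= fuse_cat.
Qed.

Lemma fuse_right k i s : (k < i)%N -> (i.+1 < size s)%N ->
  take k.+1 (fuse i s) = take k.+1 s /\
  drop k.+1 (fuse i s) = fuse (i - k.+1) (drop k.+1 s).
Proof.
move=> ki ks; have [|s1 [u [v [s2 [-> si]]]]] := @split_pair i s; first lia.
have ks1 : (k.+1 <= size s1)%N by rewrite si.
rewrite -si fuse_cat !takel_cat// !drop_cat; split => //.
case: ltnP => ks1'; first by rewrite -size_drop fuse_cat.
have -> : k.+1 = size s1 by lia.
by rewrite !subnn /= (fuse_cat [::]).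
Qed.

(** Decomposition at the root.  The last merge joins the tree grown on the first [k.+1] entries of
    the row to the tree grown on the others, and the place [k] of that cut is uniform. *)
Lemma forest_mean_root n s f : size s = n.+2 ->
  n.+1%:R * forest_mean n.+1 s f =
  \sum_(k < n.+1) forest_mean k (take k.+1 s) (fun l =>
    forest_mean (n - k) (drop k.+1 s) (fun r => f (Node l r))).
Proof.
elim: n s => [|n IH] s ss.
  rewrite mul1r /= !big_ord1/= invr1 mul1r.
  by case: s ss => [|a [|b [|]]].
rewrite [forest_mean n.+2 _ _]/= mulrA divff ?pnatr_eq0// mul1r.
have n0 : n.+1%:R != 0 :> R by rewrite pnatr_eq0.
apply: (mulfI n0); rewrite mulr_sumr.
pose T k := forest_mean k (take k.+1 s) (fun l =>
  forest_mean (n.+1 - k) (drop k.+1 s) (fun r => f (Node l r))).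
transitivity (\sum_(i < n.+2) \sum_(k < n.+1)
    forest_mean k (take k.+1 (fuse i s)) (fun l =>
    forest_mean (n - k) (drop k.+1 (fuse i s)) (fun r => f (Node l r)))).
  by apply: eq_bigr => -[i ik] _; rewrite IH//; exact: (size_fuse ss).
(* A first merge strictly left of the cut [k] is counted in the left factor, one strictly right of
   it in the right factor; [k.+1] and [n.+1 - k] are the numbers of such merges. *)
rewrite exchange_big/=.
transitivity (\sum_(k < n.+1) (k.+1%:R * T k.+1 + (n.+1 - k)%:R * T k)).
  apply: eq_bigr => -[k /= kn] _.
  rewrite -(big_mkord xpredT (fun i => forest_mean k (take k.+1 (fuse i s))
    (fun l => forest_mean (n - k) (drop k.+1 (fuse i s)) (fun r => f (Node l r))))).
  rewrite (@big_cat_nat _ _ _ k.+1)//=; last by rewrite ltnW.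
  congr (_ + _).
    transitivity (\sum_(0 <= i < k.+1) forest_mean k (fuse i (take k.+2 s))
      (fun l => forest_mean (n.+1 - k.+1) (drop k.+2 s) (fun r => f (Node l r)))).
      apply: eq_big_nat => i /andP[_ ik].
      by have [|-> ->] := @fuse_left k i s ik; [lia|].
    by rewrite /T /= mulrA divff ?pnatr_eq0// mul1r big_mkord.
  rewrite -{1}[k.+1]add0n big_addn subSS /T.
  have -> : (n.+1 - k = (n - k).+1)%N by lia.
  rewrite -forest_meanZ /=.
  under [RHS]eq_forest_mean => l do
    rewrite mulrA divff ?pnatr_eq0// mul1r.
  rewrite forest_mean_sum big_mkord; apply: eq_bigr => -[i /= ik] _.
  have [||-> ->] := @fuse_right k (i + k.+1) s; [lia|lia|].
  by rewrite addnK.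
rewrite big_split/= [in RHS]big_ord_recr/=.
rewrite -(big_mkord xpredT (fun k => k.+1%:R * T k.+1)).
rewrite -(big_add1 _ _ 0 n.+2 xpredT (fun k => k%:R * T k)).
rewrite -[X in X + _]add0r -{1}[0](mul0r (T 0%N)).
rewrite -(@big_ltn _ _ _ 0 n.+2 (fun k => k%:R * T k))// big_nat_recr//=.
rewrite big_mkord addrAC -big_split/= mulrDr; congr (_ + _).
rewrite mulr_sumr; apply: eq_bigr => -[k /= kn] _.
by rewrite -mulrDl -natrD subnKC// ltnW.
Qed.

Lemma tree_mean0 f : tree_mean 0 f = f Leaf.
Proof. by []. Qed.

Lemma tree_meanS n f : n.+1%:R * tree_mean n.+1 f =
  \sum_(k < n.+1) tree_mean k (fun l =>
    tree_mean (n - k) (fun r => f (Node l r))).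
Proof.
rewrite /tree_mean forest_mean_root ?size_nseq//.
apply: eq_bigr => k _; have kn := ltn_ord k; rewrite take_nseq; last lia.
by rewrite drop_nseq; have -> : (n.+2 - k.+1 = (n - k).+1)%N by lia.
Qed.

End random_binary_tree.

Section countable_sums.
Context {R : realType}.
Local Open Scope ereal_scope.

Lemma esum_point (J : choiceType) (j0 : J) (a : J -> \bar R) :
  (forall j, 0 <= a j) -> (forall j, j != j0 -> a j = 0) ->
  \esum_(j in setT) a j = a j0.
Proof.
move=> a0 aj; rewrite (esumID [set j0])//; first last.
rewrite !setTI esum_set1// esum1 ?adde0// => j /= jj0.
by apply: aj; apply/eqP.
Qed.

Lemma esum_pickle (J : countType) (a : J -> \bar R) : (forall j, 0 <= a j) ->
  \esum_(j in setT) a j = \sum_(k <oo) (if pickle_inv k is Some j then a j else 0).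
Proof.
move=> a0; rewrite nneseries_esumT; last by move=> k; case: pickle_inv.
rewrite (esumID (range (@pickle J)) setT); last first.
  by move=> k _; case: pickle_inv.
rewrite setTI [X in _ = _ + X]esum1 ?adde0; last first.
  move=> k [_ nk]; case E : (pickle_inv k) => [j|//].
  exfalso; apply: nk; exists j => //; have := @pickle_invK J k.
  by rewrite /= E.
rewrite esum_image; last by move=> i j _ _ /(pcan_inj pickleK).
by apply: eq_esum => j _; rewrite pickleK_inv.
Qed.

Lemma esumZl (J : countType) (c : R) (a : J -> \bar R) : (0 <= c)%R ->
  (forall j, 0 <= a j) ->
  \esum_(j in setT) (c%:E * a j) = c%:E * \esum_(j in setT) a j.
Proof.
move=> c0 a0; rewrite !esum_pickle//; last by move=> j; rewrite mule_ge0.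
rewrite -nneseriesZl//; last by move=> k; case: pickle_inv.
by apply: eq_eseriesr => k _; case: pickle_inv => //; rewrite mule0.
Qed.

End countable_sums.

Section tree_weights.
Context {R : realType}.
Implicit Types (u l r : tree) (s : seq tree) (f g : tree -> R).
Local Notation hook := (@hook R).

Lemma hook_ge0 u : 0 <= hook u.
Proof. by elim: u => //= l l0 r r0; rewrite mulr_ge0 ?mulr_ge0. Qed.

Lemma hook_Node l r : (inner (Node l r))%:R * hook (Node l r) = hook l * hook r.
Proof. by rewrite mulrA divff ?mul1r// pnatr_eq0. Qed.

Lemma forest_mean_ge0 n s f : (forall u, 0 <= f u) -> 0 <= forest_mean n s f.
Proof.
by move=> f0; elim: n s => //= n IH s; rewrite mulr_ge0// sumr_ge0.
Qed.

(** By the decomposition at the root, the probability of a tree satisfies the recursion of the hook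
    weight. *)
Lemma tree_mean_indic n u :
  tree_mean n (fun v => (v == u)%:R) = hook u * (inner u == n)%:R.
Proof.
elim: u n => [|l IHl r IHr] [|n]; rewrite ?tree_mean0 ?eqxx ?mulr0 ?mulr1//.
  apply: (mulfI (_ : n.+1%:R != 0)); first by rewrite pnatr_eq0.
  rewrite tree_meanS mulr0 big1// => k _; rewrite /tree_mean.
  rewrite -[RHS](mul0r (forest_mean k (nseq k.+1 Leaf) (fun=> 1))) -forest_meanZ.
  apply: eq_forest_mean => v; rewrite mul0r.
  rewrite -[RHS](mul0r (forest_mean (n - k) (nseq (n - k).+1 Leaf) (fun=> 1))).
  by rewrite -forest_meanZ; apply: eq_forest_mean => w; rewrite mul0r.
apply: (mulfI (_ : n.+1%:R != 0)); first by rewrite pnatr_eq0.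
rewrite tree_meanS.
transitivity (\sum_(k < n.+1) hook l * hook r *
    ((inner l == k)%:R * (inner r == n - k)%N%:R)).
  apply: eq_bigr => k _; rewrite mulrACA -IHl -IHr.
  rewrite mulrC -forest_meanZ; apply: eq_forest_mean => v.
  rewrite mulrC -forest_meanZ; apply: eq_forest_mean => w.
  rewrite -natrM mulnb; congr (nat_of_bool _)%:R.
  by apply/eqP/andP => [[-> ->]|[/eqP -> /eqP ->]].
rewrite -mulr_sumr /= eqSS.
have [<-|ne] := eqVneq (inner l + inner r)%N n.
  rewrite mulr1 mulrA divff ?pnatr_eq0// mul1r -[RHS]mulr1; congr (_ * _).
  have lr : (inner l < (inner l + inner r).+1)%N by rewrite ltnS leq_addr.
  rewrite (bigD1 (Ordinal lr))//= eqxx addKn eqxx mulr1.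
  rewrite big1 ?addr0// => k kl; case: eqP => [lk|]; last by rewrite mul0r.
  by case/eqP: kl; exact: val_inj.
rewrite !mulr0 big1 ?mulr0// => k _; have kn := ltn_ord k.
case: eqP => [lk|]; last by rewrite mul0r.
case: eqP => [rk|]; last by rewrite mulr0.
by case/eqP: ne; rewrite lk rk subnKC.
Qed.

Local Open Scope ereal_scope.

Lemma forest_mean_esum n s f : (forall u, 0 <= f u)%R ->
  (forest_mean n s f)%:E =
  \esum_(u in setT) (forest_mean n s (fun v => (v == u)%:R) * f u)%:E.
Proof.
move=> f0; elim: n s => [|n IH] s /=.
  rewrite (@esum_point _ _ (head Leaf s)) ?eqxx ?mul1r//.
    by move=> u; rewrite lee_fin mulr_ge0.
  by move=> u; rewrite eq_sym => /negbTE ->; rewrite mul0r.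
rewrite EFinM -sumEFin; under eq_bigr do rewrite IH.
rewrite -esum_sum; last first.
  by move=> u i _ _; rewrite lee_fin mulr_ge0// forest_mean_ge0.
rewrite -esumZl//; last first.
  move=> u; apply: sume_ge0 => i _.
  by rewrite lee_fin mulr_ge0// forest_mean_ge0.
apply: eq_esum => u _; rewrite sumEFin -EFinM; congr (_%:E).
by rewrite -mulr_suml mulrA.
Qed.

(** Randomizing the number of merges produces a mixture over all trees. *)
Lemma tree_mean_series (c : nat -> R) f :
  (forall n, 0 <= c n)%R -> (forall u, 0 <= f u)%R ->
  \sum_(n <oo) (c n * tree_mean n f)%:E =
  \esum_(u in setT) (c (inner u) * hook u * f u)%:E.
Proof.
move=> c0 f0.
have pos n u : 0 <= (c n * (hook u * (inner u == n)%:R * f u))%:E.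
  by rewrite lee_fin !mulr_ge0// hook_ge0.
rewrite nneseries_esumT; last first.
  by move=> n; rewrite lee_fin mulr_ge0// forest_mean_ge0.
transitivity (\esum_(n in [set: nat]) \esum_(u in [set: tree])
    (c n * (hook u * (inner u == n)%:R * f u))%:E).
  apply: eq_esum => n _; rewrite EFinM /tree_mean forest_mean_esum//.
  rewrite -esumZl//; last by move=> u; rewrite lee_fin mulr_ge0// forest_mean_ge0.
  by apply: eq_esum => u _; rewrite -EFinM -/(tree_mean n _) tree_mean_indic.
rewrite (esum_esum (J := fun=> setT))//.
transitivity (\esum_(u in [set: tree]) \esum_(n in [set: nat])
    (c n * (hook u * (inner u == n)%:R * f u))%:E).
  rewrite (esum_esum (J := fun=> setT))//.
  rewrite (reindex_esum (setT `*`` fun=> setT) _ (fun x => (x.2, x.1)))//.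
  split=> //=; first by move=> [i1 i2] [j1 j2] /= _ _ [] -> ->.
  by move=> [i1 i2] _ /=; exists (i2, i1).
apply: eq_esum => u _; rewrite (@esum_point _ _ (inner u))//.
  by rewrite eqxx mulr1 mulrA.
by move=> n; rewrite eq_sym => /negbTE ->; rewrite mulr0 mul0r mulr0.
Qed.

End tree_weights.

(** * The mean cost of a random tree *)

Section expected_cost.
Context {R : realType}.
Implicit Types (u l r : tree) (a b m t z : R).

(** Expected sum over the leaves of the gamma-th powers of their weights, when [a] and [b] are the
    gamma-th moments of the two coefficients of a smoothing. *)
Fixpoint cost a b u : R :=
  if u is Node l r then a * cost a b l + b * cost a b r else 1.

Lemma cost_ge0 a b u : 0 <= a -> 0 <= b -> 0 <= cost a b u.
Proof. by move=> a0 b0; elim: u => //= l l0 r r0; rewrite addr_ge0 ?mulr_ge0. Qed.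

Lemma tree_meanD n (f g : tree -> R) :
  tree_mean n (fun u => f u + g u) = tree_mean n f + tree_mean n g.
Proof.
rewrite /tree_mean; elim: n (nseq _ _) => //= n IH s.
by rewrite -mulrDr -big_split/=; congr (_ * _); apply: eq_bigr.
Qed.

Lemma tree_mean_cst n c : tree_mean n (fun=> c) = c :> R.
Proof.
rewrite /tree_mean; elim: n (nseq _ _) => //= n IH s.
under eq_bigr do rewrite IH.
by rewrite sumr_const card_ord -[c *+ _]mulr_natl mulrA mulVf ?mul1r// pnatr_eq0.
Qed.

(** The decomposition at the root expresses the mean cost [e n.+1] through the sum of all earlier
    ones; subtracting the relation for [n] leaves a two-term recursion. *)
Lemma tree_mean_costS n a b :
  n.+1%:R * tree_mean n.+1 (cost a b) = (n%:R + (a + b)) * tree_mean n (cost a b).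
Proof.
pose e k := tree_mean k (cost a b).
have root k : k.+1%:R * e k.+1 = (a + b) * \sum_(i < k.+1) e i.
  rewrite /e tree_meanS mulrDl [in RHS]mulr_sumr [in X in _ + X](reindex_inj rev_ord_inj)/=.
  rewrite mulr_sumr -big_split/=; apply: eq_bigr => i _.
  transitivity (tree_mean i (fun l => a * cost a b l + b * e (k - i)%N)).
    apply: eq_forest_mean => l /=.
    rewrite tree_meanD tree_mean_cst; congr (_ + _); exact: forest_meanZ.
  rewrite tree_meanD tree_mean_cst subSS; congr (_ + _); exact: forest_meanZ.
rewrite -[tree_mean n.+1 _]/(e n.+1) -[tree_mean n _]/(e n) root big_ord_recr/= mulrDr [in RHS]mulrDl; congr (_ + _).
case: n => [|n]; first by rewrite big_ord0 mulr0 mul0r.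
by rewrite root.
Qed.

(** The recursion is that of the coefficients of (1 - z) ^ (- m), and it gives (1 - z) p' <= m p for
    every partial sum p.  Along z = 1 - exp (- t) this says that exp (- m t) p decreases. *)
Lemma cost_series_le m (e : nat -> R) t N : 0 <= m -> 0 <= t -> e 0%N = 1 ->
  (forall n, 0 <= e n) -> (forall n, n.+1%:R * e n.+1 = (n%:R + m) * e n) ->
  \sum_(i < N) (1 - expR (- t)) ^+ i * e i <= expR (m * t).
Proof.
move=> m0 t0 e0 en0 eS; pose p : {poly R} := \poly_(i < N) e i.
have pE z : p.[z] = \sum_(i < N) z ^+ i * e i.
  by rewrite horner_poly; apply: eq_bigr => i _; rewrite mulrC.
have p'le z : 0 <= z -> (1 - z) * p^`().[z] <= m * p.[z].
  move=> z0; rewrite pE; case: N @p pE => [|N] p pE.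
    by rewrite big_ord0 mulr0 /p poly_def big_ord0 deriv0 horner0 mulr0.
  have p'E : p^`().[z] = \sum_(i < N) z ^+ i * ((i%:R + m) * e i).
    rewrite (_ : p^`() = \poly_(i < N) (i.+1%:R * e i.+1)).
      by rewrite horner_poly; apply: eq_bigr => i _; rewrite eS mulrC.
    apply/polyP => i; rewrite coef_deriv !coef_poly ltnS.
    by case: ifP => _; rewrite ?mul0rn// mulr_natl.
  have zp'E : z * p^`().[z] = \sum_(i < N.+1) z ^+ i * (i%:R * e i).
    rewrite p'E mulr_sumr big_ord_recl/= mul0r mulr0 add0r.
    by apply: eq_bigr => i _; rewrite -eS mulrA -exprS.
  rewrite mulrBl mul1r zp'E p'E !big_ord_recr/= mulrDr lerBlDr.
  rewrite [leRHS](_ : _ = \sum_(i < N) z ^+ i * ((i%:R + m) * e i) +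
    z ^+ N * ((N%:R + m) * e N)).
    by rewrite lerDl !mulr_ge0 ?exprn_ge0 ?addr_ge0.
  rewrite [RHS](_ : _ = \sum_(i < N.+1) z ^+ i * ((i%:R + m) * e i));
    last by rewrite big_ord_recr.
  transitivity (m * (\sum_(i < N.+1) z ^+ i * e i) +
                \sum_(i < N.+1) z ^+ i * (i%:R * e i)).
    by rewrite !big_ord_recr/= mulrDr.
  by rewrite mulr_sumr -big_split/=; apply: eq_bigr => i _; ring.
pose G s := expR (- (m * s)) * p.[1 - expR (- s)].
have dG (s : R) : is_derive s 1 G (expR (- (m * s)) *
  (expR (- s) * p^`().[1 - expR (- s)] - m * p.[1 - expR (- s)])).
  have d1 : is_derive s 1 (fun s => expR (- (m * s))) (- m * expR (- (m * s))).
    rewrite (_ : (fun s => _) = expR \o (fun s => (- m) *: s)); last first.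
      by apply/funext => x /=; rewrite -mulNr.
    by apply: is_derive_eq; rewrite /GRing.scale/= mulr1 [LHS]mulrC (mulNr m s).
  have d2 : is_derive s 1 (fun s => 1 - expR (- s)) (expR (- s)).
    apply: is_derive_eq; rewrite /GRing.scale/=; ring.
  have d3 : is_derive s 1 (horner p \o (fun s => 1 - expR (- s)))
      (expR (- s) * p^`().[1 - expR (- s)]).
    apply: is_derive_eq; rewrite /GRing.scale/=; ring.
  rewrite /G; apply: is_derive_eq; rewrite /GRing.scale/=; ring.
have : G t <= G 0.
  apply: (@ler0_derive1_nincry _ G 0) => //.
  - move=> s; rewrite in_itv/= andbT => s0; rewrite derive1E derive_val.
    rewrite mulr_ge0_le0 ?expR_ge0// subr_le0.
    rewrite -[X in X * _ <= _](subKr 1) p'le// subr_ge0 -expR0 ler_expR.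
    by rewrite oppr_le0 ltW.
  - apply/continuous_subspaceT => s; apply/differentiable_continuous/derivable1_diffP.
    exact: ex_derive.
rewrite {2}/G mulr0 oppr0 expR0 subrr mul1r pE.
have -> : \sum_(i < N) 0 ^+ i * e i = (N != 0)%N%:R :> R.
  case: (N) => [|M]; first by rewrite big_ord0.
  rewrite big_ord_recl/= expr0 e0 mulr1 big1 ?addr0// => i _.
  by rewrite exprS !mul0r.
rewrite /G expRN pE -ler_pdivlMl ?invr_gt0 ?expR_gt0// invrK => /le_trans; apply.
by rewrite ler_piMr ?expR_ge0//; case: (N != 0)%N.
Qed.

Lemma tree_cost_series a b t : 0 <= a -> 0 <= b -> 0 <= t ->
  (\esum_(u in [set: tree])
    (expR (- t) * (1 - expR (- t)) ^+ inner u * hook u * cost a b u)%:E <=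
   (expR (- ((1 - (a + b)) * t)))%:E)%E.
Proof.
move=> a0 b0 t0.
have z0 : 0 <= 1 - expR (- t) by rewrite subr_ge0 -expR0 ler_expR oppr_le0.
have c0 n : 0 <= expR (- t) * (1 - expR (- t)) ^+ n.
  by rewrite mulr_ge0 ?expR_ge0 ?exprn_ge0.
rewrite -(@tree_mean_series R (fun n => expR (- t) * (1 - expR (- t)) ^+ n))//;
  last by move=> u; exact: cost_ge0.
have e0 n : 0 <= tree_mean n (cost a b).
  by apply: forest_mean_ge0 => u; exact: cost_ge0.
apply: lime_le.
  by apply: is_cvg_nneseries => n _ _; rewrite lee_fin mulr_ge0.
apply: nearW => N; rewrite sumEFin lee_fin big_mkord.
under eq_bigr do rewrite -mulrA.
rewrite -mulr_sumr.
have -> : - ((1 - (a + b)) * t) = - t + (a + b) * t by ring.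
rewrite expRD ler_pM2l ?expR_gt0//; apply: (@cost_series_le _ (fun n => tree_mean n (cost a b))) => //.
- by rewrite addr_ge0.
- by move=> n; rewrite tree_mean_costS.
Qed.

End expected_cost.

(** * Laws indexed by trees *)

Section tree_laws.
Local Open Scope ereal_scope.
Context {R : realType} {dW} {W : measurableType dW} (PW : probability W R).

Section one_space.
Context {d} {U : measurableType d} (c : {mfun (W * (U * U))%type >-> U}).
Implicit Types (mu nu : probability U R) (u : tree).

Definition node_law mu nu : probability U R :=
  distribution (PW \x (mu \x nu)) c.

Fixpoint tree_law mu u : probability U R :=
  if u is Node l r then node_law (tree_law mu l) (tree_law mu r) else mu.

Lemma node_lawE mu nu A : measurable A ->
  node_law mu nu A = \int[PW]_w (mu \x nu) [set p | A (c (w, p))].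
Proof.
move=> mA; rewrite /node_law /distribution /pushforward /product_measure1.
by apply: eq_integral => w _ /=; congr (_ _); apply/seteqP; split=> p /=;
  rewrite xsectionP.
Qed.

Lemma measurable_node_integral1 nu (f : U -> \bar R) w :
  measurable_fun setT f -> (forall x, 0 <= f x) ->
  measurable_fun setT (fun x => \int[nu]_y f (c (w, (x, y)))).
Proof.
move=> mf f0.
have mfc : measurable_fun setT (fun p => f (c p)) by exact: measurableT_comp.
have mfcw : measurable_fun setT (fun p => f (c (w, p))).
  by apply: (measurableT_comp mfc); exact: measurable_pair1.
by apply: (measurable_fun_fubini_tonelli_F (m2 := nu) (fun p => f (c (w, p)))).
Qed.

Lemma node_integral_prod mu nu (f : U -> \bar R) w :
  measurable_fun setT f -> (forall x, 0 <= f x) ->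
  \int[mu \x nu]_p f (c (w, p)) = \int[mu]_x \int[nu]_y f (c (w, (x, y))).
Proof.
move=> mf f0.
have mfc : measurable_fun setT (fun p => f (c p)) by exact: measurableT_comp.
have mfcw : measurable_fun setT (fun p => f (c (w, p))).
  by apply: (measurableT_comp mfc); exact: measurable_pair1.
by rewrite (fubini_tonelli1 (fun p => f (c (w, p)))).
Qed.

Lemma measurable_node_integral2 mu nu (f : U -> \bar R) :
  measurable_fun setT f -> (forall x, 0 <= f x) ->
  measurable_fun setT (fun w => \int[mu]_x \int[nu]_y f (c (w, (x, y)))).
Proof.
move=> mf f0.
have mfc : measurable_fun setT (fun p => f (c p)) by exact: measurableT_comp.
pose munu : probability (U * U)%type R := mu \x nu.
have := measurable_fun_fubini_tonelli_F (m2 := munu) (fun p => f (c p)) mfc.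
move=> /(_ (fun p => f0 (c p))); rewrite (_ : fubini_F _ _ = fun w =>
  \int[mu]_x \int[nu]_y f (c (w, (x, y))))//.
by apply/funext => w; exact: node_integral_prod.
Qed.

Lemma ge0_integral_node_law mu nu (f : U -> \bar R) :
  measurable_fun setT f -> (forall x, 0 <= f x) ->
  \int[node_law mu nu]_x f x =
  \int[PW]_w \int[mu]_x \int[nu]_y f (c (w, (x, y))).
Proof.
move=> mf f0; rewrite ge0_integral_distribution//.
have mfc : measurable_fun setT (fun p => f (c p)) by exact: measurableT_comp.
rewrite (fubini_tonelli1 (fun p => f (c p)))//; apply: eq_integral => w _.
by rewrite /fubini_F node_integral_prod.
Qed.

End one_space.

(** A change of variable that intertwines the two combination maps can be performed at the leaves.
    Applied to linear forms of a triple, it gives the marginals and the difference of a smoothed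
    coupling. *)
Lemma tree_law_morph d d' (U : measurableType d) (U' : measurableType d')
    (c : {mfun (W * (U * U))%type >-> U}) (c' : {mfun (W * (U' * U'))%type >-> U'})
    (phi : U -> U') (mu : probability U R) (mu' : probability U' R) :
  measurable_fun setT phi ->
  (forall w x y, phi (c (w, (x, y))) = c' (w, (phi x, phi y))) ->
  (forall A, measurable A -> mu' A = mu (phi @^-1` A)) ->
  forall u A, measurable A -> tree_law c' mu' u A = tree_law c mu u (phi @^-1` A).
Proof.
move=> mphi cphi mu'E; elim=> [|l IHl r IHr] A mA /=; first exact: mu'E.
pose phi2 := fun p : U * U => (phi p.1, phi p.2).
have mphi2 : measurable_fun setT phi2.
  apply: measurable_fun_pair; first exact: measurableT_comp.
  exact: measurableT_comp.
pose phi3 := fun p : W * (U * U) => (p.1, phi2 p.2).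
have mphi3 : measurable_fun setT phi3.
  by apply: measurable_fun_pair => //; exact: measurableT_comp.
pose M : probability (U * U)%type R := tree_law c mu l \x tree_law c mu r.
pose M' : probability (U' * U')%type R := tree_law c' mu' l \x tree_law c' mu' r.
have M2 C : measurable C ->
    M' C = pushforward M phi2 C.
  apply: product_measure_unique => C1 C2 mC1 mC2.
  transitivity (tree_law c mu l (phi @^-1` C1) * tree_law c mu r (phi @^-1` C2)).
    apply: (@product_measure1E _ _ U U R (tree_law c mu l) (tree_law c mu r)).
    - by rewrite -[phi @^-1` C1]setTI; exact: mphi.
    - by rewrite -[phi @^-1` C2]setTI; exact: mphi.
  by congr (_ * _); [exact/esym/IHl|exact/esym/IHr].
rewrite /distribution /pushforward.
have mc'A : measurable (c' @^-1` A).
  by rewrite -[_ @^-1` _]setTI; exact: measurable_funPT.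
transitivity (pushforward (PW \x M) phi3 (c' @^-1` A)).
  apply: (@product_measure_unique _ _ _ _ _ PW M') => // C1 C2 mC1 mC2.
  transitivity (PW C1 * M (phi2 @^-1` C2)).
    apply: (@product_measure1E _ _ W (U * U)%type R PW M) => //.
    by rewrite -[phi2 @^-1` C2]setTI; exact: mphi2.
  by congr (_ * _); exact/esym/M2.
rewrite /pushforward; congr (_ _); apply/seteqP; split=> -[w [x y]]/=.
  by rewrite cphi.
by rewrite cphi.
Qed.

End tree_laws.

(** * Countable mixtures of laws *)

Section mixtures.
Local Open Scope ereal_scope.
Context {R : realType} {J : countType}.

Definition is_mixture d (U : measurableType d) (F : set U -> \bar R) (p : J -> R)
    (m : J -> set U -> \bar R) :=
  forall A, measurable A -> F A = \esum_(j in setT) ((p j)%:E * m j A).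

Lemma ge0_integral_esum d (U : measurableType d)
    (mu : {measure set U -> \bar R}) (f : J -> U -> \bar R) :
  (forall j, measurable_fun setT (f j)) -> (forall j x, 0 <= f j x) ->
  \int[mu]_x (\esum_(j in setT) f j x) = \esum_(j in setT) \int[mu]_x f j x.
Proof.
move=> mf f0; rewrite esum_pickle; last by move=> j; exact: integral_ge0.
transitivity (\int[mu]_x (\sum_(k <oo)
    (if pickle_inv k is Some j then f j x else 0))).
  by apply: eq_integral => x _; exact: esum_pickle.
rewrite integral_nneseries//; last 2 first.
- by move=> k; case: pickle_inv.
- by move=> k x _; case: pickle_inv.
by apply: eq_eseriesr => k _; case: pickle_inv => //; rewrite integral0.
Qed.

Lemma measurable_fun_esum d (U : measurableType d) (f : J -> U -> \bar R) :
  (forall j, measurable_fun setT (f j)) -> (forall j x, 0 <= f j x) ->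
  measurable_fun setT (fun x => \esum_(j in setT) f j x).
Proof.
move=> mf f0.
rewrite (_ : (fun x => _) = fun x => \sum_(k <oo)
    (if pickle_inv k is Some j then f j x else 0)); last first.
  by apply/funext => x; exact: esum_pickle.
apply: ge0_emeasurable_sum => [k x _ _|k _]; first by case: pickle_inv.
by case: pickle_inv.
Qed.

Variables (p : J -> R) (p_ge0 : forall j, (0 <= p j)%R).

Section mixture.
Context {d} {U : measurableType d} (m : J -> probability U R).

Let component k : {measure set U -> \bar R} :=
  if pickle_inv k is Some j then mscale (NngNum (p_ge0 j)) (m j) else mzero.

Definition mixture : {measure set U -> \bar R} := mseries component 0.

Lemma mixtureP : is_mixture mixture p m.
Proof.
move=> A mA; rewrite /mixture /mseries esum_pickle; last first.
  by move=> j; rewrite mule_ge0// lee_fin.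
by apply: eq_eseriesr => k _; rewrite /component; case: pickle_inv.
Qed.

Lemma ge0_integral_is_mixture (F : {measure set U -> \bar R}) (f : U -> \bar R) :
  is_mixture F p m -> measurable_fun setT f -> (forall x, 0 <= f x) ->
  \int[F]_x f x = \esum_(j in setT) ((p j)%:E * \int[m j]_x f x).
Proof.
move=> FE mf f0.
have -> : \int[F]_x f x = \int[mixture]_x f x.
  by apply: eq_measure_integral => A mA _; rewrite FE// mixtureP.
rewrite ge0_integral_measure_series// esum_pickle; last first.
  by move=> j; rewrite mule_ge0// ?lee_fin// integral_ge0.
apply: eq_eseriesr => k _; rewrite /component; case: pickle_inv => [j|].
  by rewrite ge0_integral_mscale.
by rewrite integral_measure_zero.
Qed.

End mixture.

End mixtures.

Section node_law_mixture.
Local Open Scope ereal_scope.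
Context {R : realType} {dW} {W : measurableType dW} (PW : probability W R).
Context {d} {U : measurableType d} (c : {mfun (W * (U * U))%type >-> U}).
Context {J : countType} (p : J -> R) (p_ge0 : forall j, (0 <= p j)%R).
Context (m : J -> probability U R) (F : probability U R).
Hypothesis FE : is_mixture F p m.

Lemma prod_is_mixture (C : set (U * U)) : measurable C ->
  (F \x F) C = \esum_(j in setT) \esum_(k in setT)
    ((p j * p k)%:E * (m j \x m k) C).
Proof.
move=> mC; rewrite /product_measure1 (ge0_integral_is_mixture p_ge0 FE)//;
  last exact: measurable_fun_xsection.
apply: eq_esum => j _.
transitivity ((p j)%:E * \int[m j]_x (\esum_(k in setT) ((p k)%:E * m k (xsection C x)))).
  congr (_ * _); apply: eq_integral => x _ /=; apply: FE.
  exact: measurable_xsection.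
rewrite ge0_integral_esum//; last 2 first.
- move=> k; apply: emeasurable_funM => //; exact: measurable_fun_xsection.
- by move=> k x; rewrite mule_ge0// lee_fin.
rewrite -esumZl//; last first.
  by move=> k; apply: integral_ge0 => x _; rewrite mule_ge0// lee_fin.
apply: eq_esum => k _; rewrite ge0_integralZl//.
- by rewrite muleA -EFinM.
- exact: measurable_fun_xsection.
- by rewrite lee_fin.
Qed.

(** A node law is bilinear in the laws of its two children. *)
Lemma node_law_is_mixture A : measurable A ->
  node_law PW c F F A = \esum_(j in setT) \esum_(k in setT)
    ((p j * p k)%:E * node_law PW c (m j) (m k) A).
Proof.
move=> mA; rewrite node_lawE//.
have mCw w : measurable [set x | A (c (w, x))].
  rewrite (_ : [set x | _] = (fun x => c (w, x)) @^-1` A)//.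
  rewrite -[X in measurable X]setTI.
  have : measurable_fun setT (fun x => c (w, x)).
    by apply: measurableT_comp => //; exact: measurable_pair1.
  by apply.
have mwE (M : probability (U * U)%type R) : measurable_fun setT (fun w => M [set x | A (c (w, x))]).
  have -> : (fun w => M [set x | A (c (w, x))]) = M \o xsection (c @^-1` A).
    by apply/funext => w /=; congr (M _); apply/seteqP; split=> x /=; rewrite xsectionP.
  apply: measurable_fun_xsection; rewrite -[X in measurable X]setTI.
  exact: measurable_funPT.
transitivity (\int[PW]_w (\esum_(j in setT) \esum_(k in setT)
    ((p j * p k)%:E * (m j \x m k) [set x | A (c (w, x))]))).
  by apply: eq_integral => w _; exact: prod_is_mixture.
have pp j k : 0 <= (p j * p k)%:E by rewrite lee_fin mulr_ge0.
have mf j k : measurable_fun setT (fun w =>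
    (p j * p k)%:E * (m j \x m k) [set x | A (c (w, x))]).
  by apply: emeasurable_funM => //; exact: (mwE (m j \x m k)).
rewrite ge0_integral_esum//; last 2 first.
- by move=> j; apply: measurable_fun_esum => // k w; rewrite mule_ge0.
- by move=> j w; apply: esum_ge0 => k _; rewrite mule_ge0.
apply: eq_esum => j _; rewrite ge0_integral_esum//; last first.
  by move=> k w; rewrite mule_ge0.
apply: eq_esum => k _; rewrite (node_lawE _ _ _ _ mA) ge0_integralZl => //.
Qed.

End node_law_mixture.

(** * Inequalities for real powers *)

Section power_inequalities.
Context {R : realType}.
Implicit Types a b s x y z g th : R.

(** Young's inequality for the exponents 1 / th and 1 / (1 - th). *)
Lemma powR_weighted_amgm th x y : 0 <= th <= 1 -> 0 <= x -> 0 <= y ->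
  x `^ th * y `^ (1 - th) <= th * x + (1 - th) * y.
Proof.
move=> /andP[th0 th1] x0 y0.
move: th0; rewrite le_eqVlt => /predU1P[<-|th0].
  by rewrite powRr0 subr0 powRr1// mul0r add0r !mul1r.
move: th1; rewrite le_eqVlt => /predU1P[->|th1].
  by rewrite subrr powRr0 powRr1// mul0r addr0 mulr1 mul1r.
have th1' : 0 < 1 - th by rewrite subr_gt0.
have := @conjugate_powR R (x `^ th) (y `^ (1 - th)) th^-1 (1 - th)^-1
  (powR_ge0 _ _) (powR_ge0 _ _).
rewrite !invr_gt0 !invrK => /(_ th0 th1'); rewrite -!powRrM !mulfV ?gt_eqF//.
by rewrite !powRr1// [th * x]mulrC [_ * y]mulrC; apply; ring.
Qed.

Lemma powR_bernoulli_le s y : 0 <= s <= 1 -> 0 <= y -> y `^ s <= 1 + s * (y - 1).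
Proof.
move=> s01 y0; have := powR_weighted_amgm s01 y0 ler01.
by rewrite powR1 mulr1 => /le_trans; apply; rewrite le_eqVlt; apply/orP; left;
  apply/eqP; ring.
Qed.

Lemma powR_bernoulli_ge g y : 1 <= g -> 0 <= y -> 1 + g * (y - 1) <= y `^ g.
Proof.
move=> g1 y0; have g0 : 0 < g by exact: lt_le_trans g1.
have : (y `^ g) `^ g^-1 <= 1 + g^-1 * (y `^ g - 1).
  by rewrite powR_bernoulli_le ?powR_ge0// invr_ge0 ltW//= invf_le1.
rewrite -powRrM mulfV ?gt_eqF// powRr1// -lerBlDl -(ler_pM2l g0) mulrA mulfV ?gt_eqF//.
by rewrite mul1r lerBrDl.
Qed.

Lemma powR_subadd s x y : 0 <= s <= 1 -> 0 <= x -> 0 <= y ->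
  (x + y) `^ s <= x `^ s + y `^ s.
Proof.
move=> /andP[s0 s1] x0 y0.
have [xy|xy] := eqVneq (x + y) 0.
  move/eqP: xy; rewrite paddr_eq0// => /andP[/eqP -> /eqP ->].
  by rewrite addr0 lerDl powR_ge0.
have S0 : 0 < x + y by rewrite lt0r xy addr_ge0.
have part w : 0 <= w -> w <= x + y -> (x + y) `^ s * (w / (x + y)) <= w `^ s.
  move=> w0 wS; have [->|wn0] := eqVneq w 0; first by rewrite mul0r mulr0 powR_ge0.
  rewrite -[in leRHS](divfK xy w) mulrC powRM ?divr_ge0 ?ler_wpM2r ?powR_ge0 ?(ltW S0)//.
  apply: ger1_powR => //; rewrite ler_pdivrMr// mul1r wS andbT.
  by rewrite divr_gt0// lt0r wn0.
apply: (le_trans _ (lerD (part x x0 _) (part y y0 _))).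
- by rewrite -mulrDr -mulrDl mulfV// mulr1.
- by rewrite lerDl.
- by rewrite lerDr.
Qed.

Lemma powR_norm_subadd s x y : 0 <= s <= 1 ->
  `|x + y| `^ s <= `|x| `^ s + `|y| `^ s.
Proof.
move=> s01; apply: le_trans (powR_subadd s01 (normr_ge0 _) (normr_ge0 _)).
by rewrite ge0_ler_powR ?nnegrE ?addr_ge0 ?ler_normD//; case/andP: s01.
Qed.

(** With g = s + 1 and s in [0, 1], one factor of the power is expanded.  For z >= -1 the power s is
    bounded by its tangent at 1 in the term 1 and by subadditivity in the term z; for z < -1,
    monotonicity and Bernoulli's inequality at - z suffice. *)
Lemma powR_norm1D_le g z : 1 < g <= 2 ->
  `|1 + z| `^ g <= 1 + g * z + 2 * `|z| `^ g.
Proof.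
move=> /andP[g1 g2]; pose s := g - 1.
have s01 : 0 <= s <= 1 by rewrite /s subr_ge0 ltW//= lerBlDr.
have s0 : 0 <= s by case/andP: s01.
have g0 : 0 < g by exact: lt_trans g1.
have gs x : 0 <= x -> x `^ g = x * x `^ s by move=> x0; rewrite mulr_powRB1.
have gE : g = s + 1 by rewrite /s subrK.
have [z0|z0] := leP 0 z.
  have z10 : 0 <= 1 + z by rewrite addr_ge0.
  rewrite !ger0_norm//.
  have h1 : (1 + z) `^ s <= 1 + s * z.
    have := powR_bernoulli_le s01 z10; rewrite (_ : 1 + z - 1 = z)//; ring.
  have h2 : z * (1 + z) `^ s <= z * (1 + z `^ s).
    by rewrite ler_wpM2l//; have := powR_subadd s01 ler01 z0; rewrite powR1.
  have h3 : 0 <= z `^ g by exact: powR_ge0.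
  rewrite gs// mulrDl mul1r; move: h3; rewrite (gs z z0) => h3; rewrite gE; lra.
pose y := - z; have y0 : 0 < y by rewrite oppr_gt0.
have zE : z = - y by rewrite opprK.
rewrite zE normrN (ger0_norm (ltW y0)); clearbody y; clear z z0 zE.
have [y1|y1] := leP y 1.
  have y10 : 0 <= 1 - y by rewrite subr_ge0.
  rewrite ger0_norm//.
  have h1 : (1 - y) `^ s <= 1 - s * y.
    have := powR_bernoulli_le s01 y10; rewrite (_ : 1 - y - 1 = - y) ?mulrN//; ring.
  have h2 : y * (1 - y `^ s) <= y * (1 - y) `^ s.
    rewrite ler_pM2l//; have := powR_subadd s01 y10 (ltW y0).
    by rewrite subrK powR1; lra.
  have h3 : 0 <= y `^ g by exact: powR_ge0.
  rewrite gs// mulrBl mul1r; move: h3; rewrite (gs y (ltW y0)) => h3; rewrite gE; lra.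
have y10 : 0 <= y - 1 by rewrite subr_ge0 ltW.
rewrite -normrN opprB ger0_norm//.
have h1 : (y - 1) * (y - 1) `^ s <= (y - 1) * y `^ s.
  rewrite ler_wpM2l// ge0_ler_powR ?nnegrE ?(ltW y0)//; lra.
have h2 := powR_bernoulli_ge (ltW g1) (ltW y0).
have h3 : 0 <= y `^ s by exact: powR_ge0.
have h4 : 1 <= y `^ s by rewrite -(powRr0 y) ler_powR// ltW.
rewrite gs//; move: h2; rewrite (gs y (ltW y0)) => h2; move: h2; rewrite gE; lra.
Qed.

(** Scaled form of [powR_norm1D_le].  The coefficient [k] of the linear term depends on [a] only, so
    that this term disappears when z is averaged over a centered law. *)
Lemma powR_normD_le g a : 1 < g <= 2 -> exists k : R, forall z,
  `|a + z| `^ g <= `|a| `^ g + k * z + 2 * `|z| `^ g.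
Proof.
move=> g12; have g0 : 0 < g by case/andP: g12 => /(lt_trans _)->.
have [->|a0] := eqVneq a 0.
  exists 0 => z; rewrite add0r mul0r addr0 normr0 powR0 ?gt_eqF// add0r.
  by rewrite ler_peMl ?powR_ge0// ler1n.
exists (`|a| `^ g * g / a) => z.
have -> : a + z = a * (1 + z / a) by field.
rewrite normrM powRM//.
have -> : `|z| `^ g = `|a| `^ g * `|z / a| `^ g.
  by rewrite -powRM// -normrM mulrC divfK.
have := powR_norm1D_le (z / a) g12.
rewrite -(ler_pM2l (powR_gt0 g (_ : 0 < `|a|))) ?normr_gt0// => /le_trans; apply.
by rewrite le_eqVlt; apply/orP; left; apply/eqP; field.
Qed.

End power_inequalities.

(** * Smoothing along a tree and absolute moments *)

Section smoothing.
Context {R : realType} {dLR} {TLR : measurableType dLR} (PLR : probability TLR R).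
Context (LR0 : {RV PLR >-> (R * R)%type}).

Definition smooth (p : TLR * (R * R)) : R :=
  (LR0 p.1).1 * p.2.1 + (LR0 p.1).2 * p.2.2.

Lemma measurable_smoothL : measurable_fun setT (fun w => (LR0 w).1).
Proof. by apply: measurableT_comp => //; exact: measurable_funPT. Qed.

Lemma measurable_smoothR : measurable_fun setT (fun w => (LR0 w).2).
Proof. by apply: measurableT_comp => //; exact: measurable_funPT. Qed.

Lemma measurable_smooth : measurable_fun setT smooth.
Proof.
by apply: measurable_funD; apply: measurable_funM;
  apply: measurableT_comp => //; solve [exact: measurable_smoothL
    | exact: measurable_smoothR | exact: measurableT_comp].
Qed.

HB.instance Definition _ := isMeasurableFun.Build _ _ _ _ smooth measurable_smooth.

(** The same two coefficients act on the three coordinates, which keeps every linear relation between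
    them. *)
Definition smooth3 (p : TLR * ((R * R * R) * (R * R * R))) : R * R * R :=
  ((smooth (p.1, (p.2.1.1.1, p.2.2.1.1)), smooth (p.1, (p.2.1.1.2, p.2.2.1.2))),
   smooth (p.1, (p.2.1.2, p.2.2.2))).

Lemma measurable_smooth3 : measurable_fun setT smooth3.
Proof.
have m f : measurable_fun setT f ->
    measurable_fun setT (fun p : TLR * ((R * R * R) * (R * R * R)) =>
      smooth (p.1, (f p.2.1, f p.2.2))).
  move=> mf; apply: (measurableT_comp measurable_smooth).
  apply: measurable_fun_pair => //.
  by apply: measurable_fun_pair; apply: measurableT_comp => //;
    exact: measurableT_comp.
apply: measurable_fun_pair; last exact: (m snd).
apply: measurable_fun_pair; first by apply: (m (fun q => q.1.1)); exact: measurableT_comp.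
by apply: (m (fun q => q.1.2)); exact: measurableT_comp.
Qed.

HB.instance Definition _ := isMeasurableFun.Build _ _ _ _ smooth3 measurable_smooth3.

Definition real_law := tree_law PLR smooth.
Definition triple_law := tree_law PLR smooth3.

End smoothing.

Lemma measurable_norm_powR (R : realType) d (U : measurableType d) (g : R)
    (f : U -> R) : measurable_fun [set: U] f ->
  measurable_fun [set: U] (fun x => (`|f x| `^ g)%:E).
Proof.
move=> mf; apply/measurable_EFinP.
apply: (measurableT_comp (f := @powR R ^~ g) (g := fun x => `|f x|)) => //.
exact: measurableT_comp.
Qed.

Section moments.
Local Open Scope ereal_scope.
Context {R : realType} {dLR} {TLR : measurableType dLR} (PLR : probability TLR R).
Context (LR0 : {RV PLR >-> (R * R)%type}).
Hypothesis LR0_ge0 : forall w, (0 <= (LR0 w).1)%R /\ (0 <= (LR0 w).2)%R.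
Context (g : R) (g_gt0 : (0 < g)%R).
Context (aL aR : R).
Hypothesis aLE : \int[PLR]_w ((LR0 w).1 `^ g)%:E = aL%:E.
Hypothesis aRE : \int[PLR]_w ((LR0 w).2 `^ g)%:E = aR%:E.

Definition abs_moment (mu : probability R R) (a : R) : \bar R :=
  \int[mu]_z (`|a + z| `^ g)%:E.

Let maff (a r : R) : measurable_fun setT (fun z : R => (a + r * z)%R).
Proof. by apply: measurable_funD => //; exact: measurable_funM. Qed.

Lemma abs_moment_scale (mu : probability R R) (K : R) :
  (forall a, abs_moment mu a <= (`|a| `^ g + K)%:E) ->
  forall a r, (0 <= r)%R ->
  \int[mu]_z (`|a + r * z| `^ g)%:E <= (`|a| `^ g + r `^ g * K)%:E.
Proof.
move=> muK a r; rewrite le_eqVlt => /predU1P[<-|r0].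
  under eq_integral do rewrite mul0r addr0.
  rewrite integral_cst//= probability_setT mule1 powR0 ?gt_eqF//.
  by rewrite mul0r addr0.
have rg0 : (0 <= r `^ g)%R by exact: powR_ge0.
apply: (@le_trans _ _ ((r `^ g)%:E * abs_moment mu (a / r))).
  rewrite -ge0_integralZl//; last by apply: measurable_norm_powR; exact: measurable_funD.
  rewrite le_eqVlt; apply/orP; left; apply/eqP; apply: eq_integral => z _.
  have -> : (a + r * z = r * (a / r + z))%R by field; rewrite gt_eqF.
  by rewrite normrM powRM// gtr0_norm.
apply: (@le_trans _ _ ((r `^ g)%:E * (`|a / r| `^ g + K)%:E)).
  by rewrite lee_pmul2l// lte_fin powR_gt0.
rewrite -EFinM lee_fin mulrDr lerD2r.
have {2}-> : (a = r * (a / r))%R by field; rewrite gt_eqF.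
by rewrite (normrM r) (gtr0_norm r0) powRM ?(ltW r0).
Qed.

(** Quantifying over the shift [a] makes the induction work: at a node, [a] plus the left branch is a
    shift for the right branch, and then [a] is the shift for the left one.  In each use the excess
    over |a| ^ g is multiplied by the moment of one coefficient, as in [cost]. *)
Lemma tree_abs_moment (mu : probability R R) (K : R) : (0 <= K)%R ->
  (forall a, abs_moment mu a <= (`|a| `^ g + K)%:E) ->
  forall u a,
    abs_moment (real_law LR0 mu u) a <= (`|a| `^ g + K * cost aL aR u)%:E.
Proof.
move=> K0 muK; elim=> [|l IHl r IHr] a; first by rewrite /= mulr1.
have aL0 : (0 <= aL)%R.
  by rewrite -lee_fin -aLE; apply: integral_ge0 => w _; rewrite lee_fin powR_ge0.
have aR0 : (0 <= aR)%R.
  by rewrite -lee_fin -aRE; apply: integral_ge0 => w _; rewrite lee_fin powR_ge0.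
have Kl0 : (0 <= K * cost aL aR l)%R by rewrite mulr_ge0// cost_ge0.
have Kr0 : (0 <= K * cost aL aR r)%R by rewrite mulr_ge0// cost_ge0.
have mL : measurable_fun setT (fun w => ((LR0 w).1 `^ g)%:E).
  apply/measurable_EFinP.
  by apply: (measurableT_comp (f := @powR R ^~ g)) => //; exact: measurable_smoothL.
have mR : measurable_fun setT (fun w => ((LR0 w).2 `^ g)%:E).
  apply/measurable_EFinP.
  by apply: (measurableT_comp (f := @powR R ^~ g)) => //; exact: measurable_smoothR.
have mf : measurable_fun setT (fun z => (`|a + z| `^ g)%:E).
  by apply: measurable_norm_powR; exact: measurable_funD.
have f0 z : 0 <= (`|a + z| `^ g)%:E by rewrite lee_fin powR_ge0.
rewrite /abs_moment /= ge0_integral_node_law//.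
apply: (@le_trans _ _ (\int[PLR]_w ((`|a| `^ g)%:E +
   ((LR0 w).1 `^ g)%:E * (K * cost aL aR l)%:E +
   ((LR0 w).2 `^ g)%:E * (K * cost aL aR r)%:E))).
  apply: ge0_le_integral => //.
  - move=> w _; apply: integral_ge0 => x _; apply: integral_ge0 => y _.
    by rewrite lee_fin powR_ge0.
  - exact: (measurable_node_integral2 _ _ _ mf f0).
  - by apply: emeasurable_funD; [apply: emeasurable_funD => //|];
      apply: emeasurable_funM.
  move=> w _; have [L0 R0] := LR0_ge0 w.
  apply: (@le_trans _ _ (\int[real_law LR0 mu l]_x
    ((`|a + (LR0 w).1 * x| `^ g)%:E +
     ((LR0 w).2 `^ g)%:E * (K * cost aL aR r)%:E))).
    apply: ge0_le_integral => //.
    - by move=> x _; apply: integral_ge0 => y _; rewrite lee_fin powR_ge0.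
    - exact: (measurable_node_integral1 _ _ _ mf f0).
    - by apply: emeasurable_funD => //; exact: measurable_norm_powR.
    move=> x _; rewrite /smooth /=; under eq_integral do rewrite addrA.
    by rewrite -EFinM -EFinD; exact: (abs_moment_scale IHr (a + (LR0 w).1 * x)%R R0).
  rewrite ge0_integralD//; last 2 first.
  - exact: measurable_norm_powR.
  - by move=> x _; rewrite mule_ge0// lee_fin ?powR_ge0.
  rewrite integral_cst//= (probability_setT (real_law LR0 mu l)) mule1 leeD2r//.
  by rewrite -EFinM -EFinD; exact: (abs_moment_scale IHl a L0).
have mLK k : measurable_fun setT (fun w => ((LR0 w).1 `^ g)%:E * k%:E).
  exact: emeasurable_funM.
have mRK k : measurable_fun setT (fun w => ((LR0 w).2 `^ g)%:E * k%:E).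
  exact: emeasurable_funM.
have LK0 k : (0 <= k)%R -> forall w, 0 <= ((LR0 w).1 `^ g)%:E * k%:E.
  by move=> k0 w; rewrite mule_ge0 ?lee_fin ?powR_ge0.
have RK0 k : (0 <= k)%R -> forall w, 0 <= ((LR0 w).2 `^ g)%:E * k%:E.
  by move=> k0 w; rewrite mule_ge0 ?lee_fin ?powR_ge0.
have mcL k : measurable_fun setT (fun w =>
    (`|a| `^ g)%:E + ((LR0 w).1 `^ g)%:E * k%:E) by exact: emeasurable_funD.
have cL0 k w : (0 <= k)%R -> 0 <= (`|a| `^ g)%:E + ((LR0 w).1 `^ g)%:E * k%:E.
  by move=> k0; rewrite adde_ge0 ?LK0// lee_fin powR_ge0.
rewrite ge0_integralD//; [|by move=> w _; exact: cL0|by move=> w _; exact: RK0].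
rewrite ge0_integralD//; [|by move=> w _; exact: LK0].
rewrite integral_cst//= probability_setT mule1 !ge0_integralZr//; last 2 first.
- by move=> w _; rewrite lee_fin powR_ge0.
- by move=> w _; rewrite lee_fin powR_ge0.
rewrite aLE aRE -!EFinM -!EFinD lee_fin.
by rewrite le_eqVlt; apply/orP; left; apply/eqP; rewrite /=; ring.
Qed.

(** The inequality of [powR_normD_le] loses its linear term under a centered law. *)
Lemma abs_moment_center (mu : probability R R) (M : R) :
  abs_moment mu 0 = M%:E -> (1 < g <= 2)%R ->
  mu.-integrable setT (fun z => z%:E) -> \int[mu]_z z%:E = 0 ->
  forall a, abs_moment mu a <= (`|a| `^ g + 2 * M)%:E.
Proof.
move=> muM g12 imu mu0 a; have [k kP] := powR_normD_le a g12.
have muM' : \int[mu]_z (`|z| `^ g)%:E = M%:E.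
  by rewrite -muM; apply: eq_integral => z _; rewrite add0r.
have iM : mu.-integrable setT (fun z => (`|z| `^ g)%:E).
  apply/integrableP; split; first exact: measurable_norm_powR.
  under eq_integral do rewrite gee0_abs ?lee_fin ?powR_ge0//.
  by rewrite muM' ltry.
have iB : mu.-integrable setT (fun z =>
    (`|a| `^ g)%:E + (k%:E * z%:E + 2%:E * (`|z| `^ g)%:E)).
  apply: integrableD => //; first exact: finite_measure_integrable_cst.
  by apply: integrableD => //; exact: integrableZl.
apply: (@le_trans _ _ (\int[mu]_z
    ((`|a| `^ g)%:E + (k%:E * z%:E + 2%:E * (`|z| `^ g)%:E)))).
  apply: le_integral => //.
    apply: le_integrable iB => //.
      by apply: measurable_norm_powR; exact: measurable_funD.
    move=> z _; rewrite -!EFinM -!EFinD /= lee_fin.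
    rewrite ger0_norm ?powR_ge0//; apply: le_trans (ler_norm _).
    by rewrite addrA kP.
  by move=> z _; rewrite -!EFinM -!EFinD lee_fin addrA kP.
rewrite integralD//; last 2 first.
- exact: finite_measure_integrable_cst.
- by apply: integrableD => //; exact: integrableZl.
rewrite integralD//; last 2 first.
- exact: integrableZl.
- exact: integrableZl.
rewrite integral_cst//= probability_setT mule1 !integralZl// mu0 mule0 add0e.
by rewrite muM' -EFinM -EFinD.
Qed.

Lemma abs_moment_subadd (mu : probability R R) (M : R) :
  abs_moment mu 0 = M%:E -> (g <= 1)%R ->
  forall a, abs_moment mu a <= (`|a| `^ g + M)%:E.
Proof.
move=> muM g1 a; have g01 : (0 <= g <= 1)%R by rewrite ltW.
apply: (@le_trans _ _ (\int[mu]_z ((`|a| `^ g)%:E + (`|0 + z| `^ g)%:E))).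
  apply: ge0_le_integral => //.
  - by apply: measurable_norm_powR; exact: measurable_funD.
  - apply: emeasurable_funD => //.
    by apply: measurable_norm_powR; exact: measurable_funD.
  by move=> z _; rewrite -EFinD lee_fin add0r powR_norm_subadd.
rewrite ge0_integralD//; last by apply: measurable_norm_powR; exact: measurable_funD.
rewrite integral_cst//= probability_setT mule1.
by rewrite -/(abs_moment mu 0) muM.
Qed.

End moments.

(** * The Laplace transform of the total weight of the leaves *)

Section mass_lower_bound.
Context {R : realType} {dLR} {TLR : measurableType dLR} (PLR : probability TLR R).
Context (LR0 : {RV PLR >-> (R * R)%type}).
Hypothesis LR0_ge0 : forall w, (0 <= (LR0 w).1)%R /\ (0 <= (LR0 w).2)%R.
Context (g : R) (g_bnd : 1 < g <= 2).
Context (aL aR : R).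
Hypothesis aLE : (\int[PLR]_w ((LR0 w).1 `^ g)%:E = aL%:E)%E.
Hypothesis aRE : (\int[PLR]_w ((LR0 w).2 `^ g)%:E = aR%:E)%E.
Hypothesis LR_mean : (1 <= \int[PLR]_w ((LR0 w).1 + (LR0 w).2)%:E)%E.
Context (K : R) (K1 : 1 <= K) (KP : (K + 2^-1) * (aL + aR) <= K).

(** Subtracted from 1, this is a bound for the Laplace transform that has the right first order 1 - x
    and is stable under smoothing. *)
Definition barrier (x : R) : R := Num.max 0 (x - K * x `^ g).

Let g0 : 0 < g. Proof. by case/andP: g_bnd => /(lt_trans _)->. Qed.
Let g1 : 1 <= g. Proof. by case/andP: g_bnd => /ltW. Qed.
Let K0 : 0 < K. Proof. exact: lt_le_trans K1. Qed.

Lemma barrier_ge0 x : 0 <= barrier x.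
Proof. by rewrite /barrier le_max lexx. Qed.

Lemma barrier_ge x : x - K * x `^ g <= barrier x.
Proof. by rewrite /barrier le_max lexx orbT. Qed.

Lemma barrier_le x : 0 <= x -> barrier x <= x.
Proof.
by move=> x0; rewrite /barrier ge_max x0 gerBl mulr_ge0 ?powR_ge0// ltW.
Qed.

Lemma barrier_eq0 x : 1 <= x -> barrier x = 0.
Proof.
move=> x1; apply/max_idPl; rewrite subr_le0.
apply: (le_trans (le1r_powR x1 g1)).
by rewrite ler_peMl// powR_ge0.
Qed.

Lemma barrier_le1 x : 0 <= x -> barrier x <= 1.
Proof.
move=> x0; have [x1|/ltW x1] := leP x 1; first exact: le_trans (barrier_le x0) x1.
by rewrite barrier_eq0.
Qed.

Lemma barrierM_le x y : 0 <= x -> 0 <= y ->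
  barrier x * barrier y <= 2^-1 * (x `^ g + y `^ g).
Proof.
have half z : 0 <= z -> barrier z <= z `^ (g / 2).
  move=> z0; have [z1|/ltW z1] := leP z 1; last first.
    by rewrite barrier_eq0// powR_ge0.
  apply: le_trans (barrier_le z0) _.
  have [->|zn0] := eqVneq z 0; first by rewrite powR_ge0.
  apply: ger1_powR; first by rewrite lt0r zn0 z0.
  by rewrite ler_pdivrMr// mul1r; case/andP: g_bnd.
have sq z : z `^ g = z `^ (g / 2) ^+ 2.
  by rewrite -powR_mulrn ?powR_ge0// -powRrM divfK.
move=> x0 y0; apply: (@le_trans _ _ (x `^ (g / 2) * y `^ (g / 2))).
  by rewrite ler_pM ?barrier_ge0// half.
rewrite (sq x) (sq y).
have := sqr_ge0 (x `^ (g / 2) - y `^ (g / 2)); rewrite !expr2; lra.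
Qed.

(** The product of the bounds of the two branches exceeds 1 - barrier x - barrier y by at most half of
    x ^ g + y ^ g, and this is the 1/2 that the constant [K] has to absorb. *)
Lemma barrier_step x y : 0 <= x -> 0 <= y ->
  (1 - barrier x) * (1 - barrier y) + (x + y) <=
  1 + (K + 2^-1) * (x `^ g + y `^ g).
Proof.
move=> x0 y0; have := barrierM_le x0 y0.
have := barrier_ge x; have := barrier_ge y; lra.
Qed.

Lemma expRN_barrier x : 0 <= x -> expR (- x) <= 1 - barrier x.
Proof.
move=> x0; have [x1|/ltW x1] := leP x 1; last first.
  by rewrite barrier_eq0// subr0 -expR0 ler_expR oppr_le0.
have e1 : expR (- x) <= 1 by rewrite -expR0 ler_expR oppr_le0.
rewrite /barrier oppr_max addr_minr le_min oppr0 addr0 e1/=.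
have inv : expR (- x) <= (1 + x)^-1.
  by rewrite expRN lef_pV2 ?posrE ?expR_gt0 ?expR_ge1Dx// addrC ltr_wpDl.
apply: (le_trans inv); apply: (@le_trans _ _ (1 - x + x ^+ 2)).
  rewrite -[leLHS]mul1r ler_pdivrMr; last by rewrite addrC ltr_wpDl.
  have : 0 <= x ^+ 3 by exact: exprn_ge0.
  rewrite !exprS expr0; lra.
suff : x ^+ 2 <= K * x `^ g by lra.
have [->|xn0] := eqVneq x 0; first by rewrite expr0n mulr_ge0 ?powR_ge0// ltW.
apply: (@le_trans _ _ (x `^ g)); last by rewrite ler_peMl// powR_ge0.
rewrite -powR_mulrn//; apply: ger_powR; first by rewrite lt0r xn0 x0.
by case/andP: g_bnd.
Qed.

Local Open Scope ereal_scope.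

Definition laplace (mu : probability R R) (x : R) : \bar R :=
  \int[mu]_z (expR (- (x * z)))%:E.

Lemma measurable_laplace (x : R) : measurable_fun setT (fun z : R => (expR (- (x * z)))%:E).
Proof.
apply/measurable_EFinP.
apply: (measurableT_comp (f := @expR R) (g := fun z => (- (x * z))%R)) => //.
by apply: measurableT_comp => //; exact: measurable_funM.
Qed.

Lemma laplace_node (mu nu : probability R R) (x : R) w :
  \int[mu]_y \int[nu]_z (expR (- (x * smooth LR0 (w, (y, z)))))%:E =
  laplace mu (x * (LR0 w).1) * laplace nu (x * (LR0 w).2).
Proof.
have e0 (r : R) : 0 <= (expR r)%:E by rewrite lee_fin expR_ge0.
rewrite /laplace -(ge0_integralZr _ _ (measurable_laplace _))//; last first.
  exact: integral_ge0.
apply: eq_integral => y _; rewrite -(ge0_integralZl _ _ (measurable_laplace _))//.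
by apply: eq_integral => z _; rewrite -EFinM -expRD /smooth /=; congr (expR _)%:E; ring.
Qed.

(** Since E(L + R) >= 1, the first-order term does not shrink at a node.  The error term K x ^ g is
    reproduced because (K + 1/2) E(L ^ g + R ^ g) <= K. *)
Lemma tree_laplace_le u x : (0 <= x)%R ->
  laplace (real_law LR0 (dirac (1%R : R)) u) x <= (1 - barrier x)%:E.
Proof.
elim: u x => [|l IHl r IHr] x x0.
  rewrite /laplace /= integral_dirac//; last exact: measurable_laplace.
  by rewrite diracT mul1e mulr1 lee_fin expRN_barrier.
have mf := measurable_laplace x.
have f0 z : 0 <= (expR (- (x * z)))%:E :> \bar R by rewrite lee_fin expR_ge0.
rewrite {1}/laplace /= ge0_integral_node_law//.
pose F w := \int[real_law LR0 (dirac (1%R : R)) l]_y \int[real_law LR0 (dirac (1%R : R)) r]_z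
  (expR (- (x * smooth LR0 (w, (y, z)))))%:E.
have mF : measurable_fun setT F by exact: (measurable_node_integral2 _ _ _ mf f0).
have F0 w : 0 <= F w.
  by apply: integral_ge0 => y _; apply: integral_ge0 => z _.
rewrite -/F.
have FE w : F w <= ((1 - barrier (x * (LR0 w).1)) * (1 - barrier (x * (LR0 w).2)))%:E.
  have [L0 R0] := LR0_ge0 w.
  rewrite /F laplace_node EFinM; apply: lee_pmul.
  - by apply: integral_ge0 => z _; rewrite lee_fin expR_ge0.
  - by apply: integral_ge0 => z _; rewrite lee_fin expR_ge0.
  - by apply: IHl; rewrite mulr_ge0.
  - by apply: IHr; rewrite mulr_ge0.
clearbody F; have b01 y : (0 <= y)%R -> (0 <= 1 - barrier y <= 1)%R.
  by move=> y0; rewrite subr_ge0 barrier_le1//= gerBl barrier_ge0.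
rewrite {1}/barrier oppr_max addr_minr oppr0 addr0 EFin_min le_min; apply/andP; split.
  rewrite -[leRHS](_ : \int[PLR]_w 1 = 1); last first.
    by rewrite integral_cst//= probability_setT mule1.
  apply: ge0_le_integral => //.
  move=> w _; have [L0 R0] := LR0_ge0 w.
  apply: (le_trans (FE w)); rewrite lee_fin -[leRHS]mulr1.
  have /andP[p0 p1] := b01 _ (mulr_ge0 x0 L0).
  have /andP[q0 q1] := b01 _ (mulr_ge0 x0 R0).
  by rewrite ler_pM.
have mLR : measurable_fun setT (fun w => ((LR0 w).1 + (LR0 w).2)%:E).
  apply/measurable_EFinP; apply: measurable_funD.
    exact: measurable_smoothL.
  exact: measurable_smoothR.
have LR0' w : 0 <= ((LR0 w).1 + (LR0 w).2)%:E.
  by have [L0 R0] := LR0_ge0 w; rewrite lee_fin addr_ge0.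
have mL : measurable_fun setT (fun w => ((LR0 w).1 `^ g)%:E).
  apply/measurable_EFinP.
  by apply: (measurableT_comp (f := @powR R ^~ g)) => //; exact: measurable_smoothL.
have mR : measurable_fun setT (fun w => ((LR0 w).2 `^ g)%:E).
  apply/measurable_EFinP.
  by apply: (measurableT_comp (f := @powR R ^~ g)) => //; exact: measurable_smoothR.
pose k := ((K + 2^-1) * x `^ g)%R.
have k0 : (0 <= k)%R by rewrite mulr_ge0 ?powR_ge0// addr_ge0 ?invr_ge0// ltW.
have main : \int[PLR]_w (F w + x%:E * ((LR0 w).1 + (LR0 w).2)%:E) <=
    \int[PLR]_w (1 + k%:E * (((LR0 w).1 `^ g)%:E + ((LR0 w).2 `^ g)%:E)).
  apply: ge0_le_integral => //.
  - by move=> w _; rewrite adde_ge0// mule_ge0// lee_fin.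
  - by apply: emeasurable_funD => //; exact: emeasurable_funM.
  - apply: emeasurable_funD => //; apply: emeasurable_funM => //.
    exact: emeasurable_funD.
  move=> w _; have [L0 R0] := LR0_ge0 w.
  apply: (le_trans (leeD2r _ (FE w))).
  rewrite -!EFinM -!EFinD lee_fin (mulrDr x).
  apply: (le_trans (barrier_step (mulr_ge0 x0 L0) (mulr_ge0 x0 R0))).
  by rewrite !powRM// -mulrDr /k mulrA.
have xE : 0 <= x%:E by rewrite lee_fin.
have kE : 0 <= k%:E by rewrite lee_fin.
have mkS : measurable_fun setT (fun w =>
    ((LR0 w).1 `^ g)%:E + ((LR0 w).2 `^ g)%:E) by exact: emeasurable_funD.
have mxLR : measurable_fun setT (fun w => x%:E * ((LR0 w).1 + (LR0 w).2)%:E).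
  exact: emeasurable_funM.
have mkk : measurable_fun setT (fun w =>
    k%:E * (((LR0 w).1 `^ g)%:E + ((LR0 w).2 `^ g)%:E)) by exact: emeasurable_funM.
have xLR w : setT w -> 0 <= x%:E * ((LR0 w).1 + (LR0 w).2)%:E by rewrite mule_ge0.
have kS0 w : setT w -> 0 <= ((LR0 w).1 `^ g)%:E + ((LR0 w).2 `^ g)%:E.
  by rewrite adde_ge0 ?lee_fin ?powR_ge0.
have kS w : setT w -> 0 <= k%:E * (((LR0 w).1 `^ g)%:E + ((LR0 w).2 `^ g)%:E).
  by move=> ?; rewrite mule_ge0 ?kS0.
have L0 w : setT w -> 0 <= ((LR0 w).1 `^ g)%:E by rewrite lee_fin powR_ge0.
have R0 w : setT w -> 0 <= ((LR0 w).2 `^ g)%:E by rewrite lee_fin powR_ge0.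
move: main; rewrite (ge0_integralD _ _ _ mF _ mxLR)// (ge0_integralD _ _ _ _ _ mkk)//.
rewrite (ge0_integralZl _ _ mLR)// (ge0_integralZl _ _ mkS)//.
rewrite (ge0_integralD _ _ _ mL _ mR)//.
rewrite integral_cst//= probability_setT mule1 aLE aRE.
rewrite (_ : k%:E * (aL%:E + aR%:E) = (k * (aL + aR))%:E)// => main.
have : \int[PLR]_w F w + x%:E <= (1 + k * (aL + aR))%:E.
  rewrite EFinD; apply: le_trans main; rewrite leeD2l// -[leLHS]mule1.
  by apply: lee_pmul => //; rewrite lee_fin.
rewrite -leeBrDr// => /le_trans; apply; rewrite -EFinB lee_fin opprB.
have : (k * (aL + aR) <= K * x `^ g)%R.
  by rewrite /k mulrAC ler_wpM2r ?powR_ge0.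
lra.
Qed.

End mass_lower_bound.

(** * Consequences of the moment conditions *)

Section smoothing_facts.
Local Open Scope ereal_scope.
Context {R : realType} {dLR} {TLR : measurableType dLR} (PLR : probability TLR R).
Context (LR0 : {RV PLR >-> (R * R)%type}).
Hypothesis LR0_ge0 : forall w, (0 <= (LR0 w).1)%R /\ (0 <= (LR0 w).2)%R.

Lemma measurable_smoothL_powR (s : R) :
  measurable_fun setT (fun w => ((LR0 w).1 `^ s)%:E).
Proof.
apply/measurable_EFinP.
by apply: (measurableT_comp (f := @powR R ^~ s)) => //; exact: measurable_smoothL.
Qed.

Lemma measurable_smoothR_powR (s : R) :
  measurable_fun setT (fun w => ((LR0 w).2 `^ s)%:E).
Proof.
apply/measurable_EFinP.
by apply: (measurableT_comp (f := @powR R ^~ s)) => //; exact: measurable_smoothR.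
Qed.

Lemma momentE (s : R) : s != 0%R -> moment LR0 s =
  \int[PLR]_w ((LR0 w).1 `^ s)%:E + \int[PLR]_w ((LR0 w).2 `^ s)%:E.
Proof.
move=> s0; rewrite /moment unlock.
have p00 (x : R) : (pow00 x s = x `^ s)%R.
  by rewrite /pow00; case: eqVneq => // ->; rewrite powR0.
rewrite -ge0_integralD//; last 4 first.
- by move=> w _; rewrite lee_fin powR_ge0.
- exact: measurable_smoothL_powR.
- by move=> w _; rewrite lee_fin powR_ge0.
- exact: measurable_smoothR_powR.
by apply: eq_integral => w _; rewrite !p00.
Qed.

(** The power x ^ alpha is at most a convex combination of x and x ^ g.  As the moments at alpha and
    [g] are 1 and at most 1, the first moment cannot be less than 1. *)
Lemma smoothing_mean_ge1 (alpha g : R) : (1 <= alpha)%R -> (alpha < g)%R ->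
  moment LR0 alpha = 1 -> moment LR0 g <= 1 ->
  1 <= \int[PLR]_w ((LR0 w).1 + (LR0 w).2)%:E.
Proof.
move=> a1 ag ma mg.
have a0 : (0 < alpha)%R by exact: lt_le_trans a1.
have g0 : (0 < g)%R by exact: lt_trans ag.
(* alpha is the barycenter of 1 and [g] with weights [th] and [1 - th]. *)
pose th := ((g - alpha) / (g - 1))%R.
have g1 : (0 < g - 1)%R by rewrite subr_gt0 (le_lt_trans a1).
have th0 : (0 < th)%R by rewrite divr_gt0// subr_gt0.
have th1 : (th <= 1)%R by rewrite ler_pdivrMr// mul1r lerB.
have alE : alpha = (th + g * (1 - th))%R by rewrite /th; field; rewrite gt_eqF.
have ineq x : (0 <= x)%R -> (x `^ alpha <= th * x + (1 - th) * x `^ g)%R.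
  move=> x0; have := powR_weighted_amgm (th := th) _ x0 (powR_ge0 x g).
  rewrite (ltW th0) th1 => /(_ isT); rewrite -powRrM => le1.
  have [->|xn0] := eqVneq x 0%R.
    by rewrite powR0 ?gt_eqF// addr_ge0 ?mulr0// mulr_ge0 ?powR_ge0// subr_ge0.
  by rewrite {1}alE powRD// xn0 implybT.
have mLR : measurable_fun setT (fun w => ((LR0 w).1 + (LR0 w).2)%:E).
  apply/measurable_EFinP; apply: measurable_funD.
    exact: measurable_smoothL.
  exact: measurable_smoothR.
have mS s : measurable_fun setT (fun w => ((LR0 w).1 `^ s)%:E + ((LR0 w).2 `^ s)%:E).
  by apply: emeasurable_funD; [exact: measurable_smoothL_powR
    |exact: measurable_smoothR_powR].
have S0 s w : setT w -> 0 <= ((LR0 w).1 `^ s)%:E + ((LR0 w).2 `^ s)%:E.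
  by rewrite adde_ge0 ?lee_fin ?powR_ge0.
have LR0' w : setT w -> 0 <= ((LR0 w).1 + (LR0 w).2)%:E.
  by have [L0 R0] := LR0_ge0 w; rewrite lee_fin addr_ge0.
have mE s : s != 0%R -> moment LR0 s =
    \int[PLR]_w (((LR0 w).1 `^ s)%:E + ((LR0 w).2 `^ s)%:E).
  move=> s0; rewrite momentE// ge0_integralD//.
  - by move=> w _; rewrite lee_fin powR_ge0.
  - exact: measurable_smoothL_powR.
  - by move=> w _; rewrite lee_fin powR_ge0.
  - exact: measurable_smoothR_powR.
have thE : 0 <= th%:E by rewrite lee_fin ltW.
have th'E : 0 <= (1 - th)%:E by rewrite lee_fin subr_ge0.
have : 1 <= th%:E * \int[PLR]_w ((LR0 w).1 + (LR0 w).2)%:E + (1 - th)%:E * moment LR0 g.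
  rewrite -ma !mE ?gt_eqF//.
  rewrite -(ge0_integralZl _ _ mLR)// -(ge0_integralZl _ _ (mS g))//; last exact: S0.
  rewrite -ge0_integralD//; last 4 first.
  - by move=> w _; rewrite mule_ge0// LR0'.
  - exact: emeasurable_funM.
  - by move=> w _; rewrite mule_ge0// S0.
  - exact: emeasurable_funM.
  apply: ge0_le_integral => //; first exact: S0.
    by apply: emeasurable_funD; exact: emeasurable_funM.
  move=> w _; have [L0 R0] := LR0_ge0 w.
  rewrite -!EFinD lee_fin.
  by have := ineq _ L0; have := ineq _ R0; lra.
move=> le1.
have : 1 <= th%:E * \int[PLR]_w ((LR0 w).1 + (LR0 w).2)%:E + (1 - th)%:E.
  apply: (le_trans le1); rewrite leeD2l// -[leRHS]mule1.
  by rewrite lee_wpmul2l.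
rewrite -leeBlDr// -EFinB opprB addrCA subrr addr0.
rewrite -[leLHS]mule1 lee_pmul2l// lte_fin//.
Qed.

Lemma real_law_ge0 (mu : probability R R) u :
  mu [set z | (0 <= z)%R] = 1 -> real_law LR0 mu u [set z | (0 <= z)%R] = 1.
Proof.
have mS : measurable [set z : R | (0 <= z)%R].
  rewrite (_ : [set z | _] = `[0%R, +oo[%classic)//.
  by apply/seteqP; split=> z /=; rewrite in_itv/= andbT.
move=> mu1; elim: u => [//|l IHl r IHr].
rewrite [LHS](node_lawE _ _ (real_law LR0 mu l) (real_law LR0 mu r))//.
rewrite -[RHS](_ : \int[PLR]_w 1 = 1); last first.
  by rewrite integral_cst//= probability_setT mule1.
apply: eq_integral => w _; have [L0 R0] := LR0_ge0 w.
pose C := [set z : R | (0 <= z)%R].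
pose M : probability (R * R)%type R := real_law LR0 mu l \x real_law LR0 mu r.
pose S2 := [set p | C (smooth LR0 (w, p))].
have mS2 : measurable S2.
  have mw : measurable_fun setT (fun p => smooth LR0 (w, p)).
    by apply: measurableT_comp => //; exact: measurable_pair1.
  by rewrite -[S2]setTI; exact: mw.
apply/eqP; rewrite eq_le; apply/andP; split; first exact: (probability_le1 M mS2).
apply: (@le_trans _ _ (M (C `*` C))).
  rewrite (_ : M (C `*` C) = 1)//.
  transitivity (real_law LR0 mu l C * real_law LR0 mu r C).
    exact: product_measure1E.
  by rewrite -[RHS]mule1; congr (_ * _); [exact: IHl|exact: IHr].
apply: le_measure; rewrite ?inE//; first exact: measurableX.
by move=> [x y] [/= x0 y0]; rewrite /S2 /C /smooth /= addr_ge0 ?mulr_ge0.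
Qed.

End smoothing_facts.

(** * Laws of merged summands *)

Section uniqueness_of_laws.
Local Open Scope ereal_scope.
Context {R : realType}.

Lemma eq_cdf_law (mu nu : probability R R) :
  (forall r, mu `]-oo, r]%classic = nu `]-oo, r]%classic) ->
  forall A, measurable A -> mu A = nu A.
Proof.
move=> eq_cdf.
have itvC (r : R) : `]r, +oo[%classic = ~` `]-oo, r]%classic by rewrite setCitvl.
apply: (@measure_unique _ R R (@RGenOInfty.G R)
  (fun n => `](- n%:R)%R, +oo[%classic)).
- exact: RGenOInfty.measurableE.
- move=> _ _ [x ->] [y ->]; exists (Num.max x y).
  by apply/seteqP; split=> z /=; rewrite !in_itv/= !andbT gt_max => /andP.
- by move=> n; exists (- n%:R)%R.
- apply/seteqP; split=> // x _; exists (Num.truncn `|x|).+1 => //=.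
  rewrite in_itv/= andbT ltrNl (le_lt_trans _ (truncnS_gt _))//.
  by rewrite (le_trans (ler_norm _))// normrN.
- move=> _ [x ->]; rewrite itvC; transitivity (1 - mu `]-oo, x]%classic).
    exact: (probability_setC mu).
  by rewrite eq_cdf; apply/esym/(probability_setC nu).
- by move=> k; rewrite (le_lt_trans (probability_le1 mu _))// ltry.
Qed.

Lemma eq_cdf_distribution d1 (T1 : measurableType d1) (P1 : probability T1 R)
    d2 (T2 : measurableType d2) (P2 : probability T2 R)
    (X1 : {RV P1 >-> R}) (X2 : {RV P2 >-> R}) : cdf X1 =1 cdf X2 ->
  forall A, measurable A -> distribution P1 X1 A = distribution P2 X2 A.
Proof.
by move=> eqX; apply: (@eq_cdf_law (distribution P1 X1) (distribution P2 X2)).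
Qed.

Lemma prod_unique_scale d1 d2 (T1 : measurableType d1) (T2 : measurableType d2)
    (m1 : probability T1 R) (m2 : probability T2 R)
    (m : {measure set (T1 * T2) -> \bar R}) (k : R) : (0 <= k)%R ->
  (forall A B, measurable A -> measurable B ->
    m (A `*` B) = k%:E * (m1 A * m2 B)) ->
  forall C, measurable C -> m C = k%:E * (m1 \x m2) C.
Proof.
move=> k0 mE C mC; move: k0; rewrite le_eqVlt => /predU1P[k0|k0].
  rewrite -k0 mul0e; apply/eqP; rewrite eq_le measure_ge0 andbT.
  apply: (@le_trans _ _ (m setT)); first by apply: le_measure; rewrite ?inE.
  by rewrite -setXTT mE// -k0 mul0e.
have ki0 : (0 <= k^-1)%R by rewrite invr_ge0 ltW.
have -> : (m1 \x m2) C = mscale (NngNum ki0) m C.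
  apply: product_measure_unique => // A B mA mB.
  rewrite /= /mscale/= mE// muleA -EFinM mulVf ?mul1e// gt_eqF//.
by rewrite /mscale/= muleA -EFinM mulfV ?mul1e// gt_eqF.
Qed.

End uniqueness_of_laws.

Section merge_pair.
Local Open Scope ereal_scope.
Context {R : realType} {dLR} {TLR : measurableType dLR} (PLR : probability TLR R).
Context (LR0 : {RV PLR >-> (R * R)%type}).
Context {d} {T : measurableType d} (P : probability T R).
Context (Y : {mfun T >-> (R * R)%type}) (a b : {mfun T >-> R}).

Definition smooth_rv (w : T) : R := ((Y w).1 * a w + (Y w).2 * b w)%R.

Lemma measurable_smooth_rv : measurable_fun setT smooth_rv.
Proof.
by apply: measurable_funD; apply: measurable_funM => //;
  apply: measurableT_comp => //; exact: measurable_funPT.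
Qed.

HB.instance Definition _ :=
  isMeasurableFun.Build _ _ _ _ smooth_rv measurable_smooth_rv.

(** The event [H] stands for everything that has already been conditioned upon; [k] is the probability
    left over by the factors that do not concern the merged pair. *)
Lemma smooth_rv_law (H : set T) (k : R) (mua mub : probability R R) :
  measurable H -> (0 <= k)%R ->
  (forall G A B, measurable G -> measurable A -> measurable B ->
    P (H `&` (Y @^-1` G `&` (a @^-1` A `&` b @^-1` B))) =
    k%:E * (distribution PLR LR0 G * (mua A * mub B))) ->
  forall C, measurable C ->
    P (H `&` smooth_rv @^-1` C) = k%:E * node_law PLR (smooth LR0) mua mub C.
Proof.
move=> mH k0 HE C mC.
have mab : measurable_fun setT (fun w => (a w, b w)).
  by apply: measurable_fun_pair; exact: measurable_funPT.
have mYab : measurable_fun setT (fun w => (Y w, (a w, b w))).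
  by apply: measurable_fun_pair => //; exact: measurable_funPT.
have mY G : measurable G -> measurable (Y @^-1` G).
  by move=> mG; rewrite -[X in measurable X]setTI; exact: measurable_funPT.
pose M : probability (R * R)%type R := mua \x mub.
have abE G B : measurable G -> measurable B ->
    P (H `&` (Y @^-1` G `&` (fun w => (a w, b w)) @^-1` B)) =
    (k * fine (distribution PLR LR0 G))%:E * M B.
  move=> mG mB.
  have mHY : measurable (H `&` Y @^-1` G) by exact: measurableI (mY _ mG).
  have kG0 : (0 <= k * fine (distribution PLR LR0 G))%R.
    by rewrite mulr_ge0// fine_ge0.
  have := @prod_unique_scale R _ _ R R mua mub
    (pushforward (mrestr P mHY) (fun w => (a w, b w))) _ kG0 _ B mB.
  rewrite /pushforward /mrestr => /(_ mab) <-.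
    by congr (P _); rewrite setIA setIC.
  move=> A1 A2 mA1 mA2.
  transitivity (P (H `&` (Y @^-1` G `&` (a @^-1` A1 `&` b @^-1` A2)))).
    by rewrite /pushforward /mrestr [X in _ = P X]setIA [X in _ = P X]setIC.
  by rewrite HE// EFinM fineK ?fin_num_measure// muleA.
pose lam : probability (R * R)%type R := distribution PLR LR0.
pose comb := fun p : (R * R) * (R * R) => (p.1.1 * p.2.1 + p.1.2 * p.2.2)%R.
have mcomb : measurable_fun setT comb.
  by apply: measurable_funD; apply: measurable_funM;
    apply: measurableT_comp.
have mCC : measurable (comb @^-1` C) by rewrite -[X in measurable X]setTI; exact: mcomb.
have := @prod_unique_scale R _ _ (R * R)%type (R * R)%type lam M
    (pushforward (mrestr P mH) (fun w => (Y w, (a w, b w)))) k k0 _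
    (comb @^-1` C).
move=> /(_ mYab); rewrite {1}/pushforward {1}/mrestr => HC.
transitivity (k%:E * (lam \x M) (comb @^-1` C)).
  rewrite -HC; first by rewrite setIC.
    move=> G B mG mB.
    transitivity (P (H `&` (Y @^-1` G `&` (fun w => (a w, b w)) @^-1` B))).
      by rewrite /pushforward /mrestr [X in _ = P X]setIC.
    by rewrite abE// EFinM fineK ?fin_num_measure// muleA.
  exact: mCC.
congr (_ * _); rewrite (node_lawE _ _ mua mub mC) /product_measure1.
rewrite ge0_integral_distribution; last by [].
  by apply: eq_integral => w _ /=; congr (_ _); apply/seteqP; split=> -[x y]/=;
    rewrite xsectionP.
exact: measurable_fun_xsection.
Qed.

End merge_pair.

(** * Independence is preserved by merging neighbours *)

Section law_of_forest_sums.
Local Open Scope ereal_scope.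
Context {R : realType} {dLR} {TLR : measurableType dLR} (PLR : probability TLR R).
Context (LR0 : {RV PLR >-> (R * R)%type}).
Context {d} {T : measurableType d} (P : probability T R).
Context (LR : nat -> {RV P >-> (R * R)%type}) (I : nat -> {RV P >-> nat}).
Context (mu : probability R R).
Local Notation law := (real_law LR0 mu).

Definition hits (xs : seq {mfun T >-> R}) (es : seq (set R)) : set T :=
  \big[setI/setT]_(p <- zip xs es) (p.1 @^-1` p.2).

Definition hits_at {dU} {U : measurableType dU} n (Y : nat -> {mfun T >-> U})
    (G : nat -> set U) : set T :=
  \big[setI/setT]_(1 <= k < n.+1) (Y k @^-1` G k).

(** The invariant of the backward reading.  On the event [D], the summands [xs] are independent with
    laws indexed by the trees [us], and independent of the splits that are still to be undone. *)
Definition indep_forest n (D : set T) (xs : seq {mfun T >-> R}) (us : seq tree) :=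
  [/\ measurable D, size xs = n.+1, size us = n.+1 &
   forall (es : seq (set R)) (G : nat -> set (R * R)) (J : nat -> set nat),
     size es = n.+1 -> (forall i, measurable (nth setT es i)) ->
     (forall k, measurable (G k)) ->
     P (D `&` hits xs es `&` (hits_at n LR G `&` hits_at n I J)) =
     P D * \prod_(p <- zip us es) law p.1 p.2 *
     \prod_(1 <= k < n.+1) (distribution PLR LR0 (G k) * P (I k @^-1` J k))].

Definition zero_rv : {mfun T >-> R} := cst 0%R.

Definition merge n i (xs : seq {mfun T >-> R}) : seq {mfun T >-> R} :=
  take i xs ++ (smooth_rv (LR n) (nth zero_rv xs i) (nth zero_rv xs i.+1)
    : {mfun T >-> R}) :: drop i.+2 xs.

Lemma measurable_mfun {dU} {U : measurableType dU} (f : {mfun T >-> U}) A :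
  measurable A -> measurable (f @^-1` A).
Proof. by move=> mA; rewrite -[X in measurable X]setTI; exact: measurable_funPT. Qed.

Lemma measurable_hits xs es : (forall i, measurable (nth setT es i)) ->
  measurable (hits xs es).
Proof.
rewrite /hits; elim: xs es => [|x xs IH] [|e es] mes; rewrite ?big_nil//=.
rewrite big_cons; apply: measurableI; last by apply: IH => i; exact: (mes i.+1).
by apply: measurable_mfun; exact: (mes 0%N).
Qed.

Lemma measurable_hits_at {dU} {U : measurableType dU} n
    (Y : nat -> {mfun T >-> U}) (G : nat -> set U) :
  (forall k, measurable (G k)) -> measurable (hits_at n Y G).
Proof.
move=> mG; rewrite /hits_at; apply: bigsetI_measurable => k _.
exact: measurable_mfun.
Qed.

Lemma hits_nseq xs : hits xs (nseq (size xs) setT) = setT.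
Proof.
rewrite /hits; elim: xs => [|x xs IH] /=; first by rewrite big_nil.
by rewrite big_cons IH setIT.
Qed.

Lemma law_nseq us : \prod_(p <- zip us (nseq (size us) setT)) law p.1 p.2 = 1.
Proof.
elim: us => [|u us IH] /=; first by rewrite big_nil.
by rewrite big_cons IH mule1; exact: (probability_setT (law u)).
Qed.

Lemma law_prod_fin us es : (forall i, measurable (nth setT es i)) ->
  0 <= \prod_(p <- zip us es) law p.1 p.2 /\
  \prod_(p <- zip us es) law p.1 p.2 \is a fin_num.
Proof.
elim: us es => [|u us IH] [|e es] mes; rewrite /= ?big_nil//.
have [i|ge0 fin] := IH es; first exact: (mes i.+1).
rewrite big_cons; split; first by rewrite mule_ge0.
by rewrite fin_numM// fin_num_measure//; exact: (mes 0%N).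
Qed.

Lemma hits_cat xs1 xs2 es1 es2 : size xs1 = size es1 ->
  hits (xs1 ++ xs2) (es1 ++ es2) = hits xs1 es1 `&` hits xs2 es2.
Proof. by move=> s1; rewrite /hits zip_cat// big_cat. Qed.

Lemma hits_cons x xs e es : hits (x :: xs) (e :: es) = x @^-1` e `&` hits xs es.
Proof. by rewrite /hits /= big_cons. Qed.

Lemma hits_atS {dU} {U : measurableType dU} n
    (Y : nat -> {mfun T >-> U}) (G : nat -> set U) :
  hits_at n.+1 Y G = hits_at n Y G `&` Y n.+1 @^-1` G n.+1.
Proof. by rewrite /hits_at big_nat_recr. Qed.

Lemma eq_hits_at {dU} {U : measurableType dU} n
    (Y : nat -> {mfun T >-> U}) (G G' : nat -> set U) :
  (forall k, (k <= n)%N -> G k = G' k) -> hits_at n Y G = hits_at n Y G'.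
Proof.
by move=> GG'; apply: eq_big_nat => k /andP[_ kn]; rewrite GG'.
Qed.

Lemma hits_at_setT {dU} {U : measurableType dU} n (Y : nat -> {mfun T >-> U}) :
  hits_at n Y (fun=> setT) = setT.
Proof. by rewrite /hits_at big1// => k _; rewrite preimage_setT. Qed.

Lemma indep_forest_split n D xs us i : indep_forest n.+1 D xs us ->
  P (D `&` I n.+1 @^-1` [set i]) = P D * P (I n.+1 @^-1` [set i]).
Proof.
move=> [mD sxs sus /(_ (nseq n.+2 setT) (fun=> setT)
  (fun k => if k == n.+1 then [set i] else setT))].
rewrite size_nseq => /(_ erefl) indepD.
have mT j : measurable (nth setT (nseq n.+2 (@setT R)) j).
  by rewrite nth_nseq if_same.
move: (indepD mT (fun=> measurableT)).
rewrite -{1}sxs -{1}sus hits_nseq law_nseq setIT mule1 !hits_atS eqxx preimage_setT setIT.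
rewrite (@eq_hits_at _ _ _ LR _ (fun=> setT))//.
rewrite (@eq_hits_at _ _ _ I _ (fun=> setT)); last first.
  by move=> k kn; rewrite ltn_eqF// ltnS.
rewrite !hits_at_setT !setTI.
rewrite big_nat_recr//= eqxx big_nat_cond big1 ?mul1e; last first.
  move=> k /andP[/andP[_ kn] _]; rewrite ltn_eqF//.
  by rewrite !preimage_setT !probability_setT mule1.
by rewrite probability_setT mul1e.
Qed.

(** Undoing the [n.+1]-st split at the place [i.+1] replaces two neighbouring summands by their
    smoothing and their trees by the tree that joins them, and uses up the pair and the index of that
    split. *)
Lemma indep_forest_merge n D xs us i : (i <= n)%N ->
  indep_forest n.+1 D xs us ->
  indep_forest n (D `&` I n.+1 @^-1` [set i.+1]) (merge n.+1 i xs) (fuse i us).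
Proof.
move=> i_n indepD; have PD' := indep_forest_split i.+1 indepD.
case: indepD => mD sxs sus indepD.
have mI : measurable (I n.+1 @^-1` [set i.+1]) by exact: measurable_mfun.
split.
- exact: measurableI.
- by rewrite size_cat/= size_takel ?size_drop sxs; lia.
- exact: size_fuse.
move=> es G J ses mes mG.
pose s1 := take i xs; pose s2 := drop i.+2 xs.
pose a := nth zero_rv xs i : {mfun T >-> R}.
pose b := nth zero_rv xs i.+1 : {mfun T >-> R}.
have xsE : xs = s1 ++ a :: b :: s2.
  by rewrite -drop_nth ?sxs// -drop_nth ?cat_take_drop// sxs; lia.
have ss1 : size s1 = i by rewrite size_takel// sxs; lia.
have [|t1 [u [v [t2 [usE st1]]]]] := @split_pair i us; first by rewrite sus.
pose e1 := take i es; pose c := nth setT es i; pose e2 := drop i.+1 es.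
have esE : es = e1 ++ c :: e2.
  by rewrite -drop_nth ?ses// cat_take_drop.
have se1 : size e1 = i by rewrite size_takel// ses; lia.
have mc : measurable c by exact: mes.
have me1 j : measurable (nth setT e1 j).
  have [ji|ij] := ltnP j i; first by rewrite nth_take.
  by rewrite nth_default// se1.
have me2 j : measurable (nth setT e2 j) by rewrite nth_drop; exact: mes.
pose J' k := if k == n.+1 then [set i.+1] else J k.
pose H := D `&` (hits s1 e1 `&` hits s2 e2) `&`
  (hits_at n LR G `&` (hits_at n I J `&` I n.+1 @^-1` [set i.+1])).
have mH : measurable H.
  apply: measurableI; first by apply: measurableI => //;
    apply: measurableI; exact: measurable_hits.
  apply: measurableI; first exact: measurable_hits_at.
  by apply: measurableI => //; exact: measurable_hits_at.
pose rest := \prod_(p <- zip t1 e1) law p.1 p.2 * \prod_(p <- zip t2 e2) law p.1 p.2.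
pose past := \prod_(1 <= k < n.+1) (distribution PLR LR0 (G k) * P (I k @^-1` J k)).
pose kE := P D * rest * past * P (I n.+1 @^-1` [set i.+1]).
have [rest1_ge0 rest1_fin] := law_prod_fin t1 me1.
have [rest2_ge0 rest2_fin] := law_prod_fin t2 me2.
have [past_ge0 past_fin] : 0 <= past /\ past \is a fin_num.
  rewrite /past; apply: (big_ind (fun x => 0 <= x /\ x \is a fin_num)) => //.
    by move=> x y [x0 xf] [y0 yf]; rewrite mule_ge0// fin_numM.
  move=> k _; rewrite mule_ge0// fin_numM// fin_num_measure//.
  exact: measurable_mfun.
have kfin : kE \is a fin_num by rewrite /kE /rest !fin_numM// fin_num_measure.
have k0 : (0 <= fine kE)%R by rewrite fine_ge0// /kE /rest !mule_ge0.
have HE G0 A B : measurable G0 -> measurable A -> measurable B ->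
    P (H `&` (LR n.+1 @^-1` G0 `&` (a @^-1` A `&` b @^-1` B))) =
    (fine kE)%:E * (distribution PLR LR0 G0 * (law u A * law v B)).
  move=> mG0 mA mB; rewrite fineK//.
  pose es' := e1 ++ A :: B :: e2.
  pose G' k := if k == n.+1 then G0 else G k.
  have := indepD es' G' J'.
  rewrite xsE usE /es' hits_cat ?ss1 ?se1// !hits_cons !hits_atS /G' /J' !eqxx.
  rewrite (@eq_hits_at _ _ _ LR _ G); last by move=> k kn; rewrite ltn_eqF// ltnS.
  rewrite (@eq_hits_at _ _ _ I _ J); last by move=> k kn; rewrite ltn_eqF// ltnS.
  rewrite big_nat_recr// zip_cat ?st1 ?se1// big_cat [zip (u :: _) _]/= !big_cons !eqxx.
  rewrite (eq_big_nat _ _ (F2 := fun k => distribution PLR LR0 (G k) * P (I k @^-1` J k)));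
    last by move=> k /andP[_ kn]; rewrite ltn_eqF.
  rewrite -/past => HH; transitivity (P D * (\prod_(p <- zip t1 e1) law p.1 p.2 *
     (law u A * (law v B * \prod_(p <- zip t2 e2) law p.1 p.2))) *
     (past * (distribution PLR LR0 G0 * P (I n.+1 @^-1` [set i.+1])))).
    rewrite -HH.
    - by congr (P _); apply/seteqP; split=> w; rewrite /H /=; tauto.
    - by rewrite size_cat/= se1 size_drop ses; lia.
    - move=> j; rewrite nth_cat; case: ifP => // _.
      by case: (j - _)%N => [|[|j']] //=; exact: me2.
    - by move=> k; case: ifP.
  by rewrite /kE /rest !muleA [LHS](ACl (1*2*5*6*8*7*3*4)).
have := smooth_rv_law mH k0 HE mc; rewrite fineK// => PH.
rewrite PD' /merge -/s1 -/a -/b -/s2 usE -st1 fuse_cat {1 2}esE.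
rewrite hits_cat ?ss1 ?se1// hits_cons zip_cat ?st1 ?se1// big_cat.
rewrite [zip (Node _ _ :: _) _]/= big_cons -/past.
transitivity (kE * law (Node u v) c).
  by rewrite -PH; congr (P _); apply/seteqP; split=> w; rewrite /H /=; tauto.
by rewrite /kE /rest /= !muleA [LHS](ACl (1*5*2*6*3*4)).
Qed.

End law_of_forest_sums.

(** * The law of a weighted sum of leaves *)

Section law_of_V.
Local Open Scope ereal_scope.
Context {R : realType} {dLR} {TLR : measurableType dLR} (PLR : probability TLR R).
Context (LR0 : {RV PLR >-> (R * R)%type}).
Context {d} {T : measurableType d} (P : probability T R).
Context (LR : nat -> {RV P >-> (R * R)%type}) (I : nat -> {RV P >-> nat}).
Context (mu : probability R R).
Local Notation law := (real_law LR0 mu).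

Definition weighted_sum n (xs : seq {mfun T >-> R}) (w : T) : R :=
  (\sum_(0 <= j < n.+1) beta LR I n.+1 j.+1 w * nth (@zero_rv R d T) xs j w)%R.

(** The recursion for the weights, seen from the summands: the two weights created by the split at
    [i.+1] have a common factor, so that their two terms collapse to one. *)
Lemma weighted_sum_merge n (xs : seq {mfun T >-> R}) i w : (i <= n)%N ->
  size xs = n.+2 -> I n.+1 w = i.+1 ->
  weighted_sum n.+1 xs w = weighted_sum n (merge LR n.+1 i xs) w.
Proof.
move=> i_n sxs Ii; rewrite /weighted_sum.
have nthm j : nth (@zero_rv R d T) (merge LR n.+1 i xs) j w =
    if (j < i)%N then nth (@zero_rv R d T) xs j w
    else if j == i then smooth_rv (LR n.+1) (nth (@zero_rv R d T) xs i)
      (nth (@zero_rv R d T) xs i.+1) w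
    else nth (@zero_rv R d T) xs j.+1 w.
  rewrite /merge nth_cat size_takel; last by rewrite sxs; lia.
  case: ltnP => ji; first by rewrite nth_take.
  case: eqVneq => [->|ne]; first by rewrite subnn.
  have [k ->] : exists k, j = (i + k.+1)%N by exists (j - i).-1; lia.
  by rewrite addKn /= nth_drop !addSn addnS.
case: n => [|n] in i_n sxs Ii nthm *.
  move: i_n nthm; rewrite leqn0 => /eqP -> nthm.
  rewrite big_nat_recl// !big_nat1 /= nthm/= /smooth_rv mul1r.
  by [].
have beE j : beta LR I n.+3 j.+1 w =
    if (j < i)%N then beta LR I n.+2 j.+1 w
    else if j == i then ((LR n.+2 w).1 * beta LR I n.+2 i.+1 w)%R
    else if j == i.+1 then ((LR n.+2 w).2 * beta LR I n.+2 i.+1 w)%R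
    else beta LR I n.+2 j w.
  by rewrite [LHS]/= -/(beta LR I n.+2) Ii !ltnS !eqSS.
rewrite (@big_cat_nat _ _ _ i 0 n.+3)//; last by lia.
rewrite [X in _ = X](@big_cat_nat _ _ _ i 0 n.+2)//; last by lia.
congr (_ + _)%R.
  by apply: eq_big_nat => j /andP[_ ji]; rewrite beE ji nthm ji.
rewrite (@big_ltn _ _ _ i); last by lia.
rewrite (@big_ltn _ _ _ i.+1); last by lia.
rewrite [in RHS](@big_ltn _ _ _ i); last by lia.
have [e1 e2] : (i.+1 < i)%N = false /\ (i.+1 == i) = false by split; lia.
rewrite !beE nthm !ltnn !eqxx e1 e2.
rewrite -[LHS]/(_ + (_ + _))%R -[RHS]/(_ + _)%R addrA.
congr (_ + _)%R; first by rewrite /smooth_rv; ring.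
rewrite big_add1 -[n.+3.-1]/n.+2; apply: eq_big_nat => j /andP[ij _].
have [e3 [e4 [e5 [e6 e7]]]] : (j.+1 < i)%N = false /\ (j.+1 == i) = false /\
  (j.+1 == i.+1) = false /\ (j < i)%N = false /\ (j == i) = false.
  by do !split; lia.
by rewrite beE nthm e3 e4 e5 e6 e7.
Qed.

(** Averaging over the index of the last split, which is uniform and independent of the rest, is one
    step of [forest_mean]. *)
Lemma forest_sum_law n D (xs : seq {mfun T >-> R}) us : 
  (forall m i, (1 <= i <= m)%N -> P (I m @^-1` [set i]) = (m%:R^-1)%:E) ->
  indep_forest LR0 LR I mu n D xs us -> forall A, measurable A ->
  P (D `&` weighted_sum n xs @^-1` A) =
  P D * (forest_mean n us (fun u => fine (law u A)))%:E.
Proof.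
move=> I_law; elim: n D xs us => [|n IH] D xs us indepD A mA.
  case: indepD => mD sxs sus indepD.
  have mes i : measurable (nth setT [:: A] i).
    by case: i => //= i; rewrite nth_nil.
  have := indepD [:: A] (fun=> setT) (fun=> setT) erefl mes (fun=> measurableT).
  rewrite /hits_at !big_geq// !setIT mule1.
  case: xs sxs {indepD} => [//|x [|//]] _; case: us sus => [//|u [|//]] _.
  rewrite /hits /= !big_seq1/= fineK; last first.
    exact: (fin_num_measure (law u)).
  move=> <-; rewrite (_ : weighted_sum 0 [:: x] = x)//; apply/funext => w.
  by rewrite /weighted_sum big_nat1 /= mul1r.
case: (indepD) => mD sxs sus _.
have mws m (ys : seq {mfun T >-> R}) : measurable_fun setT (weighted_sum m ys).
  have : measurable_fun setT (fun w => \sum_(0 <= j < m.+1)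
      beta LR I m.+1 j.+1 w * nth (@zero_rv R d T) ys j w)%R.
    apply: measurable_sum => j; apply: measurable_funM; first exact: measurable_beta.
    exact: measurable_funPT.
  by [].
have mF : measurable (D `&` weighted_sum n.+1 xs @^-1` A).
  by apply: measurableI => //; rewrite -[X in measurable X]setTI; exact: mws.
pose S (i : 'I_n.+1) := I n.+1 @^-1` [set (i : nat).+1].
have mS i : measurable (S i) by exact: measurable_mfun.
have tS : trivIset setT S.
  apply/trivIsetP => i j _ _ ij; apply/seteqP; split=> // w [Si Sj].
  have [ijE] : (i : nat).+1 = (j : nat).+1 by rewrite -Si -Sj.
  by case/eqP: ij; exact: val_inj.
pose N := \big[setU/set0]_(i < n.+1) S i.
have mN : measurable N by exact: bigsetU_measurable.
have PN : P N = 1.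
  rewrite [LHS]measure_bigsetU_ord//.
  transitivity (\sum_(i < n.+1) (n.+1%:R^-1)%:E : \bar R).
    by apply: eq_bigr => i _; apply: I_law; rewrite ltn_ord.
  rewrite sumEFin sumr_const card_ord -[(_ *+ _)%R]mulr_natr mulVf//.
have PNC : P (~` N) = 0 by rewrite probability_setC// PN subee.
rewrite -(setIT (D `&` _)) -(setUv N) setIUr measureU//; last 3 first.
- exact: measurableI.
- by apply: measurableI => //; exact: measurableC.
- by rewrite setIACA setICr setI0.
rewrite [X in _ + X](_ : _ = 0) ?adde0; last first.
  apply/eqP; rewrite eq_le measure_ge0 andbT -PNC.
  apply: le_measure; rewrite ?inE//; last exact: measurableC.
  by apply: measurableI => //; exact: measurableC.
rewrite /N big_distrr/= [LHS]measure_bigsetU_ord//; last 2 first.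
- by move=> i; exact: measurableI.
- exact: trivIset_setIl.
have PDE : P D = (fine (P D))%:E by rewrite fineK// fin_num_measure.
transitivity (\sum_(i < n.+1) (fine (P D) * (n.+1%:R^-1 *
    forest_mean n (fuse i us) (fun u => fine (law u A))))%:E); last first.
  by rewrite sumEFin -!mulr_sumr EFinM -PDE.
apply: eq_bigr => i _; have i_n : (i <= n)%N by rewrite -ltnS.
have -> : D `&` weighted_sum n.+1 xs @^-1` A `&` S i =
    (D `&` S i) `&` weighted_sum n (merge LR n.+1 i xs) @^-1` A.
  apply/seteqP; split=> w [[]].
    move=> Dw Aw Sw; split; first by split.
    by rewrite /= -weighted_sum_merge.
  by move=> Dw Sw; rewrite /= -weighted_sum_merge// => Aw; split.
rewrite [LHS](IH _ _ _ (indep_forest_merge i_n indepD) A mA).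
rewrite (indep_forest_split i.+1 indepD) I_law ?ltnS//.
by rewrite -muleA !EFinM -PDE.
Qed.

End law_of_V.

(** * The law of V_t *)

Section initial_independence.
Local Open Scope ereal_scope.

Lemma big_zip_map_iota (S A B : Type) (idx : S) (op : S -> S -> S) (F : A -> B -> S)
    (f : nat -> A) (b0 : B) N m (es : seq B) : size es = N ->
  \big[op/idx]_(p <- zip [seq f k | k <- iota m N] es) F p.1 p.2 =
  \big[op/idx]_(k <- iota m N) F (f k) (nth b0 es (k - m)).
Proof.
elim: N m es => [|N IH] m [|e es]//=; first by rewrite !big_nil.
move=> [ses]; rewrite !big_cons subnn /=; congr (op _ _); rewrite IH//.
apply: eq_big_seq => k; rewrite mem_iota => /andP[mk _].
by have -> : (k - m = (k - m.+1).+1)%N by lia.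
Qed.

Lemma g_sigma_bigI d' (T : measurableType d') (C : set (set T)) (J : Type) (r : seq J) (F : J -> set T) :
  (forall j, <<s C >> (F j)) -> <<s C >> (\big[setI/setT]_(j <- r) F j).
Proof.
move=> CF; apply: (big_ind (fun A => <<s C >> A)) => //.
- exact: (@measurableT _ (g_sigma_algebraType C)).
- by move=> A B CA CB; exact: (@measurableI _ (g_sigma_algebraType C)).
Qed.

Context {R : realType} {dLR} {TLR : measurableType dLR} (PLR : probability TLR R).
Context (LR0 : {RV PLR >-> (R * R)%type}).
Context {d0} {T0 : measurableType d0} (P0 : probability T0 R) (X0 : {RV P0 >-> R}).
Context {d} {T : measurableType d} (P : probability T R).
Context (X : nat -> {RV P >-> R}).
Context (LR : nat -> {RV P >-> (R * R)%type}) (I : nat -> {RV P >-> nat}).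
Context (nu : R -> {RV P >-> nat}).
Hypothesis X_law : forall n, (0 < n)%N -> cdf (X n) =1 cdf X0.
Hypothesis X_indep : independent P [set n | (0 < n)%N] (fun n => sigma_rv (X n)).
Hypothesis LR_law : forall n, (0 < n)%N -> forall A : set (R * R), measurable A ->
  distribution P (LR n) A = distribution PLR LR0 A.
Hypothesis LR_indep : independent P [set n | (0 < n)%N] (fun n => sigma_rv (LR n)).
Hypothesis I_law : forall n i, (1 <= i <= n)%N ->
  P (I n @^-1` [set i]) = (n%:R^-1)%:E.
Hypothesis I_indep : independent P [set n | (0 < n)%N] (fun n => sigma_rv (I n)).
Hypothesis nu_gt0 : forall t : R, (0 <= t)%R -> forall w, (0 < nu t w)%N.
Hypothesis nu_law : forall t : R, (0 <= t)%R -> forall n, (0 < n)%N ->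
  P (nu t @^-1` [set n]) = (expR (- t) * (1 - expR (- t)) ^+ n.-1)%:E.
Hypothesis families_indep : independent P [set: 'I_4] (fun k => nth set0
   [:: sigma_family [set n | (0 < n)%N] X;
       sigma_family [set n | (0 < n)%N] LR;
       sigma_family [set n | (0 < n)%N] I;
       sigma_family [set t : R | (0 <= t)%R] nu] k).

Lemma sigma_family_preimage (K : Type) (D : set K) dU (U : measurableType dU)
    (Y : K -> T -> U) k B : D k -> measurable B -> sigma_family D Y (Y k @^-1` B).
Proof.
move=> Dk mB; apply: sub_sigma_algebra; exists k => //.
by exists B => //; rewrite setTI.
Qed.

Lemma independent_bigI dU (U : measurableType dU) (Y : nat -> {RV P >-> U})
    (s : seq nat) (E : nat -> set U) :
  independent P [set n | (0 < n)%N] (fun n => sigma_rv (Y n)) ->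
  uniq s -> {in s, forall k, (0 < k)%N} -> (forall k, measurable (E k)) ->
  P (\big[setI/setT]_(k <- s) (Y k @^-1` E k)) = \prod_(k <- s) P (Y k @^-1` E k).
Proof.
move=> indY us s0 mE; rewrite -bigcap_seq; apply: (indY s (fun k => Y k @^-1` E k)) => //.
by move=> k ks; split; [exact: s0|exists (E k) => //; rewrite setTI].
Qed.

Lemma indep_forest_init t n : (0 <= t)%R ->
  indep_forest LR0 LR I (distribution P0 X0) n (nu t @^-1` [set n.+1])
    [seq (X k : {mfun T >-> R}) | k <- iota 1 n.+1] (nseq n.+1 Leaf).
Proof.
move=> t0; split.
- exact: measurable_mfun.
- by rewrite size_map size_iota.
- by rewrite size_nseq.
move=> es G J ses mes mG.
pose A := [:: \big[setI/setT]_(k <- iota 1 n.+1) (X k @^-1` nth setT es (k - 1));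
  hits_at n LR G; hits_at n I J; nu t @^-1` [set n.+1]].
have s4 : uniq [:: inord 0; inord 1; inord 2; inord 3 : 'I_4].
  by rewrite /= !inE -!val_eqE/= !inordK.
have iota0 : {in iota 1 n.+1, forall k, (0 < k)%N}.
  by move=> k; rewrite mem_iota => /andP[].
have iota0' : {in index_iota 1 n.+1, forall k, (0 < k)%N}.
  by move=> k; rewrite mem_index_iota => /andP[].
have := families_indep (A := fun k => nth set0 A k) s4.
rewrite bigcap_seq !big_cons !big_nil !inordK// setIT mule1 => PA.
have leafE : nseq n.+1 Leaf = [seq Leaf | k <- iota 1 n.+1].
  by elim: (n.+1) 1%N => //= m IH j; rewrite -IH.
have mem k : k \in [:: inord 0; inord 1; inord 2; inord 3 : 'I_4] ->
    [set: 'I_4] k /\ nth set0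
   [:: sigma_family [set n | (0 < n)%N] X;
       sigma_family [set n | (0 < n)%N] LR;
       sigma_family [set n | (0 < n)%N] I;
       sigma_family [set t : R | (0 <= t)%R] nu] k (nth set0 A k).
  have sub J' (r : seq nat) F C : {in r, forall k, (0 < k)%N} ->
      (forall k, (0 < k)%N -> <<s C >> (F k)) ->
      J' = \big[setI/setT]_(k <- r) F k -> <<s C >> (J' : set T).
    move=> r0 CF ->; rewrite big_seq_cond big_mkcond; apply: g_sigma_bigI => k'.
    rewrite andbT; case: ifP => [/r0/CF//|_].
    exact: (@measurableT _ (g_sigma_algebraType C)).
  rewrite !inE => /or4P[] /eqP ->; split => //; rewrite !inordK//=.
  - apply: (sub _ (iota 1 n.+1)) => // k' k0.
    exact: sigma_family_preimage.
  - apply: (sub _ (index_iota 1 n.+1)) => // k' k0.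
    exact: sigma_family_preimage.
  - apply: (sub _ (index_iota 1 n.+1)) => // k' k0.
    exact: sigma_family_preimage.
  - exact: sigma_family_preimage.
have {PA mem} := PA mem; rewrite ![nth set0 A _]/=.
rewrite (@independent_bigI _ _ X)//; last exact: (iota_uniq 1 n.+1).
rewrite /hits_at.
rewrite (@independent_bigI _ _ LR)//; last exact: iota_uniq.
rewrite (@independent_bigI _ _ I)//; last exact: iota_uniq.
rewrite -!/(hits_at _ _ _) => PA.
rewrite /hits (big_zip_map_iota _ _ (fun (x : {mfun T >-> R}) E => x @^-1` E) _ setT _ ses).
rewrite leafE (big_zip_map_iota _ _
  (fun u E => real_law LR0 (distribution P0 X0) u E) _ setT _ ses).
rewrite [in RHS]big_split/=.
transitivity (P (nu t @^-1` [set n.+1]) * (\prod_(k <- iota 1 n.+1)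
   P (X k @^-1` nth setT es (k - 1)) * (\prod_(1 <= k < n.+1) P (LR k @^-1` G k) *
   \prod_(1 <= k < n.+1) P (I k @^-1` J k)))).
  rewrite [RHS]muleC -!muleA -PA; congr (P _).
  by apply/seteqP; split=> w /=; tauto.
rewrite !muleA; congr (_ * _ * _ * _).
  apply: eq_big_seq => k /iota0 k0 /=; exact: (eq_cdf_distribution (X_law k0)).
by apply: eq_big_seq => k /iota0' k0; exact: LR_law.
Qed.

(** Probability that nu_t - 1 merges produce the tree [u]. *)
Definition tree_weight (t : R) (u : tree) : R :=
  expR (- t) * (1 - expR (- t)) ^+ inner u * hook u.

Lemma tree_weight_ge0 t u : (0 <= t)%R -> (0 <= tree_weight t u)%R.
Proof.
move=> t0; rewrite /tree_weight mulr_ge0 ?hook_ge0// mulr_ge0 ?expR_ge0// exprn_ge0//.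
by rewrite subr_ge0 -expR0 ler_expR oppr_le0.
Qed.

Lemma V_law t : (0 <= t)%R ->
  is_mixture (distribution P (V LR I X nu t)) (tree_weight t)
    (fun u => real_law LR0 (distribution P0 X0) u).
Proof.
move=> t0 A mA; pose law u := real_law LR0 (distribution P0 X0) u.
pose xs n := [seq (X k : {mfun T >-> R}) | k <- iota 1 n.+1].
have VE n w : nu t w = n.+1 -> V LR I X nu t w = weighted_sum LR I n (xs n) w.
  move=> nun; rewrite /V /= /V_fun nun big_add1 /weighted_sum.
  apply: eq_big_nat => j /andP[_ jn]; congr (_ * _)%R.
  by rewrite (nth_map 0%N) ?size_iota// nth_iota.
pose f u := fine (law u A).
have f0 u : (0 <= f u)%R by rewrite fine_ge0.
pose c n : R := (expR (- t) * (1 - expR (- t)) ^+ n)%R.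
have c0 n : (0 <= c n)%R.
  rewrite /c mulr_ge0 ?expR_ge0// exprn_ge0//.
  by rewrite subr_ge0 -expR0 ler_expR oppr_le0.
transitivity (\esum_(u in [set: tree]) (c (inner u) * hook u * f u)%:E); last first.
  apply: eq_esum => u _; rewrite EFinM /f fineK//.
  exact: (fin_num_measure (law u)).
rewrite -tree_mean_series// /distribution /pushforward.
set VA := _ @^-1` A; have mVA : measurable VA by exact: measurable_mfun.
pose D n := nu t @^-1` [set n.+1].
have mD n : measurable (D n) by exact: measurable_mfun.
have -> : VA = \bigcup_n (D n `&` VA).
  apply/seteqP; split=> [w VAw|w [n _ []]//]; exists (nu t w).-1 => //; split => //.
  by rewrite /D /= prednK// nu_gt0.
rewrite measure_semi_bigcup; last 3 first.
- by move=> n; exact: measurableI.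
- apply/trivIsetP => i j _ _ ij; apply/seteqP; split=> // w [[Di _] [Dj _]].
  have [ijE] : i.+1 = j.+1 by rewrite -Di -Dj.
  by rewrite ijE eqxx in ij.
- by apply: bigcup_measurable => n _; exact: measurableI.
apply: eq_eseriesr => n _.
transitivity (P (D n `&` weighted_sum LR I n (xs n) @^-1` A)).
  congr (P _); apply/seteqP; split=> w [Dw Aw]; split => //.
    by rewrite /= -(VE n w Dw).
  by rewrite /VA /preimage/= (VE n w Dw).
rewrite (forest_sum_law I_law (indep_forest_init n t0) mA).
by rewrite nu_law.
Qed.

End initial_independence.

(** * Growth of the mixture in time *)

Section tree_weight_growth.
Context {R : realType}.
Local Notation hook := (@hook R).

Lemma exprn_tangent_le (x y : R) n : 0 <= x <= y ->
  x ^+ n + n%:R * x ^+ n.-1 * (y - x) <= y ^+ n.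
Proof.
move=> /andP[x0 xy]; elim: n => [|n IH]; first by rewrite !expr0 !mul0r addr0.
rewrite [in leRHS]exprS.
apply: (@le_trans _ _ (y * (x ^+ n + n%:R * x ^+ n.-1 * (y - x)))); last first.
  by rewrite ler_wpM2l// (le_trans x0).
have nx : n%:R * x ^+ n.-1 * x = n%:R * x ^+ n.
  by case: n {IH} => [|n]; rewrite ?mul0r// -mulrA -exprSr.
have p0 : 0 <= n%:R * x ^+ n.-1 * (y - x) ^+ 2.
  by rewrite !mulr_ge0 ?exprn_ge0// subr_ge0.
rewrite -subr_ge0 (_ : _ - _ = n%:R * x ^+ n.-1 * (y - x) ^+ 2)//.
rewrite /= -natr1 exprSr; move: nx; set k := n%:R * x ^+ n.-1 => nx.
have -> : (n%:R + 1) * x ^+ n * (y - x) = k * x * (y - x) + x ^+ n * (y - x).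
  by rewrite nx; ring.
ring.
Qed.

Lemma tree_weight_growth_Leaf t s :
  expR (- s) * tree_weight t Leaf = tree_weight (t + s) Leaf :> R.
Proof. by rewrite /tree_weight /= !expr0 !mulr1 opprD expRD mulrC. Qed.

(** The first term is the part of order 0 and the second the part of order 1 in the expansion of the
    power of 1 - exp (- t - s) around that of 1 - exp (- t); the hook formula at the root splits the
    latter into the weights of the two subtrees. *)
Lemma tree_weight_growth_Node t s l r : 0 <= t -> 0 <= s ->
  expR (- s) * tree_weight t (Node l r) +
   expR (- s) * (1 - expR (- s)) * (tree_weight t l * tree_weight t r) <=
   tree_weight (t + s) (Node l r) :> R.
Proof.
move=> t0 s0; rewrite /tree_weight opprD expRD.
set q := expR (- t); set th := expR (- s).
have q0 : 0 < q by exact: expR_gt0.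
have th0 : 0 < th by exact: expR_gt0.
have q1 : q <= 1 by rewrite /q -expR0 ler_expR oppr_le0.
have th1 : th <= 1 by rewrite /th -expR0 ler_expR oppr_le0.
have := @exprn_tangent_le (1 - q) (1 - q * th) (inner l + inner r).+1.
have -> : 0 <= 1 - q <= 1 - q * th.
  by rewrite subr_ge0 q1 lerD2l lerN2 ler_piMr// ltW.
move=> /(_ isT); rewrite [_.+1.-1]/= (exprS (1 - q)) (exprD (1 - q)) => tangent.
have w0 := hook_ge0 (R := R) (Node l r).
have hE := hook_Node (R := R) l r.
have iE : inner (Node l r) = (inner l + inner r).+1 by [].
rewrite iE in hE *; set h := hook (Node l r) in w0 hE *.
set A := (1 - q) ^+ inner l in tangent *; set B := (1 - q) ^+ inner r in tangent *.
have -> : q * A * hook l * (q * B * hook r) =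
    q ^+ 2 * A * B * ((inner l + inner r).+1%:R * h) by rewrite hE; ring.
have qth : 0 <= q * th * h by apply: mulr_ge0 => //; apply: mulr_ge0; exact: ltW.
move: tangent; rewrite -subr_ge0 => /(mulr_ge0 qth) h1.
rewrite -subr_ge0; apply: (le_trans h1); rewrite le_eqVlt; apply/orP; left.
by apply/eqP; ring.
Qed.

End tree_weight_growth.

Section growth.
Local Open Scope ereal_scope.
Context {R : realType} {dLR} {TLR : measurableType dLR} (PLR : probability TLR R).
Context (LR0 : {RV PLR >-> (R * R)%type}).
Context (mu : probability R R) (F : R -> probability R R).
Hypothesis FE : forall t, (0 <= t)%R ->
  is_mixture (F t) (tree_weight t) (real_law LR0 mu).

Lemma esum_Node (a : tree -> tree -> \bar R) : (forall l r, 0 <= a l r) ->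
  \esum_(l in setT) \esum_(r in setT) a l r =
  \esum_(u in setT) (if u is Node l r then a l r else 0).
Proof.
move=> a0; rewrite (esum_esum (J := fun=> setT))//.
rewrite [RHS](esumID [set Leaf]); last by move=> [|l r].
rewrite setTI esum_set1// add0e setTI.
apply/esym; rewrite (reindex_esum (setT `*`` fun=> setT) _ (fun p => Node p.1 p.2))//.
split=> //=; first by move=> [l r] [l' r'] /= _ _ [-> ->].
by move=> [|l r] //= _; exists (l, r).
Qed.

(** The law of V at time t + s dominates a combination of its law at time t and of the smoothing of
    two independent copies.  As all three have mass 1, the defect (1 - exp (- s)) ^ 2 is of second
    order, which is why an inequality suffices to identify the limit. *)
Lemma law_growth t s A : (0 <= t)%R -> (0 <= s)%R -> measurable A ->
  (expR (- s))%:E * F t A +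
  (expR (- s) * (1 - expR (- s)))%:E * node_law PLR (smooth LR0) (F t) (F t) A
  <= F (t + s)%R A.
Proof.
move=> t0 s0 mA; have ts0 : (0 <= t + s)%R by exact: addr_ge0.
have w0 t' u : (0 <= t')%R -> 0 <= (tree_weight t' u)%:E :> \bar R.
  by move=> t'0; rewrite lee_fin tree_weight_ge0.
rewrite (node_law_is_mixture _ _ (fun u => tree_weight_ge0 u t0) (FE t0))// !FE//.
rewrite esum_Node; last first.
  by move=> l r; rewrite mule_ge0// lee_fin mulr_ge0 ?tree_weight_ge0.
have es0 : (0 <= expR (- s))%R by exact: expR_ge0.
have es1 : (0 <= expR (- s) * (1 - expR (- s)))%R.
  by rewrite mulr_ge0// subr_ge0 -expR0 ler_expR oppr_le0.
rewrite -!esumZl//; last 2 first.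
- move=> [|l r] //; rewrite mule_ge0// lee_fin mulr_ge0 ?tree_weight_ge0//.
- by move=> u; rewrite mule_ge0 ?w0.
rewrite -esumD; last 2 first.
- by move=> u _; rewrite mule_ge0 ?lee_fin// mule_ge0 ?w0.
- move=> [|l r] _; rewrite mule_ge0 ?lee_fin// mule_ge0// lee_fin.
  by rewrite mulr_ge0 ?tree_weight_ge0.
apply: le_esum => -[|l r] _.
  by rewrite mule0 adde0 muleA -EFinM tree_weight_growth_Leaf.
rewrite -[node_law _ _ _ _ A]/(real_law LR0 mu (Node l r) A).
have a0 : 0 <= (expR (- s) * tree_weight t (Node l r))%:E.
  by rewrite lee_fin; apply: mulr_ge0 => //; exact: tree_weight_ge0.
have b0 : 0 <= (expR (- s) * (1 - expR (- s)) *
    (tree_weight t l * tree_weight t r))%:E.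
  by rewrite lee_fin; apply: mulr_ge0 => //; apply: mulr_ge0;
    exact: tree_weight_ge0.
rewrite !muleA -!EFinM -ge0_muleDl//.
by rewrite lee_wpmul2r// -EFinD lee_fin tree_weight_growth_Node.
Qed.

End growth.

(** * Lower limits of measures on open sets *)

Section liminf.
Local Open Scope ereal_scope.
Context {R : realType}.
Implicit Types u v : (\bar R)^nat.

Lemma le_limn_einf u v : (forall n, u n <= v n) -> limn_einf u <= limn_einf v.
Proof.
move=> uv; rewrite !limn_einf_lim; apply: lee_lim; [exact: is_cvg_einfs..|].
apply: nearW => n; apply: le_ereal_inf_tmp => _ [k nk <-].
apply: le_trans (uv k); apply: ereal_inf_lbound; by exists k.
Qed.

Lemma limn_einf_ge u v l : (forall n, u n <= v n) -> u @ \oo --> l ->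
  l <= limn_einf v.
Proof. by move=> uv /cvg_limn_einf_sup[<- _]; exact: le_limn_einf. Qed.

Lemma limn_einf_le u v l : (forall n, u n <= v n) -> v @ \oo --> l ->
  limn_einf u <= l.
Proof. by move=> uv /cvg_limn_einf_sup[<- _]; exact: le_limn_einf. Qed.

Lemma measurable_fun_limn_einf d (T : measurableType d) (f : (T -> \bar R)^nat) :
  (forall n, measurable_fun setT (f n)) ->
  measurable_fun setT (fun x => limn_einf (f ^~ x)).
Proof.
move=> mf; rewrite /limn_einf; apply: measurableT_comp => //.
apply: (@measurable_fun_limn_esup _ _ _ _ (fun n x => - f n x)) => n.
exact: measurableT_comp.
Qed.

Context {d} {T : measurableType d} (m_ : nat -> probability T R) (m : probability T R).
Context (G : set (set T)).
Hypothesis Gm : G `<=` measurable.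
Hypothesis GI : setI_closed G.
Hypothesis m_cvg : forall A, G A -> m_ n A @[n --> \oo] --> m A.

(** Inclusion and exclusion, one set at a time. *)
Lemma cvg_mu_bigsetU (r : seq nat) (A : nat -> set T) : (forall k, G (A k)) ->
  m_ n (\big[setU/set0]_(k <- r) A k) @[n --> \oo] -->
  m (\big[setU/set0]_(k <- r) A k).
Proof.
elim: r A => [|j r IH] A GA.
  rewrite big_nil measure0; apply: cvg_near_cst; apply: nearW => n.
  by rewrite measure0.
have mA k : measurable (A k) by exact: Gm.
have mU : measurable (\big[setU/set0]_(k <- r) A k) by exact: bigsetU_measurable.
have UE (p : probability T R) : p (\big[setU/set0]_(k <- j :: r) A k) =
    p (A j) + p (\big[setU/set0]_(k <- r) A k) -
    p (\big[setU/set0]_(k <- r) (A j `&` A k)).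
  rewrite big_cons measureUfinl//; last by rewrite ltey_eq fin_num_measure.
  by rewrite big_distrr.
rewrite UE; under eq_cvg do rewrite UE.
apply: cvgeB.
- apply: fin_num_adde_defl; rewrite fin_numN fin_num_measure//.
  by apply: bigsetU_measurable => k _; exact: measurableI.
- apply: cvgeD; [|exact: m_cvg|exact: IH].
  by rewrite fin_num_adde_defr// fin_num_measure.
- by apply: IH => k; exact: GI.
Qed.

Lemma bigcup_le_limn_einf (A : nat -> set T) : (forall k, G (A k)) ->
  m (\bigcup_k A k) <= limn_einf (fun n => m_ n (\bigcup_k A k)).
Proof.
move=> GA; pose U N := \big[setU/set0]_(k < N.+1) A k.
have mA k : measurable (A k) by exact: Gm.
have mU N : measurable (U N) by exact: bigsetU_measurable.
have mC : measurable (\bigcup_k A k) by exact: bigcup_measurable.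
have UC : \bigcup_N U N = \bigcup_k A k by exact: bigcup_bigsetU_bigcup.
have cvgU : m \o U @ \oo --> m (\bigcup_k A k).
  rewrite -UC; apply: nondecreasing_cvg_mu => //; first by rewrite UC.
  by move=> i j ij; apply/subsetPset; exact: subset_bigsetU.
rewrite -(cvg_lim _ cvgU)//; apply: lime_le; first by apply/cvg_ex; eexists; exact: cvgU.
apply: nearW => N; apply: (@limn_einf_ge (fun n => m_ n (U N))).
  move=> n; apply: le_measure; rewrite ?inE//.
  by rewrite -UC; exact: bigcup_sup.
rewrite -[(m \o U) N]/(m (U N)).
have -> : U N = \big[setU/set0]_(k <- index_iota 0 N.+1) A k by rewrite /U big_mkord.
exact: cvg_mu_bigsetU.
Qed.

End liminf.

(** * Points without mass *)

Section identity_variable.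
Context {R : realType}.

Definition id_rv (x : R) : R := x.

Let measurable_id_rv : measurable_fun setT id_rv. Proof. exact: measurable_id. Qed.

HB.instance Definition _ := isMeasurableFun.Build _ _ _ _ id_rv measurable_id_rv.

(** Right continuity of the distribution function. *)
Lemma cvg_cdf_above (p : probability R R) (x_ : nat -> R) (r : R) :
  (forall n, r < x_ n) -> x_ @ \oo --> r ->
  (p `]-oo, x_ n]%classic @[n --> \oo] --> p `]-oo, r]%classic)%E.
Proof.
move=> x_gt x_cvg; pose Z : {RV p >-> R} := id_rv.
have E : p `]-oo, r]%classic = (fine (p `]-oo, r]%classic))%:E.
  by rewrite fineK// fin_num_measure.
have right_cont : cdf Z y @[y --> r^'+] --> (fine (p `]-oo, r]%classic))%:E.
  by rewrite -E; exact: cdf_right_continuous.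
by rewrite E; move: right_cont => /cvge_at_rightP/(_ x_); apply; split.
Qed.

End identity_variable.

Section continuity_points.
Local Open Scope ereal_scope.
Context {R : realType} (m : probability R R).

Definition no_atom : set R := [set x | m [set x] = 0].

(** A law has at most countably many atoms, and an interval is uncountable. *)
Lemma no_atom_dense (x y : R) : (x < y)%R -> exists z, no_atom z /\ (x < z < y)%R.
Proof.
move=> xy; apply: contrapT => noz.
pose X : {RV m >-> R} := id_rv.
have cnt : countable `]x, y[%classic.
  apply: sub_countable (pmf_gt0_countable X); apply: subset_card_le => z /=.
  rewrite in_itv/= => zxy; rewrite lt0r pmf_ge0 andbT; apply/negP => /eqP pz.
  apply: noz; exists z; split => //; rewrite /no_atom /=.
  have : m [set z] = (pmf X z)%:E by rewrite /pmf fineK// fin_num_measure.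
  by rewrite pz.
have := countable_lebesgue_measure0 cnt; rewrite lebesgue_measure_itv/= lte_fin xy.
by rewrite -EFinB => -[] /eqP; rewrite subr_eq0 gt_eqF.
Qed.

(** Countably many points without mass that are dense in the line, indexed by the rational intervals. *)
Definition pick_no_atom (q : rat * rat) : R :=
  xget 0%R [set z | no_atom z /\ (ratr q.1 < z < ratr q.2)%R].

Lemma pick_no_atomP q : (ratr q.1 < ratr q.2 :> R)%R ->
  no_atom (pick_no_atom q) /\ (ratr q.1 < pick_no_atom q < ratr q.2)%R.
Proof.
move=> q12; have [z zP] := no_atom_dense q12.
by rewrite /pick_no_atom; case: xgetP => [w _ []//|/(_ z)].
Qed.

Lemma pick_no_atom_between (x y : R) : (x < y)%R ->
  exists q, (ratr q.1 < ratr q.2 :> R)%R /\ (x < pick_no_atom q < y)%R.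
Proof.
move=> xy; have [q1] := rat_in_itvoo xy; rewrite in_itv/= => /andP[xq1 q1y].
have [q2] := rat_in_itvoo q1y; rewrite in_itv/= => /andP[q12 q2y].
exists (q1, q2); split => //.
have [_ /andP[]] := pick_no_atomP (q := (q1, q2)) q12.
by move=> /(lt_trans xq1) -> /lt_trans/(_ q2y) ->.
Qed.

End continuity_points.

(** * Convergence at the points without mass *)

Section weak_limits.
Local Open Scope ereal_scope.
Context {R : realType}.

Lemma itv_oc_measure (p : probability R R) (a b : R) : (a <= b)%R ->
  p `]a, b]%classic = p `]-oo, b]%classic - p `]-oo, a]%classic.
Proof.
move=> ab; have -> : `]a, b]%classic = `]-oo, b] `\` `]-oo, a] :> set R.
  by rewrite -[RHS]setCK setCD setCitvl setUC -[LHS]setCK setCitv.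
rewrite measureD ?setIidr//; first exact: subset_itvl.
by rewrite ltey_eq fin_num_measure.
Qed.

Lemma cvg_itv_no_atom (p : probability R R) (x : R) : no_atom p x ->
  p `](x - k.+1%:R^-1)%R, x]%classic @[k --> \oo] --> 0.
Proof.
move=> px; have -> : 0 = p (\bigcap_k `](x - k.+1%:R^-1)%R, x]%classic).
  rewrite -px; congr (p _); apply/seteqP; split=> [_ -> k _ /=|y yI].
    by rewrite in_itv/= lexx andbT ltrBlDr ltrDl invr_gt0.
  have [yx|xy] := ltP y x; last first.
    by have := yI 0%N Logic.I; rewrite /= in_itv/= => /andP[_ yx];
      apply/eqP; rewrite eq_le yx xy.
  have /ltr_add_invr[k] : (y < x)%R by [].
  have := yI k Logic.I; rewrite /= in_itv/= ltrBlDr => /andP[/lt_trans h _] /h.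
  by rewrite ltxx.
apply: nonincreasing_cvg_mu => //.
- by rewrite ltey_eq fin_num_measure.
- by apply: bigcap_measurable => // k _.
move=> k l kl; apply/subsetPset => y; rewrite /= !in_itv/= => /andP[xy ->].
rewrite andbT (le_lt_trans _ xy)// lerB// lef_pV2 ?posrE//.
by rewrite ler_nat.
Qed.

Lemma continuous_cdf_no_atom d (T : measurableType d) (P : probability T R)
    (X : {RV P >-> R}) (x : R) : no_atom (distribution P X) x ->
  {for x, continuous (cdf X)}.
Proof.
move=> x0; apply/left_right_continuousP; split; last exact: cdf_right_continuous.
pose p : probability R R := distribution P X.
have cdfE y : cdf X y = (fine (cdf X y))%:E by rewrite fineK// fin_num_measure.
have := cvg_itv_no_atom x0 => /fine_cvgP[_] /cvgrPdist_lt small.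
rewrite [X in _ --> X]cdfE; apply/fine_cvgP; split.
  by apply: nearW => y; rewrite cdfE.
apply/cvgrPdist_le => e e0.
have [N _ /(_ N (leqnn _))] := small e e0; rewrite /= sub0r normrN => pN.
near=> y.
have yx : (y < x)%R by near: y; exact: nbhs_left_lt.
have yN : (x - N.+1%:R^-1 < y)%R.
  by near: y; apply: nbhs_left_gt; rewrite ltrBlDr ltrDl invr_gt0.
rewrite -[fine (cdf X x)]/(fine (p `]-oo, x]%classic)).
rewrite -[fine (cdf X y)]/(fine (p `]-oo, y]%classic)).
rewrite -fineB ?fin_num_measure// -itv_oc_measure ?(ltW yx)//.
rewrite ger0_norm ?fine_ge0//; apply: (le_trans _ (ltW pN)).
rewrite ger0_norm ?fine_ge0// fine_le ?fin_num_measure//.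
apply: le_measure; rewrite ?inE// => z; rewrite /= !in_itv/= => /andP[yz ->].
by rewrite (lt_trans yN yz).
Unshelve. all: by end_near. Qed.

Context (F_ : nat -> probability R R) (F : probability R R).
Hypothesis F_cvg : forall x, no_atom F x ->
  F_ n `]-oo, x]%classic @[n --> \oo] --> F `]-oo, x]%classic.

Lemma cvg_itv_oc a b : no_atom F a -> no_atom F b ->
  F_ n `]a, b]%classic @[n --> \oo] --> F `]a, b]%classic.
Proof.
move=> Fa Fb; have [ab|ba] := leP a b; last first.
  rewrite set_itv_ge ?bnd_simp -?leNgt ?ltW// measure0.
  by apply: cvg_near_cst; apply: nearW => n; rewrite measure0.
rewrite itv_oc_measure//; under eq_cvg do rewrite itv_oc_measure//.
apply: cvgeB; [|exact: F_cvg..].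
by apply: fin_num_adde_defl; rewrite fin_numN fin_num_measure.
Qed.

Definition no_atom_box : set (set (R * R)) :=
  [set A | exists a b c d, [/\ no_atom F a, no_atom F b, no_atom F c, no_atom F d &
     A = `]a, b]%classic `*` `]c, d]%classic]].

Lemma no_atom_box_measurable : no_atom_box `<=` measurable.
Proof. by move=> _ [a [b [c [d [_ _ _ _ ->]]]]]; exact: measurableX. Qed.

Lemma no_atom_boxI : setI_closed no_atom_box.
Proof.
move=> _ _ [a [b [c [d [Ca Cb Cc Cd ->]]]]] [a' [b' [c' [d' [Ca' Cb' Cc' Cd' ->]]]]].
exists (Num.max a a'), (Num.min b b'), (Num.max c c'), (Num.min d d'); split.
- by rewrite /Num.max; case: ifP.
- by rewrite /Num.min; case: ifP.
- by rewrite /Num.max; case: ifP.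
- by rewrite /Num.min; case: ifP.
apply/seteqP; split=> -[x y]/=; rewrite !in_itv/= !gt_max !le_min.
  by move=> [[/andP[-> ->] /andP[-> ->]] [/andP[-> ->] /andP[-> ->]]].
by move=> [/andP[/andP[-> ->] /andP[-> ->]] /andP[/andP[-> ->] /andP[-> ->]]].
Qed.

Lemma no_atom_box_cvg A : no_atom_box A ->
  (F_ n \x F_ n) A @[n --> \oo] --> (F \x F) A.
Proof.
move=> [a [b [c [d [Ca Cb Cc Cd ->]]]]].
rewrite product_measure1E//.
under eq_cvg do rewrite product_measure1E//.
apply: cvgeM; [|exact: cvg_itv_oc..].
by rewrite mule_def_fin ?fin_num_measure.
Qed.

(** An open subset of the plane is a countable union of boxes whose vertices have coordinates without
    mass, and these boxes form a class stable under intersection on which the product laws converge. *)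
Lemma open_le_limn_einf (C : set (R * R)) :
  (forall p, C p -> exists e : R, (0 < e)%R /\ forall p', (`|p'.1 - p.1| <= e)%R ->
     (`|p'.2 - p.2| <= e)%R -> C p') ->
  (F \x F) C <= limn_einf (fun n => (F_ n \x F_ n) C).
Proof.
move=> oC.
pose cpt (q : rat * rat) : R :=
  pick_no_atom F (if (ratr q.1 < ratr q.2 :> R)%R then q else (0, 1)%R).
have cptP q : no_atom F (cpt q).
  rewrite /cpt; case: ifPn => [q12|_]; first exact: (pick_no_atomP F q12).1.
  by apply: (pick_no_atomP F _).1; rewrite /= ltr_rat ltr01.
pose box (q : ((rat * rat) * (rat * rat)) * ((rat * rat) * (rat * rat))) : set (R * R) :=
  `]cpt q.1.1, cpt q.1.2]%classic `*` `]cpt q.2.1, cpt q.2.2]%classic.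
pose q0 : ((rat * rat) * (rat * rat)) * ((rat * rat) * (rat * rat)) :=
  (((0, 0), (0, 0)), ((0, 0), (0, 0)))%R.
pose A k := let q := odflt q0 (unpickle k) in
  if pselect (box q `<=` C) then box q else box q0.
have box0 : box q0 = set0.
  by rewrite /box /= set_itv_ge ?bnd_simp ?ltxx// set0X.
have GA k : no_atom_box (A k).
  by rewrite /A; case: pselect => h /=; do 4 eexists; split; last reflexivity.
have -> : C = \bigcup_k A k.
  apply/seteqP; split=> [[u v] Cuv|p [k _]]; last first.
    by rewrite /A; case: pselect => [sub /sub//|h] /=; rewrite box0.
  have [e [e0 eC]] := oC _ Cuv.
  have near (x : R) : exists q1 q2, [/\ (x - e < cpt q1)%R, (cpt q1 < x)%R,
      (x < cpt q2)%R & (cpt q2 < x + e)%R].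
    have [|q1 [q1lt /andP[a1 a2]]] := @pick_no_atom_between _ F (x - e)%R x.
      by rewrite ltrBlDr ltrDl.
    have [|q2 [q2lt /andP[b1 b2]]] := @pick_no_atom_between _ F x (x + e)%R.
      by rewrite ltrDl.
    by exists q1, q2; rewrite /cpt q1lt q2lt.
  have [q1 [q2 [h1 h2 h3 h4]]] := near u.
  have [q3 [q4 [h5 h6 h7 h8]]] := near v.
  exists (pickle ((q1, q2), (q3, q4))) => //.
  rewrite /A pickleK /=; case: pselect => [h|[]] /=.
    by split; rewrite /= in_itv/= ?h2 ?h6 ?(ltW h3) ?(ltW h7).
  move=> [x y] [/= /[!in_itv]/= /andP[x1 x2] /andP[y1 y2]].
  by apply: eC => /=; rewrite ler_norml; apply/andP; split; lra.
pose FF n : probability (R * R)%type R := F_ n \x F_ n.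
exact: (@bigcup_le_limn_einf _ _ _ FF (F \x F) _ no_atom_box_measurable
  no_atom_boxI no_atom_box_cvg A GA).
Qed.

End weak_limits.

(** * The limit law is a fixed point of smoothing *)

Section fixed_point.
Local Open Scope ereal_scope.
Context {R : realType} {dLR} {TLR : measurableType dLR} (PLR : probability TLR R).
Context (LR0 : {RV PLR >-> (R * R)%type}).
Hypothesis LR0_ge0 : forall w, (0 <= (LR0 w).1)%R /\ (0 <= (LR0 w).2)%R.
Local Notation node := (node_law PLR (smooth LR0)).

Lemma measurable_smooth_section w (O : set R) : measurable O ->
  measurable [set p | O (smooth LR0 (w, p))].
Proof.
move=> mO; have mw : measurable_fun setT (fun p => smooth LR0 (w, p)).
  by apply: measurableT_comp => //; exact: measurable_pair1.
rewrite (_ : [set p | _] = (fun p => smooth LR0 (w, p)) @^-1` O)//.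
by rewrite -[X in measurable X]setTI; exact: mw.
Qed.

Lemma node_law_le_limn_einf (F_ : nat -> probability R R) (F : probability R R)
    (O : set R) : measurable O ->
  (forall x, O x -> exists e : R, (0 < e)%R /\ forall y, (`|y - x| <= e)%R -> O y) ->
  (forall x, no_atom F x ->
    F_ n `]-oo, x]%classic @[n --> \oo] --> F `]-oo, x]%classic) ->
  node F F O <= limn_einf (fun n => node (F_ n) (F_ n) O).
Proof.
move=> mO openO F_cvg.
have mg (m : probability R R) :
    measurable_fun setT (fun w => (m \x m) [set p | O (smooth LR0 (w, p))]).
  have -> : (fun w => (m \x m) [set p | O (smooth LR0 (w, p))]) =
      (m \x m) \o xsection (smooth LR0 @^-1` O).
    by apply/funext => w /=; congr (_ _); apply/seteqP; split=> x /=; rewrite xsectionP.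
  pose mm : probability (R * R)%type R := m \x m.
  apply: (measurable_fun_xsection mm); rewrite -[X in measurable X]setTI.
  exact: measurable_smooth.
rewrite node_lawE// (_ : (fun n => node _ _ _) = (fun n =>
  \int[PLR]_w (F_ n \x F_ n) [set p | O (smooth LR0 (w, p))])); last first.
  by apply/funext => n; exact: node_lawE.
apply: le_trans (fatou PLR measurableT
  (f := fun n w => (F_ n \x F_ n) [set p | O (smooth LR0 (w, p))]) _ _) => //.
apply: ge0_le_integral => //.
  by apply: measurable_fun_limn_einf => n; exact: mg.
move=> w _; apply: open_le_limn_einf => // -[u v] /= /openO[e [e0 eO]].
have [L0 R0] := LR0_ge0 w; set L := (LR0 w).1 in L0 *; set Rr := (LR0 w).2 in R0 *.
exists (e / (L + Rr + 1))%R.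
have LR1 : (0 < L + Rr + 1)%R by rewrite ltr_wpDl// addr_ge0.
split; first by rewrite divr_gt0.
move=> [u' v'] /= uu vv; apply: eO; rewrite /smooth /= -/L -/Rr.
have -> : (L * u' + Rr * v' - (L * u + Rr * v) = L * (u' - u) + Rr * (v' - v))%R by ring.
apply: (le_trans (ler_normD _ _)); rewrite !normrM (ger0_norm L0) (ger0_norm R0).
apply: (@le_trans _ _ ((L + Rr) * (e / (L + Rr + 1)))%R).
  by rewrite mulrDl lerD// ler_wpM2l.
by rewrite mulrCA -[leRHS]mulr1 ler_pM2l// ler_pdivrMr// mul1r lerDl.
Qed.

Context (mu : probability R R) (F : R -> probability R R) (Fi : probability R R).
Hypothesis FE : forall t, (0 <= t)%R ->
  is_mixture (F t) (tree_weight t) (real_law LR0 mu).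
Hypothesis F_cvg : forall x, no_atom Fi x ->
  F t `]-oo, x]%classic @[t --> +oo%R] --> Fi `]-oo, x]%classic.

Let cvg_shift (s : R) : (n%:R + s)%R @[n --> \oo] --> +oo%R.
Proof.
apply/cvgryPge => A; have := nbhs_infty_ger (A - s).
by apply: filterS => n; rewrite lerBlDr.
Qed.

Let cvg_seq (s x : R) : no_atom Fi x ->
  F (n%:R + s)%R `]-oo, x]%classic @[n --> \oo] --> Fi `]-oo, x]%classic.
Proof.
move=> Fx; apply: (cvg_comp (fun n => (n%:R + s)%R) (fun t => F t `]-oo, x]%classic)
  (cvg_shift s)); exact: F_cvg.
Qed.

(** The limit in t of the growth inequality, divided by 1 - exp (- s), when s then tends to 0.  The set
    [O] is open so that the smoothing of the limit law is bounded by the lower limit of the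
    smoothings, and [A] is slightly larger so that its probabilities converge. *)
Lemma node_law_le_limit (A O : set R) : measurable A -> measurable O -> O `<=` A ->
  (forall x, O x -> exists e : R, (0 < e)%R /\ forall y, (`|y - x| <= e)%R -> O y) ->
  (forall s : R, F (n%:R + s)%R A @[n --> \oo] --> Fi A) ->
  node Fi Fi O <= Fi A.
Proof.
move=> mA mO OA openO cvgA.
have bound s : (0 < s)%R ->
    node Fi Fi O <= ((expR (- s))^-1 * fine (Fi A))%:E.
  move=> s0; set th := expR (- s).
  have th0 : (0 < th)%R by exact: expR_gt0.
  have th1 : (0 < 1 - th)%R by rewrite subr_gt0 /th -expR0 ltr_expR oppr_lt0.
  have c0 : (0 < th * (1 - th))%R by rewrite mulr_gt0.
  pose v n := ((th * (1 - th))^-1 *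
    (fine (F (n%:R + s)%R A) - th * fine (F (n%:R + 0)%R A)))%R.
  apply: (le_trans (@node_law_le_limn_einf (fun n => F (n%:R + 0)%R) Fi O mO openO _)).
    by move=> x Fx; exact: cvg_seq.
  apply: (@limn_einf_le _ _ (EFin \o v)) => [n|].
    have n0 : (0 <= n%:R :> R)%R by [].
    have := law_growth FE n0 (ltW s0) mA; rewrite -/th.
    have -> : F n%:R A = (fine (F (n%:R + 0)%R A))%:E.
      by rewrite addr0 fineK// fin_num_measure.
    have -> : F (n%:R + s)%R A = (fine (F (n%:R + s)%R A))%:E.
      by rewrite fineK// fin_num_measure.
    have BE (E : set R) : measurable E -> node (F n%:R) (F n%:R) E =
        (fine (node (F n%:R) (F n%:R) E))%:E.
      by move=> mE; rewrite fineK// fin_num_measure.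
    have OleA : (fine (node (F n%:R) (F n%:R) O) <= fine (node (F n%:R) (F n%:R) A))%R.
      pose N : probability R R := node (F n%:R) (F n%:R).
      apply: fine_le; [exact: (fin_num_measure N)|exact: (fin_num_measure N)|].
      by apply: (le_measure N); rewrite ?inE.
    rewrite addr0 (BE _ mA) (BE _ mO) -!EFinM -EFinD !lee_fin => le1.
    rewrite /v /= addr0 ler_pdivlMl//.
    apply: (@le_trans _ _ (th * (1 - th) * fine (node (F n%:R) (F n%:R) A))%R).
      by rewrite ler_pM2l//; exact: OleA.
    by rewrite lerBrDl.
  apply: cvg_EFin; first exact: nearW.
  have -> : (th^-1 * fine (Fi A) = (th * (1 - th))^-1 *
      (fine (Fi A) - th * fine (Fi A)))%R.
    by field; rewrite !gt_eqF.
  have cvgA' s' : fine (F (n%:R + s')%R A) @[n --> \oo] --> fine (Fi A).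
    by apply: fine_cvg; rewrite fineK ?fin_num_measure//; exact: cvgA.
  by apply: cvgMr; apply: cvgB => //; apply: cvgMr.
have BE : node Fi Fi O = (fine (node Fi Fi O))%:E.
  by rewrite fineK// fin_num_measure.
have AE : Fi A = (fine (Fi A))%:E by rewrite fineK// fin_num_measure.
have B1 : (fine (node Fi Fi O) <= 1)%R.
  by rewrite -lee_fin -BE probability_le1.
have B0 : (0 <= fine (node Fi Fi O))%R by rewrite fine_ge0.
rewrite BE AE lee_fin leNgt; apply/negP => lt1.
set b := fine (node Fi Fi O) in B1 B0 BE lt1; set y := fine (Fi A) in lt1 bound.
(* If the limit inequality failed, s = (b - y) / 2 would contradict [bound], as exp (- s) >= 1 - s. *)
have s0 : (0 < (b - y) / 2)%R by rewrite divr_gt0// subr_gt0.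
have := bound _ s0; rewrite BE lee_fin ler_pdivlMl ?expR_gt0//.
have := expR_ge1Dx (- ((b - y) / 2)).
set E := expR _ => E1 E2.
have : ((1 - (b - y) / 2) * b <= y)%R.
  by apply: le_trans E2; rewrite ler_wpM2r.
nra.
Qed.

Let ray_cvg (s x : R) : no_atom Fi x ->
  F (n%:R + s)%R `]x, +oo[%classic @[n --> \oo] --> Fi `]x, +oo[%classic.
Proof.
move=> Fx; have rayE (p : probability R R) :
    p `]x, +oo[%classic = 1 - p `]-oo, x]%classic.
  by rewrite -setCitvl probability_setC.
rewrite rayE; under eq_cvg do rewrite rayE.
apply: cvgeB; [|exact: cvg_cst|exact: cvg_seq].
by apply: fin_num_adde_defl; rewrite fin_numN fin_num_measure.
Qed.

(** The inequality holds for both half-lines bounded by a point without mass, hence is an equality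
    between distribution functions. *)
Theorem limit_law_fixed A : measurable A -> node Fi Fi A = Fi A.
Proof.
apply: eq_cdf_law => r.
pose N : probability R R := node Fi Fi.
have lower x : no_atom Fi x -> N `]-oo, x[%classic <= Fi `]-oo, x]%classic.
  move=> Fx; apply: node_law_le_limit => //.
  - by apply: subset_itvl; rewrite bnd_simp.
  - move=> y; rewrite /= in_itv/= => yx; exists ((x - y) / 2)%R; split.
      by rewrite divr_gt0// subr_gt0.
    by move=> z; rewrite ler_norml in_itv/= => /andP[_]; lra.
  - by move=> s; exact: cvg_seq.
have upper x : no_atom Fi x -> N `]x, +oo[%classic <= Fi `]x, +oo[%classic.
  move=> Fx; apply: node_law_le_limit => //.
  - move=> y; rewrite /= in_itv/= andbT => xy; exists ((y - x) / 2)%R; split.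
      by rewrite divr_gt0// subr_gt0.
    by move=> z; rewrite ler_norml in_itv/= andbT => /andP[+ _]; lra.
  - by move=> s; exact: ray_cvg.
have rayC (p : probability R R) x : p `]x, +oo[%classic = 1 - p `]-oo, x]%classic.
  by rewrite -setCitvl probability_setC.
have upper' x : no_atom Fi x -> Fi `]-oo, x]%classic <= N `]-oo, x]%classic.
  move=> /upper; rewrite !rayC.
  have -> : N `]-oo, x]%classic = (fine (N `]-oo, x]%classic))%:E.
    by rewrite fineK// fin_num_measure.
  have -> : Fi `]-oo, x]%classic = (fine (Fi `]-oo, x]%classic))%:E.
    by rewrite fineK// fin_num_measure.
  by rewrite -!EFinB !lee_fin lerD2l lerN2.
have [x_ [x_gt x_cvg]] : exists x_ : nat -> R,
    (forall n, no_atom Fi (x_ n) /\ (r < x_ n)%R) /\ x_ @ \oo --> r.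
  have pick n : {z : R | no_atom Fi z /\ (r < z < r + n.+1%:R^-1)%R}.
    by apply/cid/no_atom_dense; rewrite ltrDl invr_gt0.
  exists (fun n => sval (pick n)); split.
    by move=> n; case: (pick n) => z /= [? /andP[]].
  apply: (@squeeze_cvgr _ _ _ _ (fun=> r) (fun n => r + n.+1%:R^-1)%R).
  - apply: nearW => n; case: (pick n) => z /= [_ /andP[/ltW -> /ltW ->]] //.
  - exact: cvg_cst.
  - rewrite -[X in _ --> X]addr0; apply: cvgD; first exact: cvg_cst.
    exact: cvg_harmonic.
have x_gt' n : (r < x_ n)%R by case: (x_gt n).
apply/eqP; rewrite eq_le; apply/andP; split.
  have Fi_cvg := cvg_cdf_above (p := Fi) x_gt' x_cvg.
  rewrite -(cvg_lim _ Fi_cvg)//; apply: lime_ge; first by apply/cvg_ex; eexists; exact: Fi_cvg.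
  apply: nearW => n; apply: le_trans (lower _ (x_gt n).1).
  apply: (le_measure N); rewrite ?inE//.
  by apply: subset_itvl; rewrite bnd_simp.
have N_cvg := cvg_cdf_above (p := N) x_gt' x_cvg.
rewrite -(cvg_lim _ N_cvg)//; apply: lime_ge; first by apply/cvg_ex; eexists; exact: N_cvg.
apply: nearW => n; apply: le_trans (upper' _ (x_gt n).1).
apply: (le_measure Fi); rewrite ?inE//.
by apply: subset_itvl; rewrite bnd_simp ltW.
Qed.

Lemma tree_limit_law_fixed u A : measurable A -> real_law LR0 Fi u A = Fi A.
Proof.
elim: u A => [//|l IHl r IHr] A mA; rewrite -limit_law_fixed//.
rewrite [LHS](node_lawE _ _ (real_law LR0 Fi l) (real_law LR0 Fi r))// node_lawE//.
apply: eq_integral => w _.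
apply: (@product_measure_unique _ _ _ _ _ (real_law LR0 Fi l) (real_law LR0 Fi r)
  (Fi \x Fi)); last exact: measurable_smooth_section.
move=> C D mC mD; transitivity (Fi C * Fi D); first exact: product_measure1E.
by congr (_ * _); [exact/esym/IHl|exact/esym/IHr].
Qed.

End fixed_point.

(** * Smoothing a coupling along the random tree *)

Section coupled_flow.
Local Open Scope ereal_scope.
Context {R : realType}.

Lemma esum_tree_weight (t : R) : (0 <= t)%R ->
  \esum_(u in [set: tree]) (tree_weight t u)%:E = 1.
Proof.
move=> t0; have z0 : (0 <= 1 - expR (- t) :> R)%R.
  by rewrite subr_ge0 -expR0 ler_expR oppr_le0.
have c0 n : (0 <= expR (- t) * (1 - expR (- t)) ^+ n :> R)%R.
  by rewrite mulr_ge0 ?expR_ge0 ?exprn_ge0.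
transitivity (\sum_(n <oo) (expR (- t) * (1 - expR (- t)) ^+ n * tree_mean n (fun=> 1%R))%:E).
  by rewrite tree_mean_series//; apply: eq_esum => u _; rewrite mulr1.
have := @cvg_geometric_series R (expR (- t)) (1 - expR (- t)).
rewrite ger0_norm// subKr divff ?gt_eqF ?expR_gt0// gtrBl expR_gt0 => /(_ isT) geo.
apply: cvg_lim => //; apply: cvg_EFin.
  by apply: nearW => N; rewrite sumEFin.
apply: cvg_trans geo; apply: near_eq_cvg; apply: nearW => N /=.
rewrite sumEFin /series/=; apply: eq_bigr => n _; rewrite tree_mean_cst mulr1//.
Qed.

Context {dLR} {TLR : measurableType dLR} (PLR : probability TLR R).
Context (LR0 : {RV PLR >-> (R * R)%type}) (mu : probability (R * R * R)%type R).

Let flow_set (t : R) (t0 : (0 <= t)%R) : set (R * R * R) -> \bar R :=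
  mixture (fun u => tree_weight_ge0 u t0) (triple_law LR0 mu).

Let flow_setT t t0 : @flow_set t t0 setT = 1.
Proof.
rewrite /flow_set mixtureP// -[RHS](esum_tree_weight t0).
by apply: eq_esum => u _; rewrite probability_setT mule1.
Qed.

HB.instance Definition _ t t0 := Measure.copy (@flow_set t t0)
  (mixture (fun u => tree_weight_ge0 u t0) (triple_law LR0 mu)).

HB.instance Definition _ t t0 :=
  Measure_isProbability.Build _ _ _ (@flow_set t t0) (flow_setT t0).

(** The law at time t of the smoothing of triples of law [mu] along the random tree. *)
Definition flow t t0 : probability (R * R * R)%type R := @flow_set t t0.

Context (t : R) (t0 : (0 <= t)%R).

Section image.
Context (phi : R * R * R -> R).
Hypothesis mphi : measurable_fun setT phi.
Hypothesis phi_smooth : forall w x y,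
  phi (smooth3 LR0 (w, (x, y))) = smooth LR0 (w, (phi x, phi y)).
Context (mu' : probability R R).
Hypothesis mu'E : forall A, measurable A -> mu' A = mu (phi @^-1` A).

Lemma flow_image A : measurable A -> flow t0 (phi @^-1` A) =
  \esum_(u in [set: tree]) ((tree_weight t u)%:E * real_law LR0 mu' u A).
Proof.
move=> mA; rewrite /flow /flow_set mixtureP; last by rewrite -[_ @^-1` _]setTI; exact: mphi.
by apply: eq_esum => u _; congr (_ * _); exact/esym/(tree_law_morph PLR mphi phi_smooth mu'E).
Qed.

Lemma ge0_integral_flow_image (f : R -> \bar R) :
  measurable_fun setT f -> (forall x, 0 <= f x) ->
  \int[flow t0]_p f (phi p) =
  \esum_(u in [set: tree]) ((tree_weight t u)%:E * \int[real_law LR0 mu' u]_x f x).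
Proof.
move=> mf f0.
have f0' : {in [set: R], forall x, 0 <= f x} by move=> x _; exact: f0.
have := ge0_integral_pushforward mphi (flow t0) measurableT mf f0'.
rewrite preimage_setT => <-.
apply: (ge0_integral_is_mixture (fun u => tree_weight_ge0 u t0)) => // A mA.
exact: flow_image.
Qed.

End image.
End coupled_flow.

Section fixed_base.
Local Open Scope ereal_scope.
Context {R : realType} {dLR} {TLR : measurableType dLR} (PLR : probability TLR R).
Context (LR0 : {RV PLR >-> (R * R)%type}).

Lemma eq_real_law (m m' : probability R R) : (forall A, measurable A -> m A = m' A) ->
  forall u A, measurable A -> real_law LR0 m u A = real_law LR0 m' u A.
Proof. by move=> mm' u A mA; rewrite (tree_law_morph PLR (c := smooth LR0) (c' := smooth LR0) (phi := id) (mu := m')) //. Qed.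

End fixed_base.

(** * Contraction of a coupling *)

Section contraction.
Local Open Scope ereal_scope.
Context {R : realType} {dLR} {TLR : measurableType dLR} (PLR : probability TLR R).
Context (LR0 : {RV PLR >-> (R * R)%type}) (mu : probability (R * R * R)%type R).

Definition first3 (p : R * R * R) : R := p.1.1.
Definition second3 (p : R * R * R) : R := p.1.2.

Lemma measurable_first3 : measurable_fun setT first3.
Proof. exact: measurableT_comp. Qed.

Lemma measurable_second3 : measurable_fun setT second3.
Proof. exact: measurableT_comp. Qed.

HB.instance Definition _ := isMeasurableFun.Build _ _ _ _ first3 measurable_first3.
HB.instance Definition _ := isMeasurableFun.Build _ _ _ _ second3 measurable_second3.

(** The smoothing multiplies a mean [delta] of x - y at the leaves by the total weight of the leaves,
    which is the third coordinate of the smoothed triple; the difference is again centered. *)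
Definition gap (delta : R) (p : R * R * R) : R := (p.1.1 - p.1.2 - delta * p.2)%R.

Lemma measurable_gap delta : measurable_fun setT (gap delta).
Proof.
apply: measurable_funB; last exact: measurable_funM.
by apply: measurable_funB; exact: measurableT_comp.
Qed.

HB.instance Definition _ delta :=
  isMeasurableFun.Build _ _ _ _ (gap delta) (measurable_gap delta).

Lemma gap_smooth delta w x y :
  gap delta (smooth3 LR0 (w, (x, y))) = smooth LR0 (w, (gap delta x, gap delta y)).
Proof. by rewrite /gap /smooth3 /smooth /=; ring. Qed.

Hypothesis LR0_ge0 : forall w, (0 <= (LR0 w).1)%R /\ (0 <= (LR0 w).2)%R.
Context (g : R) (g_gt0 : (0 < g)%R).
Context (aL aR : R).
Hypothesis aLE : \int[PLR]_w ((LR0 w).1 `^ g)%:E = aL%:E.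
Hypothesis aRE : \int[PLR]_w ((LR0 w).2 `^ g)%:E = aR%:E.

(** A linear form of the triple is smoothed like a single real variable, so that the bound along one
    tree can be averaged over the trees. *)
Lemma flow_gap_moment (delta K t : R) (t0 : (0 <= t)%R) : (0 <= K)%R ->
  (forall a, abs_moment g (distribution mu (gap delta)) a <= (`|a| `^ g + K)%:E) ->
  \int[flow LR0 mu t0]_p (`|gap delta p| `^ g)%:E <=
    (K * expR (- ((1 - (aL + aR)) * t)))%:E.
Proof.
move=> K0 gapK; set lam : probability R R := distribution mu (gap delta) in gapK *.
have aL0 : (0 <= aL)%R.
  by rewrite -lee_fin -aLE; apply: integral_ge0 => w _; rewrite lee_fin powR_ge0.
have aR0 : (0 <= aR)%R.
  by rewrite -lee_fin -aRE; apply: integral_ge0 => w _; rewrite lee_fin powR_ge0.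
have mf : measurable_fun setT (fun z : R => (`|z| `^ g)%:E).
  exact: measurable_norm_powR.
have f0 (z : R) : 0 <= (`|z| `^ g)%:E by rewrite lee_fin powR_ge0.
have lamE A : measurable A -> lam A = mu (gap delta @^-1` A) by [].
have -> := ge0_integral_flow_image t0 (measurable_gap delta) (gap_smooth delta) lamE mf f0.
apply: (@le_trans _ _ (\esum_(u in [set: tree])
    (K%:E * (tree_weight t u * cost aL aR u)%:E))); last first.
  rewrite esumZl//; last first.
    by move=> u; rewrite lee_fin mulr_ge0 ?tree_weight_ge0 ?cost_ge0.
  by rewrite EFinM; apply: lee_wpmul2l; rewrite ?lee_fin//; exact: tree_cost_series.
apply: le_esum => u _; have -> : K%:E * (tree_weight t u * cost aL aR u)%:E =
    (tree_weight t u)%:E * (K * cost aL aR u)%:E by rewrite -[LHS]EFinM mulrCA.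
apply: lee_wpmul2l.
  by rewrite lee_fin tree_weight_ge0.
have := tree_abs_moment LR0_ge0 g_gt0 aLE aRE K0 gapK u 0.
rewrite normr0 powR0 ?gt_eqF// add0r; apply: le_trans.
by rewrite le_eqVlt; apply/orP; left; apply/eqP; apply: eq_integral => z _; rewrite add0r.
Qed.

Context (mu1 mu2 : probability R R).
Hypothesis mu1E : forall A, measurable A -> mu1 A = mu (first3 @^-1` A).
Hypothesis mu2E : forall A, measurable A -> mu2 A = mu (second3 @^-1` A).

Lemma flow_fst t (t0 : (0 <= t)%R) (F : probability R R) :
  is_mixture F (tree_weight t) (real_law LR0 mu1) -> forall A, measurable A ->
  flow LR0 mu t0 (first3 @^-1` A) = F A.
Proof.
move=> FE A mA; rewrite FE//.
by apply: (flow_image t0 (phi := first3)) => //; exact: measurable_first3.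
Qed.

Lemma flow_snd t (t0 : (0 <= t)%R) :
  (forall u A, measurable A -> real_law LR0 mu2 u A = mu2 A) ->
  forall A, measurable A -> flow LR0 mu t0 (second3 @^-1` A) = mu2 A.
Proof.
move=> mu2_fixed A mA.
have -> := flow_image t0 measurable_second3 (fun w x y => erefl) mu2E mA.
under eq_esum do rewrite mu2_fixed// muleC.
have -> : mu2 A = (fine (mu2 A))%:E by rewrite fineK// fin_num_measure.
rewrite esumZl ?esum_tree_weight ?mule1//.
by rewrite fine_ge0.
by move=> u; rewrite lee_fin tree_weight_ge0.
Qed.

End contraction.

(** * Asymptotically ordered variables with the same limit *)

Section asymptotic_order.
Local Open Scope ereal_scope.
Context {R : realType} d (S : measurableType d) (Q : nat -> probability S R).

Definition asymptotically_null (A : set S) :=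
  forall e : R, (0 < e)%R -> \forall n \near \oo, Q n A <= e%:E.

Lemma asymptotically_null_sub (A B : set S) : measurable A -> measurable B -> A `<=` B ->
  asymptotically_null B -> asymptotically_null A.
Proof.
move=> mA mB AB B0 e e0; have := B0 e e0; apply: filterS => n; apply: le_trans.
by apply: le_measure; rewrite ?inE.
Qed.

Lemma asymptotically_nullU (A B : set S) : measurable A -> measurable B ->
  asymptotically_null A -> asymptotically_null B -> asymptotically_null (A `|` B).
Proof.
move=> mA mB A0 B0 e e0; have e2 : (0 < e / 2)%R by rewrite divr_gt0.
have := B0 _ e2; have := A0 _ e2; apply: filterS2 => n An Bn.
apply: (le_trans (measureU2 (Q n) mA mB)).
by rewrite [e]splitr EFinD; exact: leeD.
Qed.

Lemma asymptotically_null_bigU (A : nat -> set S) N : (forall i, measurable (A i)) ->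
  (forall i, asymptotically_null (A i)) ->
  asymptotically_null (\big[setU/set0]_(i < N) A i).
Proof.
move=> mA A0; elim: N => [|N IH].
  by rewrite big_ord0 => e e0; apply: nearW => n; rewrite measure0 lee_fin ltW.
rewrite big_ord_recr; apply: asymptotically_nullU => //.
exact: bigsetU_measurable.
Qed.

Context (F : probability R R) (u v : {mfun S >-> R}).
Hypothesis u_cvg : forall x, no_atom F x ->
  Q n (u @^-1` `]-oo, x]%classic) @[n --> \oo] --> F `]-oo, x]%classic.
Hypothesis v_cvg : forall x, no_atom F x ->
  Q n (v @^-1` `]-oo, x]%classic) @[n --> \oo] --> F `]-oo, x]%classic.
Hypothesis almost_ordered : forall e : R, (0 < e)%R ->
  asymptotically_null [set w | (v w + e <= u w)%R].

Let mpre (f : {mfun S >-> R}) (A : set R) : measurable A -> measurable (f @^-1` A).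
Proof. by move=> mA; rewrite -[X in measurable X]setTI; exact: measurable_funPT. Qed.

Let near_limit (f : {mfun S >-> R}) (r e : R) :
  Q n (f @^-1` `]-oo, r]%classic) @[n --> \oo] --> F `]-oo, r]%classic -> (0 < e)%R ->
  \forall n \near \oo, (`|fine (F `]-oo, r]%classic) -
    fine (Q n (f @^-1` `]-oo, r]%classic))| <= e)%R.
Proof.
have -> : F `]-oo, r]%classic = (fine (F `]-oo, r]%classic))%:E.
  by rewrite fineK// fin_num_measure.
by move=> /fine_cvgP[_] /cvgrPdist_le/(_ e).
Qed.

Lemma no_atom_right (x e : R) : (0 < e)%R ->
  exists y, [/\ no_atom F y, (x < y)%R & F `]x, y]%classic <= e%:E].
Proof.
move=> e0; have x_gt n : (x < x + n.+1%:R^-1 :> R)%R by rewrite ltrDl invr_gt0.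
have x_cvg : (x + n.+1%:R^-1)%R @[n --> \oo] --> x.
  rewrite -[X in _ --> X]addr0; apply: cvgD; first exact: cvg_cst.
  exact: cvg_harmonic.
have := cvg_cdf_above (p := F) x_gt x_cvg.
have E y : F `]-oo, y]%classic = (fine (F `]-oo, y]%classic))%:E.
  by rewrite fineK// fin_num_measure.
rewrite (E x) => /fine_cvgP[_] /cvgrPdist_le/(_ e e0)[N _ /(_ N (leqnn N))] /= small.
have [y [Fy /andP[xy yN]]] := no_atom_dense F (x_gt N).
exists y; split => //; rewrite itv_oc_measure ?(ltW xy)// (E y) (E x) -EFinB lee_fin.
apply: le_trans small; rewrite distrC; apply: le_trans (ler_norm _).
rewrite lerD2r fine_le ?fin_num_measure//.
by apply: le_measure; rewrite ?inE//; apply: subset_itvl; rewrite bnd_simp ltW.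
Qed.

(** P(u <= a < v) = P(u <= a) - P(v <= a) + P(v <= a < u).  The difference tends to 0, and the last
    event forces [u] into a short interval to the right of [a], unless [v] is below [u] by a fixed
    amount. *)
Lemma asymptotically_null_crossing (a : R) : no_atom F a ->
  asymptotically_null [set w | (u w <= a)%R /\ (a < v w)%R].
Proof.
move=> Fa e e0; have e4 : (0 < e / 4)%R by rewrite divr_gt0.
have [b [Fb ab Fab]] := no_atom_right a e4.
have ba0 : (0 < b - a)%R by rewrite subr_gt0.
have finF r : F `]-oo, r]%classic = (fine (F `]-oo, r]%classic))%:E.
  by rewrite fineK// fin_num_measure.
have e8 : (0 < e / 8)%R by rewrite divr_gt0.
have ua := near_limit (u_cvg Fa) e8; have ub := near_limit (u_cvg Fb) e8.
have va := near_limit (v_cvg Fa) e8; have ord := almost_ordered ba0 e8.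
move: Fab; rewrite itv_oc_measure ?(ltW ab)// (finF a) (finF b) -EFinB lee_fin => Fab.
near=> n.
have ua' : (`|fine (F `]-oo, a]%classic) - fine (Q n (u @^-1` `]-oo, a]%classic))| <= e / 8)%R.
  by near: n.
have ub' : (`|fine (F `]-oo, b]%classic) - fine (Q n (u @^-1` `]-oo, b]%classic))| <= e / 8)%R.
  by near: n.
have va' : (`|fine (F `]-oo, a]%classic) - fine (Q n (v @^-1` `]-oo, a]%classic))| <= e / 8)%R.
  by near: n.
have ord' : Q n [set w | (v w + (b - a) <= u w)%R] <= (e / 8)%:E by near: n.
pose U := u @^-1` `]-oo, a]%classic; pose B := u @^-1` `]-oo, b]%classic.
pose W := v @^-1` `]-oo, a]%classic.
pose D := [set w | (v w + (b - a) <= u w)%R].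
have mU : measurable U by exact: mpre.
have mB : measurable B by exact: mpre.
have mW : measurable W by exact: mpre.
have mD : measurable D.
  rewrite (_ : D = setT `&` [set w | (v w + (b - a) <= u w)%R]); last by rewrite setTI.
  by apply: measurable_fun_le => //; apply: measurable_funD.
have -> : [set w | (u w <= a)%R /\ (a < v w)%R] = U `\` W.
  apply/seteqP; split=> w; rewrite /U /W /= !in_itv/=.
    by move=> [-> aw]; split=> //; rewrite leNgt aw.
  by move=> [-> /negP]; rewrite -ltNge.
have UW : Q n (U `\` W) + Q n W <= Q n B + Q n D.
  rewrite -measureU//; last 2 first.
  - exact: measurableD.
  - by rewrite setIC setDIK.
  apply: le_trans (measureU2 (Q n) mB mD); apply: le_measure; rewrite ?inE//.
  - by apply: measurableU => //; exact: measurableD.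
  - exact: measurableU.
  move=> w [[wa _]|wa].
    by left; move: wa; rewrite /U /B /= !in_itv/= => /le_trans ->//; exact: ltW.
  have {}wa : (v w <= a)%R by move: wa; rewrite /W /= in_itv.
  have [ub''|ub''] := leP (u w) b; [by left; rewrite /B/= in_itv/=|right].
  by rewrite /D /=; lra.
have finQ A : measurable A -> Q n A = (fine (Q n A))%:E.
  by move=> mA; rewrite fineK// fin_num_measure.
move: UW ord'; rewrite -/D.
rewrite (finQ (U `\` W)); last exact: measurableD.
rewrite (finQ W mW) (finQ B mB) (finQ D mD) -!EFinD !lee_fin => UW DW.
move: ua' ub' va'; rewrite -/U -/B -/W !ler_norml => /andP[? ?] /andP[? ?] /andP[? ?].
lra.
Unshelve. all: by end_near. Qed.

(** If [v] exceeds [u] by [eta], a grid of mesh less than [eta] has a point between them, or [u] lies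
    outside the range of the grid. *)
Lemma asymptotically_null_gap (eta : R) : (0 < eta)%R ->
  asymptotically_null [set w | (u w + eta <= v w)%R].
Proof.
move=> eta0 e e0; have h0 : (0 < eta / 2)%R by rewrite divr_gt0.
have e6 : (0 < e / 6)%R by rewrite divr_gt0.
have e3 : (0 < e / 3)%R by rewrite divr_gt0.
pose X : {RV F >-> R} := id_rv.
have [x0 x0P] : exists x0 : R, forall x, (x <= x0)%R -> (fine (F `]-oo, x]%classic) <= e / 6)%R.
  have := cvg_cdfNy0 X => /fine_cvgP[_] /cvgrPdist_le/(_ _ e6)[M [_ MP]].
  exists (M - 1)%R => x xM; have := MP x.
  rewrite /= sub0r normrN => h; apply: le_trans (ler_norm _) (h _).
  by rewrite (le_lt_trans xM)// ltrBlDr ltrDl.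
have [x1 x1P] : exists x1 : R, forall x, (x1 <= x)%R ->
    (1 - fine (F `]-oo, x]%classic) <= e / 6)%R.
  have := cvg_cdfy1 X => /fine_cvgP[_] /cvgrPdist_le/(_ _ e6)[M [_ MP]].
  exists (M + 1)%R => x xM; have := MP x.
  move=> /= h; apply: le_trans (ler_norm _) (h _).
  by rewrite (lt_le_trans _ xM)// ltrDl.
(* The grid has one point without mass in each of the consecutive intervals of length eta / 2. *)
pose y0 := (x0 - eta / 2)%R.
have step i : (y0 + i%:R * (eta / 2) < y0 + i.+1%:R * (eta / 2) :> R)%R.
  by rewrite ltrD2l ltr_pM2r// ltr_nat.
have [a aP] := choice (fun i => no_atom_dense F (step i)).
have aN i : no_atom F (a i) by case: (aP i).
have aS i : (a i.+1 < a i + eta)%R.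
  have [_ /andP[lo _]] := aP i; have [_ /andP[_ hi]] := aP i.+1.
  apply: (lt_le_trans hi); have : (y0 + i%:R * (eta / 2) + eta <= a i + eta)%R.
    by rewrite lerD2r ltW.
  by apply: le_trans; rewrite -(natr1 i.+1) -(natr1 i); lra.
have [N x1N] : exists N, (x1 <= a N)%R.
  exists (Num.truncn (`|x1 - y0| / (eta / 2))%R).+1.
  set N := _.+1; have [_ /andP[+ _]] := aP N => /ltW; apply: le_trans.
  rewrite -lerBlDl; apply: (le_trans (ler_norm _)).
  by rewrite -ler_pdivrMr// ltW// truncnS_gt.
have a0 : (a 0%N <= x0)%R.
  have [_ /andP[_ /ltW]] := aP 0%N; rewrite mul1r /y0 => h.
  by apply: (le_trans h); rewrite subrK.
pose C i := [set w | (u w <= a i)%R /\ (a i < v w)%R].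
have mC i : measurable (C i).
  rewrite (_ : C i = u @^-1` `]-oo, a i]%classic `&` v @^-1` `]a i, +oo[%classic).
    by apply: measurableI; exact: mpre.
  by apply/seteqP; split=> w; rewrite /C/= !in_itv/= andbT.
pose G := \big[setU/set0]_(i < N) C i.+1.
have mG : measurable G by apply: bigsetU_measurable.
have mU r : measurable (u @^-1` `]-oo, r]%classic) by exact: mpre.
have sub : [set w | (u w + eta <= v w)%R] `<=`
    (u @^-1` `]-oo, a 0%N]%classic `|` G) `|` ~` (u @^-1` `]-oo, a N]%classic).
  move=> w /= uv; rewrite /G; elim: (N) => [|k IH].
    by rewrite !in_itv/=; case: (leP (u w) (a 0%N)) => h; [left; left|right].
  rewrite big_ord_recr/=; case: IH => [[|]|].
  - by left; left.
  - by left; right; left.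
  rewrite !in_itv/= => /negP; rewrite -ltNge => aku.
  have [ua|au] := leP (u w) (a k.+1); last by right.
  by left; right; right; split => //; apply: (lt_trans (aS k)); apply: lt_le_trans uv; rewrite ltrD2r.
have G0 : asymptotically_null G.
  apply: (asymptotically_null_bigU (A := fun i => C i.+1)) => // i.
  exact: asymptotically_null_crossing.
have GN := G0 _ e3.
have u0 := near_limit (u_cvg (aN 0%N)) e6; have uN := near_limit (u_cvg (aN N)) e6.
have := x0P _ a0; have := x1P _ x1N => FN F0.
near=> n.
have u0' : (`|fine (F `]-oo, a 0%N]%classic) - fine (Q n (u @^-1` `]-oo, a 0%N]%classic))| <= e / 6)%R.
  by near: n.
have uN' : (`|fine (F `]-oo, a N]%classic) - fine (Q n (u @^-1` `]-oo, a N]%classic))| <= e / 6)%R.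
  by near: n.
have GN' : Q n G <= (e / 3)%:E by near: n.
have mD : measurable [set w | (u w + eta <= v w)%R].
  rewrite (_ : [set w | _] = setT `&` [set w | (u w + eta <= v w)%R]); last by rewrite setTI.
  by apply: measurable_fun_le => //; apply: measurable_funD.
have finQ A : measurable A -> Q n A = (fine (Q n A))%:E.
  by move=> mA; rewrite fineK// fin_num_measure.
apply: (@le_trans _ _ (Q n (u @^-1` `]-oo, a 0%N]%classic) + Q n G +
    Q n (~` (u @^-1` `]-oo, a N]%classic)))).
  apply: (@le_trans _ _ (Q n ((u @^-1` `]-oo, a 0%N]%classic `|` G) `|`
      ~` (u @^-1` `]-oo, a N]%classic)))).
    apply: le_measure; rewrite ?inE//.
    by apply: measurableU; [exact: measurableU|exact: measurableC].
  apply: (le_trans (measureU2 (Q n) _ _)).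
  - exact: measurableU.
  - exact: measurableC.
  by rewrite leeD2r//; exact: measureU2.
rewrite probability_setC//; move: GN'; rewrite (finQ G mG) (finQ _ (mU (a 0%N))) (finQ _ (mU (a N))).
rewrite -EFinB -!EFinD !lee_fin => GN'.
move: u0' uN'; rewrite !ler_norml => /andP[? ?] /andP[? ?].
lra.
Unshelve. all: by end_near. Qed.

End asymptotic_order.

(** * Couplings are centered *)

Section mass_away_from_zero.
Local Open Scope ereal_scope.
Context {R : realType} {dLR} {TLR : measurableType dLR} (PLR : probability TLR R).
Context (LR0 : {RV PLR >-> (R * R)%type}).
Hypothesis LR0_ge0 : forall w, (0 <= (LR0 w).1)%R /\ (0 <= (LR0 w).2)%R.
Context (g : R) (g_bnd : (1 < g <= 2)%R).
Context (aL aR : R).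
Hypothesis aLE : \int[PLR]_w ((LR0 w).1 `^ g)%:E = aL%:E.
Hypothesis aRE : \int[PLR]_w ((LR0 w).2 `^ g)%:E = aR%:E.
Hypothesis LR_mean : 1 <= \int[PLR]_w ((LR0 w).1 + (LR0 w).2)%:E.
Hypothesis a_lt1 : (aL + aR < 1)%R.

(** A Laplace transform that stays below 1 - x / 2 at some x > 0 prevents the law from concentrating
    near 0. *)
Lemma tree_mass_away : exists c : R, (0 < c)%R /\ forall u,
  c%:E <= real_law LR0 (dirac (1%R : R)) u `[(4^-1 : R)%R, +oo[%classic.
Proof.
have aL0 : (0 <= aL)%R.
  by rewrite -lee_fin -aLE; apply: integral_ge0 => w _; rewrite lee_fin powR_ge0.
have aR0 : (0 <= aR)%R.
  by rewrite -lee_fin -aRE; apply: integral_ge0 => w _; rewrite lee_fin powR_ge0.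
pose m := (aL + aR)%R; have m0 : (0 <= m)%R by rewrite addr_ge0.
have m1 : (0 < 1 - m)%R by rewrite subr_gt0.
(* This value makes K (1 - m) = 1, which exceeds the m / 2 needed for the barrier. *)
pose K := ((1 - m)^-1)%R.
have K1 : (1 <= K)%R by rewrite invf_ge1// gerBl.
have KP : ((K + 2^-1) * (aL + aR) <= K)%R.
  rewrite -/m; have : (K * (1 - m) = 1)%R by rewrite mulVf// gt_eqF.
  by move=> h; have : (m < 1)%R by []; lra.
have [g1 _] := andP g_bnd.
have g10 : (0 < g - 1)%R by rewrite subr_gt0.
pose q := ((2 * K)^-1)%R; have q0 : (0 < q)%R by rewrite invr_gt0 mulr_gt0// (lt_le_trans _ K1).
have q1 : (q <= 1)%R by rewrite invf_le1 ?mulr_gt0// ?(lt_le_trans _ K1)//; lra.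
(* The point where K x ^ g = x / 2, so that the barrier is at least x / 2. *)
pose x := (q `^ (g - 1)^-1)%R.
have x0 : (0 < x)%R by exact: powR_gt0.
have x1 : (x <= 1)%R.
  apply: (@le_trans _ _ (1 `^ (g - 1)^-1)%R); last by rewrite powR1.
  have gi : (0 <= (g - 1)^-1)%R by rewrite invr_ge0 ltW.
  have qn : q \in Num.nneg by rewrite nnegrE ltW.
  have on : (1 : R)%R \in Num.nneg by rewrite nnegrE.
  exact: (ge0_ler_powR gi qn on q1).
have xg : (K * x `^ g = x / 2)%R.
  rewrite -(mulr_powRB1 (ltW x0)); last exact: lt_trans g1.
  rewrite -powRrM mulVf ?gt_eqF// powRr1 ?(ltW q0)// /q.
  by field; rewrite gt_eqF// (lt_le_trans _ K1).
exists (x / 4)%R; split; first by rewrite divr_gt0.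
move=> u; set p := real_law LR0 (dirac (1%R : R)) u.
have lap : laplace p x <= (1 - x / 2)%:E.
  apply: (le_trans (tree_laplace_le LR0_ge0 g_bnd aLE aRE LR_mean K1 KP u (ltW x0))).
  rewrite lee_fin lerD2l lerN2; apply: le_trans (barrier_ge g K x).
  by rewrite xg; lra.
have -> : `[(4^-1 : R)%R, +oo[%classic = ~` `]-oo, (4^-1 : R)%R[%classic by rewrite setCitvl.
have -> := probability_setC p (measurable_itv `]-oo, (4^-1 : R)%R[).
have E : p `]-oo, (4^-1 : R)%R[%classic = (fine (p `]-oo, (4^-1 : R)%R[%classic))%:E.
  by rewrite fineK// fin_num_measure.
have cheb : (expR (- (x / 4)))%:E * p `]-oo, (4^-1 : R)%R[%classic <= (1 - x / 2)%:E.
  apply: le_trans lap; rewrite /laplace -integral_cst//.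
  apply: (@le_trans _ _ (\int[p]_(z in `]-oo, (4^-1 : R)%R[%classic) (expR (- (x * z)))%:E)).
    apply: ge0_le_integral => //.
    - by move=> z _; rewrite lee_fin expR_ge0.
    - exact: measurable_funS (measurable_laplace x).
    move=> z; rewrite /= in_itv/= => z4; rewrite lee_fin ler_expR lerN2.
    by rewrite ler_pM2l// ltW.
  by apply: ge0_subset_integral => //; exact: measurable_laplace.
move: cheb; rewrite E -EFinM -EFinB !lee_fin; set b := fine _ => cheb.
have b0 : (0 <= b)%R by rewrite fine_ge0.
have : ((1 - x / 4) * b <= 1 - x / 2)%R.
  apply: le_trans cheb; rewrite ler_wpM2r//.
  by have := expR_ge1Dx (- (x / 4)).
have x4 : (0 < 1 - x / 4)%R by lra.
rewrite mulrC -ler_pdivlMr// => bx.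
have : ((1 - x / 2) / (1 - x / 4) <= 1 - x / 4)%R.
  rewrite ler_pdivrMr//; have := sqr_ge0 (x / 4); rewrite expr2; lra.
lra.
Qed.

End mass_away_from_zero.

Section gap_vanishes.
Local Open Scope ereal_scope.
Context {R : realType} {d} {S : measurableType d} (Q : nat -> probability S R).
Context (f : {mfun S >-> R}) (g : R) (g_gt0 : (0 < g)%R).

(** Markov's inequality. *)
Lemma asymptotically_null_moment (b : nat -> R) :
  (forall n, \int[Q n]_p (`|f p| `^ g)%:E <= (b n)%:E) -> b @ \oo --> 0%R ->
  forall e : R, (0 < e)%R -> asymptotically_null Q [set p | (e <= `|f p|)%R].
Proof.
move=> fb b0 e e0 r r0.
have eg0 : (0 < e `^ g)%R by exact: powR_gt0.
have mA : measurable [set p | (e <= `|f p|)%R].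
  rewrite (_ : [set p | _] = setT `&` [set p | (e <= `|f p|)%R]); last by rewrite setTI.
  by apply: measurable_fun_le => //; exact: measurableT_comp.
have := b0 => /cvgrPdist_le/(_ (e `^ g * r)%R); rewrite mulr_gt0// => /(_ isT).
apply: filterS => n; rewrite sub0r normrN => bn.
have : (e `^ g)%:E * Q n [set p | (e <= `|f p|)%R] <= (e `^ g * r)%:E.
  apply: (@le_trans _ _ (b n)%:E); last by rewrite lee_fin (le_trans (ler_norm _)).
  apply: le_trans (fb n); rewrite -integral_cst//.
  apply: (@le_trans _ _ (\int[Q n]_(p in [set p | (e <= `|f p|)%R]) (`|f p| `^ g)%:E)).
    apply: ge0_le_integral => //.
    - by move=> p _; rewrite lee_fin powR_ge0.
    - by apply: measurable_funS (measurable_norm_powR _ _).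
    move=> p /= ep; rewrite lee_fin ge0_ler_powR ?nnegrE// ltW//.
  by apply: ge0_subset_integral => //; exact: measurable_norm_powR.
by rewrite EFinM lee_pmul2l// lte_fin.
Qed.

End gap_vanishes.

Section centering.
Local Open Scope ereal_scope.
Context {R : realType} {dLR} {TLR : measurableType dLR} (PLR : probability TLR R).
Context (LR0 : {RV PLR >-> (R * R)%type}).
Hypothesis LR0_ge0 : forall w, (0 <= (LR0 w).1)%R /\ (0 <= (LR0 w).2)%R.
Context (g : R) (g_bnd : (1 < g <= 2)%R).
Context (aL aR : R).
Hypothesis aLE : \int[PLR]_w ((LR0 w).1 `^ g)%:E = aL%:E.
Hypothesis aRE : \int[PLR]_w ((LR0 w).2 `^ g)%:E = aR%:E.
Hypothesis LR_mean : 1 <= \int[PLR]_w ((LR0 w).1 + (LR0 w).2)%:E.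
Hypothesis a_lt1 : (aL + aR < 1)%R.
Context (mu : probability (R * R * R)%type R) (mu1 mu2 : probability R R).
Hypothesis mu1E : forall A, measurable A -> mu1 A = mu (first3 @^-1` A).
Hypothesis mu2E : forall A, measurable A -> mu2 A = mu (second3 @^-1` A).
Hypothesis mu3E : forall A, measurable A ->
  dirac (1%R : R) A = mu (snd @^-1` A) :> \bar R.
Context (F : R -> probability R R).
Hypothesis FE : forall t, (0 <= t)%R ->
  is_mixture (F t) (tree_weight t) (real_law LR0 mu1).
Hypothesis mu2_fixed : forall u A, measurable A -> real_law LR0 mu2 u A = mu2 A.
Hypothesis F_cvg : forall x, no_atom mu2 x ->
  F n%:R `]-oo, x]%classic @[n --> \oo] --> mu2 `]-oo, x]%classic.

Let Q n : probability (R * R * R)%type R := flow LR0 mu (ler0n R n).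

Let m2 : measurable_fun setT (snd : R * R * R -> R). Proof. by []. Qed.

Let mass_ge (A : set R) (c : R) n : measurable A -> (0 <= c)%R ->
  (forall u, c%:E <= real_law LR0 (dirac (1%R : R)) u A) ->
  c%:E <= Q n (snd @^-1` A).
Proof.
move=> mA c0 cA.
have -> := flow_image (ler0n R n) m2 (fun w x y => erefl) mu3E mA.
rewrite -[leLHS]mule1 -(esum_tree_weight (ler0n R n)) -esumZl//; last first.
  by move=> u; rewrite lee_fin tree_weight_ge0.
apply: le_esum => u _; rewrite muleC; apply: lee_wpmul2l => //.
by rewrite lee_fin tree_weight_ge0.
Qed.

Let mass_lt0 n : Q n [set p | (p.2 < 0)%R] = 0.
Proof.
have mge0 : measurable [set z : R | (0 <= z)%R].
  rewrite (_ : [set z | _] = `[0%R, +oo[%classic)//.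
  by apply/seteqP; split=> z /=; rewrite in_itv/= andbT.
have -> : [set p : R * R * R | (p.2 < 0)%R] = ~` (snd @^-1` [set z : R | (0 <= z)%R]).
  by apply/seteqP; split=> p /=; rewrite ltNge => /negP.
rewrite probability_setC; last by rewrite -[_ @^-1` _]setTI; exact: m2.
suff -> : Q n (snd @^-1` [set z : R | (0 <= z)%R]) = 1 by rewrite subee.
apply/eqP; rewrite eq_le probability_le1/=; last by rewrite -[_ @^-1` _]setTI; exact: m2.
have d1 : dirac (1%R : R) [set z : R | (0 <= z)%R] = 1 :> \bar R.
  by rewrite diracE mem_set//=.
by apply: mass_ge => // u; rewrite (real_law_ge0 LR0_ge0 u d1).
Qed.

Let no_drift (u v z : {mfun (R * R * R)%type >-> R}) (k : R) : (0 < k)%R ->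
  (forall p, `|v p - u p - k * p.2| = `|z p|)%R ->
  (forall x, no_atom mu2 x ->
    Q n (u @^-1` `]-oo, x]%classic) @[n --> \oo] --> mu2 `]-oo, x]%classic) ->
  (forall x, no_atom mu2 x ->
    Q n (v @^-1` `]-oo, x]%classic) @[n --> \oo] --> mu2 `]-oo, x]%classic) ->
  (forall e : R, (0 < e)%R -> asymptotically_null Q [set p | (e <= `|z p|)%R]) ->
  False.
Proof.
move=> k0 vE u_cvg v_cvg z0.
have mle (f h : R * R * R -> R) : measurable_fun setT f -> measurable_fun setT h ->
    measurable [set p | (f p <= h p)%R].
  move=> mf mh; rewrite (_ : [set p | _] = setT `&` [set p | (f p <= h p)%R]); last by rewrite setTI.
  exact: measurable_fun_le.
have mz e : measurable [set p | (e <= `|z p|)%R].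
  by apply: mle => //; exact: measurableT_comp.
have mneg : measurable [set p : R * R * R | (p.2 < 0)%R].
  rewrite (_ : [set p : R * R * R | _] = ~` [set p | (0 <= p.2)%R]).
    by apply: measurableC; exact: mle.
  by apply/seteqP; split=> p /=; rewrite ltNge => /negP.
have ordered e : (0 < e)%R -> asymptotically_null Q [set p | (v p + e <= u p)%R].
  move=> e0; apply: (asymptotically_null_sub
      (B := [set p | (p.2 < 0)%R] `|` [set p | (e <= `|z p|)%R])).
  - by apply: mle => //; exact: measurable_funD.
  - exact: measurableU.
  - move=> p /= h; have [p0|p0] := ltP p.2 0%R; [by left|right].
    have kp : (0 <= k * p.2)%R by rewrite mulr_ge0// ltW.
    by rewrite -vE ler_normr; apply/orP; right; lra.
  apply: asymptotically_nullU => //; last exact: z0.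
  by move=> r r0; apply: nearW => n; rewrite mass_lt0 lee_fin ltW.
have [c [c0 cP]] := tree_mass_away LR0_ge0 g_bnd aLE aRE LR_mean a_lt1.
have k8 : (0 < k / 8)%R by rewrite divr_gt0.
have m4 : measurable (snd @^-1` `[(4^-1 : R)%R, +oo[%classic : set (R * R * R)).
  by rewrite -[_ @^-1` _]setTI; exact: m2.
have : asymptotically_null Q (snd @^-1` `[(4^-1 : R)%R, +oo[%classic).
  apply: (asymptotically_null_sub (B := [set p | (u p + k / 8 <= v p)%R] `|`
      [set p | (k / 8 <= `|z p|)%R])) => //.
  - by apply: measurableU => //; apply: mle => //; exact: measurable_funD.
  - move=> p; rewrite /= in_itv/= andbT => p4.
    have [zk|zk] := leP (k / 8)%R `|z p|%R; [by right|left].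
    have kp : (k * 4^-1 <= k * p.2)%R by rewrite ler_pM2l.
    by move: zk; rewrite -vE ltr_norml => /andP[]; lra.
  apply: asymptotically_nullU => //; last exact: z0.
    by apply: mle => //; exact: measurable_funD.
  exact: (asymptotically_null_gap u_cvg v_cvg ordered).
move=> /(_ (c / 2)%R); rewrite divr_gt0// => /(_ isT) [N _ /(_ N (leqnn N))] /= QN.
have := le_trans (mass_ge N (measurable_itv _) (ltW c0) cP) QN.
by rewrite lee_fin; lra.
Qed.

(** A nonzero mean would make the smoothed coupling asymptotically ordered, with a gap of the size of
    the total weight of the leaves, although both marginals converge to the same law. *)
Theorem coupling_centered (delta K : R) : (0 <= K)%R ->
  (forall a, abs_moment g (distribution mu (gap delta)) a <= (`|a| `^ g + K)%:E) ->
  delta = 0%R.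
Proof.
move=> K0 gapK; have [g1 _] := andP g_bnd; have g0 : (0 < g)%R by exact: lt_trans g1.
have b0 : (K * expR (- ((1 - (aL + aR)) * n%:R)))%R @[n --> \oo] --> 0%R.
  rewrite -(mulr0 K); apply: cvgMr.
  have lin : ((1 - (aL + aR)) * n%:R)%R @[n --> \oo] --> +oo%R.
    apply/cvgryPge => A; have := nbhs_infty_ger (A / (1 - (aL + aR)))%R.
    by apply: filterS => n; rewrite ler_pdivrMr ?subr_gt0// mulrC.
  by apply: (cvg_comp _ (fun x => expR (- x))%R lin); exact: cvgr_expR.
have gap0 := asymptotically_null_moment g0
  (fun n => flow_gap_moment LR0_ge0 g0 aLE aRE (ler0n R n) K0 gapK) b0.
have x_cvg r : no_atom mu2 r ->
    Q n (first3 @^-1` `]-oo, r]%classic) @[n --> \oo] --> mu2 `]-oo, r]%classic.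
  move=> /F_cvg; apply: cvg_trans; apply: near_eq_cvg; apply: nearW => n.
  exact/esym/(flow_fst mu1E (ler0n R n) (FE (ler0n R n)) (measurable_itv `]-oo, r])).
have y_cvg r : no_atom mu2 r ->
    Q n (second3 @^-1` `]-oo, r]%classic) @[n --> \oo] --> mu2 `]-oo, r]%classic.
  move=> _; apply: cvg_near_cst; apply: nearW => n.
  exact: (flow_snd mu2E (ler0n R n) mu2_fixed).
have [d0|d0|//] := ltgtP delta 0%R; exfalso.
  apply: (@no_drift first3 second3 (gap delta) (- delta)%R) => //.
  - by rewrite oppr_gt0.
  - move=> p; rewrite -normrN; congr (Num.norm _).
    by rewrite /= /gap /first3 /second3; ring.
apply: (@no_drift second3 first3 (gap delta) delta) => //.
Qed.

End centering.

(** * The contracted coupling *)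

Section couplings.
Local Open Scope ereal_scope.
Context {R : realType} {dQ} {TQ : measurableType dQ} (Q0 : probability TQ R).
Context (X' Y' : {RV Q0 >-> R}) (g : R).

(** A leaf carries the total weight 1. *)
Definition pair_and_mass (w : TQ) : R * R * R := ((X' w, Y' w), 1%R).

Lemma measurable_pair_and_mass : measurable_fun setT pair_and_mass.
Proof.
apply: measurable_fun_pair => //.
by apply: measurable_fun_pair; exact: measurable_funPT.
Qed.

HB.instance Definition _ :=
  isMeasurableFun.Build _ _ _ _ pair_and_mass measurable_pair_and_mass.

Definition pair_law : probability (R * R * R)%type R := distribution Q0 pair_and_mass.

Lemma pair_law_mass A : measurable A ->
  dirac (1%R : R) A = pair_law (snd @^-1` A) :> \bar R.
Proof.
move=> mA; rewrite diracE.
transitivity (Q0 [set w | A 1%R]); last by [].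
have [A1|A1] := boolP (1%R \in A).
  rewrite (_ : [set w | A 1%R] = setT) ?probability_setT//.
  by apply/seteqP; split=> // w _; exact: set_mem A1.
rewrite (_ : [set w | A 1%R] = set0) ?measure0//.
by apply/seteqP; split=> // w wA; move/negP: A1; apply; exact: mem_set.
Qed.

Lemma gap_abs_moment delta a :
  abs_moment g (distribution pair_law (gap delta)) a =
  \int[Q0]_w (`|a + (X' w - Y' w - delta)| `^ g)%:E.
Proof.
have mf : measurable_fun setT (fun z : R => (`|a + z| `^ g)%:E).
  by apply: measurable_norm_powR; exact: measurable_funD.
have f0 (z : R) : 0 <= (`|a + z| `^ g)%:E by rewrite lee_fin powR_ge0.
rewrite /abs_moment ge0_integral_distribution//.
have mfg : measurable_fun setT ((fun z : R => (`|a + z| `^ g)%:E) \o gap delta).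
  by apply: measurableT_comp => //; exact: measurable_gap.
rewrite ge0_integral_distribution; [|exact: mfg|by move=> p; exact: f0].
by apply: eq_integral => w _; rewrite /= /gap /= mulr1.
Qed.

Context (M : R) (ME : \int[Q0]_w (`|X' w - Y' w| `^ g)%:E = M%:E).

Lemma gap0_abs_moment : abs_moment g (distribution pair_law (gap 0)) 0 = M%:E.
Proof. by rewrite gap_abs_moment -ME; apply: eq_integral => w _; rewrite add0r subr0. Qed.

(** The number [delta] is the mean of X' - Y'. *)
Lemma centered_gap : (1 < g <= 2)%R -> exists delta M', [/\ (0 <= M')%R,
  abs_moment g (distribution pair_law (gap delta)) 0 = M'%:E &
  forall a, abs_moment g (distribution pair_law (gap delta)) a <=
    (`|a| `^ g + 2 * M')%:E].
Proof.
move=> g12; have /andP[g1 _] := g12.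
pose D w := (X' w - Y' w)%R.
have mD : measurable_fun setT D by exact: measurable_funB.
have iM : Q0.-integrable setT (fun w => (`|D w| `^ g)%:E).
  apply/integrableP; split; first exact: measurable_norm_powR.
  under eq_integral do rewrite gee0_abs ?lee_fin ?powR_ge0//.
  by rewrite ME ltry.
have i1 (c : R) : Q0.-integrable setT (fun=> c%:E).
  exact: finite_measure_integrable_cst.
have iD : Q0.-integrable setT (fun w => (D w)%:E).
  apply: (@le_integrable _ _ _ Q0 _ _ _ (fun w => 1 + (`|D w| `^ g)%:E)) => //.
  - exact/measurable_EFinP.
  - move=> w _; rewrite -EFinD /= lee_fin [leRHS]ger0_norm ?addr_ge0 ?powR_ge0//.
    have [D1|/ltW D1] := leP `|D w|%R 1%R; first by rewrite (le_trans D1)// lerDl powR_ge0.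
    by rewrite (le_trans (le1r_powR D1 (ltW g1)))// lerDr.
  - exact: integrableD.
pose delta := fine (\int[Q0]_w (D w)%:E); exists delta.
have deltaE : \int[Q0]_w (D w)%:E = delta%:E by rewrite fineK// integrable_fin_num.
have iDd : Q0.-integrable setT (fun w => (D w - delta)%:E).
  under eq_fun do rewrite EFinB; exact: integrableB.
have mDd : measurable_fun setT (fun w => (D w - delta)%R) by exact: measurable_funB.
have [k kP] := powR_normD_le (- delta)%R g12.
have iDg : Q0.-integrable setT (fun w => (`|D w - delta| `^ g)%:E).
  apply: (@le_integrable _ _ _ Q0 _ _ _ (fun w =>
      (`|- delta| `^ g)%:E + (k%:E * (D w)%:E + 2%:E * (`|D w| `^ g)%:E))) => //.
  - exact: measurable_norm_powR.
  - move=> w _; rewrite -!EFinM -!EFinD /= lee_fin ger0_norm ?powR_ge0//.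
    by apply: le_trans (ler_norm _); rewrite addrA (addrC (D w)) kP.
  - by apply: integrableD => //; apply: integrableD => //; exact: integrableZl.
pose M' := fine (\int[Q0]_w (`|D w - delta| `^ g)%:E); exists M'.
have M'0 : (0 <= M')%R.
  by apply: fine_ge0; apply: integral_ge0 => w _; rewrite lee_fin powR_ge0.
have M'E : abs_moment g (distribution pair_law (gap delta)) 0 = M'%:E.
  rewrite gap_abs_moment /M' fineK; last exact: integrable_fin_num.
  by apply: eq_integral => w _; rewrite add0r.
have mE : measurable_fun setT (EFin : R -> \bar R) by apply/measurable_EFinP.
have mgap : measurable_fun setT (fun p => (gap delta p)%:E).
  by apply/measurable_EFinP; exact: measurable_gap.
have igap' : Q0.-integrable setT (fun w => (gap delta (pair_and_mass w))%:E).
  by move: iDd; apply: eq_integrable => // w _; rewrite /gap /= mulr1.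
have igap : pair_law.-integrable setT (fun p => (gap delta p)%:E).
  exact: (integrable_pushforward measurable_pair_and_mass).
split => //; apply: abs_moment_center => //.
  exact: (integrable_pushforward (measurable_gap delta)).
rewrite integral_distribution// integral_distribution//.
transitivity (\int[Q0]_w ((D w)%:E - delta%:E)).
  by apply: eq_integral => w _; rewrite -EFinB /= /gap /= mulr1.
by rewrite integralB// deltaE integral_cst//= probability_setT mule1 subee.
Qed.

End couplings.

Section contracted_coupling.
Local Open Scope ereal_scope.
Context {R : realType} {dLR} {TLR : measurableType dLR} (PLR : probability TLR R).
Context (LR0 : {RV PLR >-> (R * R)%type}).
Hypothesis LR0_ge0 : forall w, (0 <= (LR0 w).1)%R /\ (0 <= (LR0 w).2)%R.
Context (g : R) (g_gt0 : (0 < g)%R) (g_le2 : (g <= 2)%R).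
Context (aL aR : R).
Hypothesis aLE : \int[PLR]_w ((LR0 w).1 `^ g)%:E = aL%:E.
Hypothesis aRE : \int[PLR]_w ((LR0 w).2 `^ g)%:E = aR%:E.
Hypothesis a_lt1 : (aL + aR < 1)%R.
Hypothesis LR_mean : (1 < g)%R -> 1 <= \int[PLR]_w ((LR0 w).1 + (LR0 w).2)%:E.
Context (mu0 Fi : probability R R) (F : R -> probability R R).
Hypothesis FE : forall t, (0 <= t)%R ->
  is_mixture (F t) (tree_weight t) (real_law LR0 mu0).
Hypothesis F_cvg : forall x, no_atom Fi x ->
  F t `]-oo, x]%classic @[t --> +oo%R] --> Fi `]-oo, x]%classic.
Context {dQ} {TQ : measurableType dQ} (Q0 : probability TQ R).
Context (X' Y' : {RV Q0 >-> R}).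
Hypothesis X'_law : forall A, measurable A -> distribution Q0 X' A = mu0 A.
Hypothesis Y'_law : forall A, measurable A -> distribution Q0 Y' A = Fi A.

Lemma contracted_coupling (M t : R) (t0 : (0 <= t)%R) :
  \int[Q0]_w (`|X' w - Y' w| `^ g)%:E = M%:E ->
  [/\ forall A, measurable A -> flow LR0 (pair_law X' Y') t0 (first3 @^-1` A) = F t A,
      forall A, measurable A -> flow LR0 (pair_law X' Y') t0 (second3 @^-1` A) = Fi A &
      \int[flow LR0 (pair_law X' Y') t0]_p (`|gap 0 p| `^ g)%:E <=
      ((if (g <= 1)%R then M else 2 * M) * expR (- ((1 - (aL + aR)) * t)))%:E].
Proof.
move=> ME; pose mu1 : probability R R := distribution Q0 X'.
pose mu2 : probability R R := distribution Q0 Y'.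
have M0 : (0 <= M)%R.
  by rewrite -lee_fin -ME; apply: integral_ge0 => w _; rewrite lee_fin powR_ge0.
have F1 s : (0 <= s)%R -> is_mixture (F s) (tree_weight s) (real_law LR0 mu1).
  move=> s0 A mA; rewrite FE//; apply: eq_esum => u _; congr (_ * _).
  by apply/esym; apply: eq_real_law.
have fixed2 u A : measurable A -> real_law LR0 mu2 u A = mu2 A.
  move=> mA; rewrite (eq_real_law LR0 (m := mu2) (m' := Fi))//.
  by rewrite (tree_limit_law_fixed LR0_ge0 FE F_cvg)//; exact/esym/Y'_law.
have mu1E A : measurable A -> mu1 A = pair_law X' Y' (first3 @^-1` A) by [].
have mu2E A : measurable A -> mu2 A = pair_law X' Y' (second3 @^-1` A) by [].
split.
- exact: (flow_fst mu1E t0 (F1 t t0)).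
- by move=> A mA; rewrite (flow_snd mu2E t0)//; exact: Y'_law.
have [g1|g1] := leP g 1%R.
  apply: (flow_gap_moment LR0_ge0 g_gt0 aLE aRE t0 M0).
  by apply: abs_moment_subadd => //; exact: gap0_abs_moment.
have g12 : (1 < g <= 2)%R by rewrite g1.
have [delta [M' [M'0 M'E centered]]] := centered_gap ME g12.
have F_cvgn x : no_atom mu2 x ->
    F n%:R `]-oo, x]%classic @[n --> \oo] --> mu2 `]-oo, x]%classic.
  rewrite /no_atom /= !Y'_law// => Fix0.
  apply: (cvg_comp (fun n => n%:R : R) (fun t => F t `]-oo, x]%classic)); last exact: (F_cvg Fix0).
  by apply/cvgryPge => A; exact: nbhs_infty_ger.
have M'20 : (0 <= 2 * M')%R by rewrite mulr_ge0.
have delta0 := coupling_centered LR0_ge0 g12 aLE aRE (LR_mean g1) a_lt1 mu1E mu2E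
  (pair_law_mass X' Y') F1 fixed2 F_cvgn M'20 centered.
move: M'E centered; rewrite delta0 (gap0_abs_moment ME) => -[<-] centered.
by apply: (flow_gap_moment LR0_ge0 g_gt0 aLE aRE t0 _ centered); rewrite mulr_ge0.
Qed.

End contracted_coupling.

Lemma ge0_addelt1 (R : realType) (x y : \bar R) : (0 <= x)%E -> (0 <= y)%E ->
  (x + y < 1)%E -> exists a b, [/\ x = a%:E, y = b%:E & a + b < 1].
Proof.
by case: x y => [a| |] [b| |]// _ _; rewrite -EFinD lte_fin => ab; exists a, b.
Qed.

(** * Contraction in Wasserstein distance *)

Theorem proposition3p6
  (R : realType)
  (* the fixed random vector (L, R) *)
  (dLR : measure_display) (TLR : measurableType dLR) (PLR : probability TLR R)
  (LR0 : {RV PLR >-> (R * R)%type})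
  (LR0_ge0 : forall w, 0 <= (LR0 w).1 /\ 0 <= (LR0 w).2)
  (* the initial condition X_0 *)
  (d0 : measure_display) (T0 : measurableType d0) (P0 : probability T0 R)
  (X0 : {RV P0 >-> R})
  (* the probability space carrying the independent families *)
  (d : measure_display) (T : measurableType d) (P : probability T R)
  (X : nat -> {RV P >-> R})
  (LR : nat -> {RV P >-> (R * R)%type})
  (I : nat -> {RV P >-> nat})
  (nu : R -> {RV P >-> nat})
  (X_law : forall n, (0 < n)%N -> cdf (X n) =1 cdf X0)
  (X_indep : independent P [set n | (0 < n)%N] (fun n => sigma_rv (X n)))
  (LR_law : forall n, (0 < n)%N -> forall A : set (R * R), measurable A ->
     distribution P (LR n) A = distribution PLR LR0 A)
  (LR_indep : independent P [set n | (0 < n)%N] (fun n => sigma_rv (LR n)))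
  (I_law : forall n i, (1 <= i <= n)%N ->
     P (I n @^-1` [set i]) = (n%:R^-1)%:E)
  (I_indep : independent P [set n | (0 < n)%N] (fun n => sigma_rv (I n)))
  (nu_gt0 : forall t : R, 0 <= t -> forall w, (0 < nu t w)%N)
  (nu_law : forall t : R, 0 <= t -> forall n, (0 < n)%N ->
     P (nu t @^-1` [set n]) = (expR (- t) * (1 - expR (- t)) ^+ n.-1)%:E)
  (families_indep : independent P [set: 'I_4] (fun k => nth set0
     [:: sigma_family [set n | (0 < n)%N] X;
         sigma_family [set n | (0 < n)%N] LR;
         sigma_family [set n | (0 < n)%N] I;
         sigma_family [set t : R | 0 <= t] nu] k))
  (* the limit in distribution of V_t *)
  (dV : measure_display) (TV : measurableType dV) (PV : probability TV R)
  (Vinfty : {RV PV >-> R})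
  (V_cvg : cvg_in_distribution (V LR I X nu) Vinfty)
  (alpha gamma : R)
  (alpha_bounds : 0 < alpha <= 2)
  (moment_alpha : moment LR0 alpha = 1%E)
  (calS_gamma : (calS LR0 gamma < 0)%E)
  (gamma_bounds : (1 <= alpha /\ alpha < gamma /\ gamma <= 2) \/
                  (alpha < gamma /\ gamma <= 1))
  (X0_tails : alpha != 1 -> exists cp cm : R,
     ((x `^ alpha)%:E * (1 - cdf X0 x))%E @[x --> +oo] --> cp%:E /\
     ((`|x| `^ alpha)%:E * cdf X0 x)%E @[x --> -oo] --> cm%:E)
  (X0_moment : alpha = 1 -> ('E_P0[fun w => (`|X0 w| `^ gamma)%R] < +oo)%E) :
  let A := if gamma <= 1 then 1 else 2 `^ gamma^-1 in
  let B := if gamma <= 1 then 1 else gamma^-1 in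
  forall t : R, 0 <= t ->
    (wasserstein gamma (V LR I X nu t) Vinfty <=
     A%:E * wasserstein gamma X0 Vinfty
       * (expR (- (B * t * `|fine (calS LR0 gamma)|)))%:E)%E.
Proof.
move=> A B t t0.
have alpha0 : 0 < alpha by case/andP: alpha_bounds.
have alpha_lt : alpha < gamma by case: gamma_bounds => [[_ []]|[]].
have gamma0 : 0 < gamma by exact: lt_trans alpha_lt.
have gamma_le2 : gamma <= 2 by case: gamma_bounds => [[_ [_ ->]]|[_ g1]] //; lra.
pose IL := (\int[PLR]_w ((LR0 w).1 `^ gamma)%:E)%E.
pose IR := (\int[PLR]_w ((LR0 w).2 `^ gamma)%:E)%E.
have IL0 : (0 <= IL)%E by apply: integral_ge0 => w _; rewrite lee_fin powR_ge0.
have IR0 : (0 <= IR)%E by apply: integral_ge0 => w _; rewrite lee_fin powR_ge0.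
have mE : moment LR0 gamma = (IL + IR)%E by apply: momentE; rewrite gt_eqF.
have mlt1 : (IL + IR < 1)%E.
  by move: calS_gamma; rewrite /calS mE lteBlDr// add0e.
have [aL [aR [aLE aRE a_lt1]]] := ge0_addelt1 IL0 IR0 mlt1.
have SE : `|fine (calS LR0 gamma)| = 1 - (aL + aR).
  by rewrite /calS mE aLE aRE -[fine _]/(aL + aR - 1) ltr0_norm ?subr_lt0// opprB.
have LR_mean : 1 < gamma -> (1 <= \int[PLR]_w ((LR0 w).1 + (LR0 w).2)%:E)%E.
  move=> g1; case: gamma_bounds => [[a1 [ag _]]|[_]]; last by rewrite leNgt g1.
  by apply: (smoothing_mean_ge1 LR0_ge0 a1 ag moment_alpha); rewrite mE ltW.
pose F s : probability R R := distribution P (V LR I X nu s).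
pose Fi : probability R R := distribution PV Vinfty.
pose mu0 : probability R R := distribution P0 X0.
have FE s : 0 <= s -> is_mixture (F s) (tree_weight s) (real_law LR0 mu0).
  move=> s0; exact: (V_law X_law X_indep LR_law LR_indep I_law I_indep nu_gt0 nu_law families_indep s0).
have F_cvg x : no_atom Fi x ->
    (F s `]-oo, x]%classic @[s --> +oo%R] --> Fi `]-oo, x]%classic)%E.
  by move=> Fix0; exact/V_cvg/continuous_cdf_no_atom.
have A0 : 0 < A by rewrite /A; case: ifP => // _; exact: powR_gt0.
pose ex := expR (- (B * t * `|fine (calS LR0 gamma)|)).
have ex0 : 0 < ex by exact: expR_gt0.
rewrite -/ex muleAC -EFinM [in leRHS]/wasserstein -ereal_inf_pZl ?mulr_gt0//.
apply/ereal_infP => _ [e [dQ [TQ [Q0 [X' [Y' [X'E Y'E ->]]]]]] <-].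
set W := Num.max gamma 1.
have W0 : 0 < W^-1 by rewrite invr_gt0 lt_max gamma0.
rewrite unlock; set E := (\int[Q0]_w _)%E.
have E0 : (0 <= E)%E by apply: integral_ge0 => w _; rewrite lee_fin powR_ge0.
have [Ey|Efin] := eqVneq E +oo%E.
  by rewrite Ey poweRyr ?gt_eqF// gt0_muley ?leey// lte_fin mulr_gt0.
have ME : E = (fine E)%:E by rewrite fineK// ge0_fin_numE// ltey.
set M := fine E in ME.
have M0 : 0 <= M by exact: fine_ge0.
have [Q1 Q2 Q3] := contracted_coupling LR0_ge0 gamma0 gamma_le2 aLE aRE a_lt1
  LR_mean FE F_cvg (eq_cdf_distribution X'E) (eq_cdf_distribution Y'E) t0 ME.
set Q := flow LR0 (pair_law X' Y') t0 in Q1 Q2 Q3.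
apply: ge_ereal_inf; exists ('E_Q[fun p => (`|first3 p - second3 p| `^ gamma)%R] `^ W^-1)%E.
  exists _, (R * R * R)%type, Q, first3, second3; split => // r.
    exact: (Q1 _ (measurable_itv `]-oo, r])).
  exact: (Q2 _ (measurable_itv `]-oo, r])).
rewrite unlock.
have -> : (\int[Q]_p (`|first3 p - second3 p| `^ gamma)%:E =
    \int[Q]_p (`|gap 0 p| `^ gamma)%:E)%E.
  by apply: eq_integral => p _; rewrite /gap mul0r subr0.
rewrite ME poweR_EFin -EFinM.
have Qpos : (0 <= \int[Q]_p (`|gap 0 p| `^ gamma)%:E)%E.
  by apply: integral_ge0 => p _; rewrite lee_fin powR_ge0.
have := gt0_ler_poweR (ltW W0) _ _ Q3; rewrite !in_itv/= !leey !andbT.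
rewrite Qpos => /(_ isT); rewrite lee_fin mulr_ge0 ?expR_ge0//; last by case: ifP => // _; rewrite mulr_ge0.
move=> /(_ isT) /le_trans; apply; rewrite lee_fin /A /ex SE /B /W.
have [g1|g1] := leP gamma 1.
  rewrite invr1 !powRr1 ?mulr_ge0 ?expR_ge0// le_eqVlt; apply/orP; left; apply/eqP.
  by rewrite !mul1r mulrC; congr (expR (- _) * _); ring.
rewrite powRM ?mulr_ge0 ?expR_ge0// powRM// -expRM.
rewrite mulrAC le_eqVlt; apply/orP; left; apply/eqP; congr (_ * expR _ * _).
by rewrite mulNr; congr (- _); ring.
Qed.
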